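(* There exists a unique algebra morphism $\tilde{\mathcal{A}}_+^{\mathrm{ex}}:\mathcal{T}_+^{\mathrm{ex}}\to\hat{\mathcal{T}}_+^{\mathrm{ex}}$ (the ''positive twisted antipode'') such that $\tilde{\mathcal{A}}_+^{\mathrm{ex}}X_i=-X_i$ and, for all $\mathcal{J}_k^{\mathfrak{t}}(\tau)\in\mathcal{T}_+^{\mathrm{ex}}$, $$\tilde{\mathcal{A}}_+^{\mathrm{ex}}\mathcal{J}_k^{\mathfrak{t}}(\tau)=-\sum_{\ell\in\mathbb{N}^d}\frac{(-X)^\ell}{\ell!}\,P_+\hat{\mathcal{M}}_+^{\mathrm{ex}}\bigl(\hat{\mathcal{J}}_{k+\ell}^{\mathfrak{t}}\otimes\tilde{\mathcal{A}}_+^{\mathrm{ex}}\bigr)\Delta^+_{\mathrm{ex}}\tau,$$ where $\hat{\mathcal{M}}_+^{\mathrm{ex}}$ is the (tree) product of $\hat{\mathcal{T}}_+^{\mathrm{ex}}$ and $\Delta^+_{\mathrm{ex}}:\mathcal{T}^{\mathrm{ex}}\to\mathcal{T}^{\mathrm{ex}}\otimes\mathcal{T}_+^{\mathrm{ex}}$.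
   Context: Decorated forests. $\mathbb{N}=\{0,1,\dots\}$; fix $d\ge1$ and a finite set $\mathfrak{L}$ of types; $\mathbb{Z}(\mathfrak{L})$ is the free abelian group on $\mathfrak{L}$. A typed rooted forest $F$ is a finite, possibly empty, forest with nodes $N_F$, edges $E_F$, a root in each connected component, edges written $(x,y)$ with $x$ nearer to the root, and a type map $\mathfrak{t}:E_F\to\mathfrak{L}$. A subforest $A\subset F$ is given by $E_A\subset E_F$, $N_A\subset N_F$, $N_A$ containing all endpoints of $E_A$. A decorated forest is $\tau=(F,\hat F,\mathfrak{n},\mathfrak{o},\mathfrak{e})$ with a colouring $\hat F:E_F\sqcup N_F\to\mathbb{N}$ such that $\hat F(x)=\hat F(y)=\hat F(e)$ whenever $\hat F(e)\ne0$, $e=(x,y)$; and maps $\mathfrak{n}:N_F\to\mathbb{N}^d$, $\mathfrak{o}:N_F\to\mathbb{Z}^d\oplus\mathbb{Z}(\mathfrak{L})$ vanishing where $\hat F=0$, $\mathfrak{e}:E_F\to\mathbb{N}^d$ vanishing where $\hat F\ne0$. $\hat F_i$ ($i>0$) is the subforest of colour $i$; $\hat F\le i$ means all colours are $\le i$. Isomorphic decorated forests are identified; $\mathfrak{F}$ is the set of all of them. $\cdot$ is disjoint union; $\bullet$ is the one-node tree; a number in place of $\hat F$ means a constant colouring. Bigrading. $|\tau|_{\mathrm{bi}}=(n_1,n_2)$, $n_1=\sum_e\sum_j\mathfrak{e}(e)_j$, $n_2$ the number of non-root nodes and edges of colour $0$. For $S\subset\mathfrak{F}$, $\langle S\rangle$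 is the space of formal series $\sum_{n\in\mathbb{N}^2}v_n$, $v_n$ in the free real vector space on $\{\tau\in S:|\tau|_{\mathrm{bi}}=n\}$, with $v_n=0$ for $n_2$ large. Coproduct. $\mathfrak{A}_2(F,\hat F)$: all subforests $A\supset\hat F_2$ such that, for each connected component $T$ of $F$, $T\cap A$ is connected and contains the root of $T$, and each connected component of $\hat F_1$ is contained in $A$ or disjoint from $A$. $$\Delta_2\tau=\sum_{A\in\mathfrak{A}_2(F,\hat F)}\sum_{\varepsilon,\mathfrak{n}_A}\tfrac{1}{\varepsilon!}\tbinom{\mathfrak{n}}{\mathfrak{n}_A}(A,\hat F\restriction A,\mathfrak{n}_A+\pi\varepsilon,\mathfrak{o}\restriction N_A,\mathfrak{e}\restriction E_A)\otimes(F,\hat F\cup_2A,\mathfrak{n}-\mathfrak{n}_A,\mathfrak{o}+\mathfrak{n}_A+\pi(\varepsilon-\mathfrak{e}\mathbf{1}_{E_A}),\mathfrak{e}\mathbf{1}_{E_F\setminus E_A}+\varepsilon),$$ where $\hat F\cup_2A$ equals $2$ on $A$ and $\hat F$ elsewhere, $\mathfrak{n}_A:N_F\to\mathbb{N}^d$ is supported in $N_A$ with $\mathfrak{n}_A\le\mathfrak{n}$, $\varepsilon:E_F\to\mathbb{N}^d$ is supported in $\partial(A,F)=\{(x,y)\in E_F\setminus E_A:x\in N_A\}$, $(\pi\varepsilon)(x)=\sum_{(x,y)\in E_F}\varepsilon((x,y))$; factorials and binomials are products over nodes/edges and components. Contractions. $\mathcal{K}$ contracts every connected component of the graph of edges of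 nonzero colour to one node, sums $\mathfrak{n}$ over it, restricts $\mathfrak{e}$ to the remaining edges, and gives the new node the sum of the $\mathfrak{o}$'s plus the sum of the types of the contracted edges as $\mathfrak{o}$-decoration. $\Phi_i$: write $\tau=\mu\cdot\nu$ with $\nu$ the product of all components entirely of colour $i$; then $\Phi_i\tau=\mu\cdot(\bullet,i,\sum_{N_\nu}\mathfrak{n},0,0)$. $\hat P_i$ sets $\mathfrak{o}$ to $0$ on the connected components of $\hat F_i$ containing a root. $\mathcal{K}_i=\Phi_i\mathcal{K}$, $\hat{\mathcal{K}}_i=\hat P_i\Phi_i\mathcal{K}$. $\mathscr{J}$ identifies all roots (defined when all roots have colour in $\{0,i\}$ for one $i$), summing $\mathfrak{n}$ and $\mathfrak{o}$ and taking the maximal colour. The tree product is $\tau\bar\tau=\mathscr{J}(\tau\cdot\bar\tau)$. Spaces. $\mathfrak{F}_\circ$: trees with $\hat F\le1$; $\mathfrak{F}_2$: forests with $\hat F\le2$ such that, for each component $T$, $\hat F_2\cap T$ is a subtree containing the root of $T$. $\mathcal{H}_\circ=\langle\mathfrak{F}_\circ\rangle/\ker\mathcal{K}$, $\hat{\mathcal{H}}_2=\langle\mathfrak{F}_2\rangle/\ker(\mathscr{J}\hat{\mathcal{K}}_2)$, with bases $H_\circ=\mathcal{K}\mathfrak{F}_\circ$, $\hat H_2=\mathscr{J}\hat{\mathcal{K}}_2\mathfrak{F}_2$ (in the series sense); $\hat{\mathcal{H}}_2$ has the tree product; $\mathbf{1}_2$ is the class of the empty forest. $\Delta_2$ descends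 to these spaces. $X^k=(\bullet,2,k,0,0)\in\hat{\mathcal{H}}_2$, $X_i=X^k$ with $k$ the $i$-th canonical basis vector. $\mathcal{I}_k^{\mathfrak{t}}(\tau)$ (resp. $\hat{\mathcal{J}}_k^{\mathfrak{t}}(\tau)$) is obtained from the tree $\tau\in H_\circ$ by adding a new root of colour $0$ (resp. $2$) with zero decorations, joined to the old root by an edge of type $\mathfrak{t}$ and $\mathfrak{e}$-decoration $k$. Degrees and rules. Fix $\mathfrak{s}:\{1,\dots,d\}\to[1,\infty)$ and $|\cdot|_{\mathfrak{s}}:\mathfrak{L}\to\mathbb{R}\setminus\{0\}$; $|k|_{\mathfrak{s}}=\sum_jk_j\mathfrak{s}_j$, extended additively to $\mathbb{Z}^d\oplus\mathbb{Z}(\mathfrak{L})$. Set $|\tau|_-=\sum_{\hat F(e)=0}(|\mathfrak{t}(e)|_{\mathfrak{s}}-|\mathfrak{e}(e)|_{\mathfrak{s}})+\sum_x|\mathfrak{n}(x)|_{\mathfrak{s}}$ and $|\tau|_+=\sum_{\hat F(e)\ne2}(|\mathfrak{t}(e)|_{\mathfrak{s}}-|\mathfrak{e}(e)|_{\mathfrak{s}})+\sum_x|\mathfrak{n}(x)|_{\mathfrak{s}}+\sum_{\hat F(x)\ne2}|\mathfrak{o}(x)|_{\mathfrak{s}}$. $\mathfrak{T}$ is the set of decorated trees with $\hat F=0$, $\mathfrak{o}=0$, written $(T,\mathfrak{n},\mathfrak{e})$; on it $|\cdot|_{\mathfrak{s}}:=|\cdot|_-$. $\mathcal{S}$ forgets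 $\hat F$ and $\mathfrak{o}$. Node types are finite multisets of elements of $\mathfrak{L}\times\mathbb{N}^d$ (with $\subset,\sqcup,\setminus$ for multisets, $()$ the empty one); the type $\mathcal{N}(x)$ of a node is the multiset of $(\mathfrak{t}(e),\mathfrak{e}(e))$ over edges $e=(x,y)$. A rule $R$ maps each $\mathfrak{t}\in\mathfrak{L}$ to a nonempty set of node types; it is normal if $M\subset N\in R(\mathfrak{t})$ implies $M\in R(\mathfrak{t})$. A tree conforms to $R$ at a non-root node $x$ if $\mathcal{N}(x)\in R(\mathfrak{t}(e))$ for the edge $e$ joining $x$ to its parent, and at the root if $\mathcal{N}(x)\in R(\mathfrak{t})$ for some $\mathfrak{t}$. $\mathfrak{T}_\circ(R)$: trees in $\mathfrak{T}$ conforming at all nodes; $\mathfrak{T}_2(R)$: trees conforming at all nodes except possibly the root; $\mathfrak{T}_-(R)$: $\tau\in\mathfrak{T}_\circ(R)$ with $|\tau|_{\mathfrak{s}}<0$, root decoration $\mathfrak{n}(\rho)=0$ and $\tau$ not of the form $\mathcal{I}_k^{\mathfrak{t}}(\bar\tau)$ with $|\mathfrak{t}|_{\mathfrak{s}}>0$. $R$ is subcritical if some $\mathrm{reg}:\mathfrak{L}\to\mathbb{R}$ satisfies $\mathrm{reg}(\mathfrak{t})<|\mathfrak{t}|_{\mathfrak{s}}+\inf_{N\in R(\mathfrak{t})}\sum_{(\mathfrak{t}',k)\in N}(\mathrm{reg}(\mathfrak{t}')-|k|_{\mathfrak{s}})$ for all $\mathfrak{t}$. For $m\in\mathbb{N}^d$,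 $\partial^mN$ is the set of node types obtained from $N=((\mathfrak{t}_1,k_1),\dots,(\mathfrak{t}_n,k_n))$ by replacing $k_j$ with $k_j+m_j$, $\sum_jm_j=m$. For a tree in $\mathfrak{T}_\circ(R)$ define, from the leaves down, $\mathcal{M}(y)=\bar{\mathcal{N}}(e_1)\times\dots\times\bar{\mathcal{N}}(e_\ell)$ for a node $y$ with outgoing edges $e_1,\dots,e_\ell$ ($\{()\}$ if $y$ is a leaf), and for $e=(x,y)$, $\bar{\mathcal{N}}(e)=\{(N\setminus\mathcal{N}(y))\sqcup M_1\sqcup\dots\sqcup M_\ell:\mathcal{N}(y)\subset N\in R(\mathfrak{t}(e)),M\in\mathcal{M}(y)\}$. $R$ is complete if it is normal and, for all $\tau\in\mathfrak{T}_-(R)$ with root $\rho$, all $\mathfrak{t}$, $N\in R(\mathfrak{t})$ with $\mathcal{N}(\rho)\subset N$, $M\in\mathcal{M}(\rho)$ and $m$ with $|m|_{\mathfrak{s}}+|\tau|_{\mathfrak{s}}<0$, one has $\partial^m((N\setminus\mathcal{N}(\rho))\sqcup M_1\sqcup\dots\sqcup M_\ell)\subset R(\mathfrak{t})$. Throughout, $R$ is a fixed subcritical complete rule with $R(\mathfrak{t})=\{()\}$ whenever $|\mathfrak{t}|_{\mathfrak{s}}<0$. Spaces determined by $R$. For $T=(G,\mathfrak{n}',\mathfrak{e}')\in\mathfrak{T}$ and $x\in N_G$, $D(x,T)$ is the set of $\alpha\in\mathbb{Z}^d\oplus\mathbb{Z}(\mathfrak{L})$ for which there exist $\sigma=(F,\mathfrak{n},\mathfrak{e})\in\mathfrak{T}$,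 a subtree $A\subset F$ such that $\sigma$ conforms to $R$ at every node of $A$, and maps $\mathfrak{n}_A\le\mathfrak{n}$ supported in $N_A$ and $\varepsilon$ supported in $\partial(A,F)$, such that $(A,0,\mathfrak{n}_A+\pi\varepsilon,0,\mathfrak{e})\in\mathfrak{T}_-(R)$ and $(G,\mathbf{1}_{\{x\}},\mathfrak{n}',\alpha\mathbf{1}_{\{x\}},\mathfrak{e}')=\mathcal{K}_1(F,\mathbf{1}_A,\mathfrak{n}-\mathfrak{n}_A,\mathfrak{n}_A+\pi(\varepsilon-\mathfrak{e}\mathbf{1}_{E_A}),\mathfrak{e}\mathbf{1}_{E_F\setminus E_A}+\varepsilon)$, and in particular $\alpha=\sum_{N_A}(\mathfrak{n}_A+\pi(\varepsilon-\mathfrak{e}\mathbf{1}_{E_A}))$. $\Lambda$ is the set of all $\tau=(F,\hat F,\mathfrak{n},\mathfrak{o},\mathfrak{e})\in\mathfrak{F}$ with $\tau=\mathcal{K}_1\tau$ such that, for each $x\in N_F$, exactly one of the following holds: $\hat F(x)\in\{0,2\}$ and $\mathfrak{o}(x)=0$; or $\hat F(x)=1$ and $\mathfrak{o}(x)\in D(x,\mathcal{S}\tau)$. $\mathcal{T}^{\mathrm{ex}}=\langle B_\circ\rangle$, $\hat{\mathcal{T}}^{\mathrm{ex}}_+=\langle B_+\rangle$ where $B_\circ,B_+$ are the sets of $\tau\in\Lambda$ in $H_\circ,\hat H_2$ with $\mathcal{S}\tau$ in $\mathfrak{T}_\circ(R),\mathfrak{T}_2(R)$ respectively. $\mathcal{J}_-\subset\hat{\mathcal{T}}^{\mathrm{ex}}_+$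 is spanned (in the sense $\langle\cdot\rangle$) by the $\tau\in B_+$ of the form $\mathscr{J}\hat{\mathcal{K}}_2(\sigma\cdot\bar\sigma)$, $\sigma,\bar\sigma\in B_+$, $\sigma\ne\mathbf{1}_2$, $|\sigma|_+\le0$. $\mathcal{T}_+^{\mathrm{ex}}=\hat{\mathcal{T}}_+^{\mathrm{ex}}/\mathcal{J}_-$ with projection $\mathfrak{p}_+^{\mathrm{ex}}$; $\mathcal{J}_k^{\mathfrak{t}}=\mathfrak{p}_+^{\mathrm{ex}}\hat{\mathcal{J}}_k^{\mathfrak{t}}:\mathcal{T}^{\mathrm{ex}}\to\mathcal{T}_+^{\mathrm{ex}}$; $\mathcal{J}_k^{\mathfrak{t}}(\tau)$ is a non-zero element of $\mathcal{T}_+^{\mathrm{ex}}$ (for $\tau\in B_\circ$) if and only if $|\tau|_++|\mathfrak{t}|_{\mathfrak{s}}-|k|_{\mathfrak{s}}>0$. $\Delta^+_{\mathrm{ex}}=(\mathrm{id}\otimes\mathfrak{p}_+^{\mathrm{ex}})\Delta_2$ is well defined on $\mathcal{T}^{\mathrm{ex}}$. $P_+:\hat{\mathcal{T}}_+^{\mathrm{ex}}\to\hat{\mathcal{T}}_+^{\mathrm{ex}}$ is the linear map with $P_+\tau=\tau$ for $\tau\in B_+$ with $|\tau|_+>0$ and $P_+\tau=0$ for other $\tau\in B_+$.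
   Formalization: In the definitions of D(x,T) and Λ the contraction K replaces K_1 = Φ_1 K, since with Φ_1 as displayed B_+ would be empty and contain no X_i; accordingly α includes the types of the contracted edges, and the displayed formula for α without them is dropped. *)

(* Defs.v *)
From HB Require Import structures.
From mathcomp Require Import all_boot all_order all_algebra.
From mathcomp Require Import finmap multiset generic_quotient ring_quotient.
From mathcomp Require Import all_classical all_reals ereal.

Set Implicit Arguments.
Unset Strict Implicit.
Unset Printing Implicit Defensive.

Import Order.TTheory GRing.Theory Num.Theory.
Local Open Scope classical_set_scope.
Local Open Scope ring_scope.
Local Open Scope quotient_scope.

(* Multi-indices, and values of the o-decoration: Z^d (+) Z(L). *)
Definition mindex (d : nat) := {ffun 'I_d -> nat}.
Definition odeco (d : nat) (L : finType) :=
  ({ffun 'I_d -> int} * {ffun L -> int})%type.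

HB.instance Definition _ d := GRing.Nmodule.on (mindex d).
HB.instance Definition _ d L := GRing.Zmodule.on (odeco d L).

Section DecoratedForests.
Variables (d : nat) (L : finType).
Local Notation mindex := (mindex d).
Local Notation odeco := (odeco d L).

Definition mvec (k : mindex) : odeco := ([ffun j => (k j)%:Z], 0).
Definition mtyp (t : L) : odeco := (0, [ffun t' => ((t' == t) : nat)%:Z]).
Definition munit (i : 'I_d) : mindex := [ffun j => (j == i) : nat].

(* A finite graph with the data of a decorated forest.  The edge e is
   (src e, tgt e), the source being the end nearer to the root.  The axioms are
   imposed separately (dforest), so that the operations below are total. *)
Record dgraph := DGraph {
  node : finType;
  edge : finType;
  src : edge -> node;
  tgt : edge -> node;
  typ : edge -> L;
  ncol : node -> nat;
  ecol : edge -> nat;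
  ndec : node -> mindex;
  odec : node -> odeco;
  edec : edge -> mindex }.

Definition dgraph_iso (g h : dgraph) : Prop :=
  exists (fN : node g -> node h) (fE : edge g -> edge h),
    [/\ bijective fN, bijective fE,
        forall e, src (fE e) = fN (src e) /\ tgt (fE e) = fN (tgt e),
        forall x, [/\ ncol (fN x) = ncol x, ndec (fN x) = ndec x
                    & odec (fN x) = odec x]
      & forall e, [/\ typ (fE e) = typ e, ecol (fE e) = ecol e
                    & edec (fE e) = edec e] ].

(* Isomorphism classes are classes of graphs on ordinals: dgraph itself, whose
   nodes and edges may be any finTypes, is too large to be a choiceType. *)
Record ograph := OGraph {
  onode : nat;
  oedge : nat;
  osrc : 'I_oedge -> 'I_onode;
  otgt : 'I_oedge -> 'I_onode;
  otyp : 'I_oedge -> L;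
  oncol : 'I_onode -> nat;
  oecol : 'I_oedge -> nat;
  ondec : 'I_onode -> mindex;
  oodec : 'I_onode -> odeco;
  oedec : 'I_oedge -> mindex }.

HB.instance Definition _ := gen_eqMixin ograph.
HB.instance Definition _ := gen_choiceMixin ograph.

Definition to_dgraph (g : ograph) : dgraph :=
  @DGraph 'I_(onode g) 'I_(oedge g) (@osrc g) (@otgt g) (@otyp g) (@oncol g)
    (@oecol g) (@ondec g) (@oodec g) (@oedec g).

Definition of_dgraph (g : dgraph) : ograph :=
  @OGraph #|node g| #|edge g|
    (fun e => enum_rank (src (enum_val e))) (fun e => enum_rank (tgt (enum_val e)))
    (fun e => typ (enum_val e)) (fun x => ncol (enum_val x))
    (fun e => ecol (enum_val e)) (fun x => ndec (enum_val x))
    (fun x => odec (enum_val x)) (fun e => edec (enum_val e)).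

Lemma dgraph_iso_refl g : dgraph_iso g g.
Proof. by exists id, id; split => //; exists id. Qed.

Lemma dgraph_iso_sym g h : dgraph_iso g h -> dgraph_iso h g.
Proof.
case=> fN [fE [[gN fgN gfN] [gE fgE gfE] st nn ee]].
exists gN, gE; split; first by exists fN.
- by exists fE.
- by move=> e; have [] := st (gE e); rewrite gfE => -> ->; rewrite !fgN.
- by move=> x; have [] := nn (gN x); rewrite gfN.
- by move=> e; have [] := ee (gE e); rewrite gfE.
Qed.

Lemma dgraph_iso_trans h g k :
  dgraph_iso g h -> dgraph_iso h k -> dgraph_iso g k.
Proof.
move=> [fN [fE [bN bE st nn ee]]] [fN' [fE' [bN' bE' st' nn' ee']]].
exists (fN' \o fN), (fE' \o fE); split.
- exact: bij_comp.
- exact: bij_comp.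
- by move=> e /=; have [<- <-] := st e; have [] := st' (fE e).
- by move=> x /=; have [<- <- <-] := nn x; have [] := nn' (fN x).
- by move=> e /=; have [<- <- <-] := ee e; have [] := ee' (fE e).
Qed.

Definition oiso (g h : ograph) : bool :=
  `[< dgraph_iso (to_dgraph g) (to_dgraph h) >].

Lemma oiso_is_equiv : equiv_class_of oiso.
Proof.
split=> [g|g h|h g k]; first by apply/asboolP; exact: dgraph_iso_refl.
  by apply: asbool_equiv_eq; split; exact: dgraph_iso_sym.
by move=> /asboolP gh /asboolP hk; apply/asboolP; exact: dgraph_iso_trans gh hk.
Qed.

Canonical oiso_equiv := EquivRelPack oiso_is_equiv.
Definition iclass := {eq_quot oiso}.
HB.instance Definition _ := Choice.on iclass.
Definition cls (g : dgraph) : iclass := \pi_iclass (of_dgraph g).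
Definition rep (c : iclass) : dgraph := to_dgraph (repr c).

Section Graph.
Variable g : dgraph.

Definition isroot (x : node g) : bool := [forall e : edge g, tgt e != x].

Definition earc : rel (node g) :=
  fun x y => [exists e : edge g, (src e == x) && (tgt e == y)].

Definition rooted_forest : Prop :=
  injective (@tgt g) /\ forall e : edge g, ~~ connect earc (tgt e) (src e).

(* x and y are connected by an undirected path of edges in E *)
Definition joined (E : {set edge g}) : rel (node g) :=
  connect (fun x y => [exists e in E, ((src e == x) && (tgt e == y))
                                  || ((src e == y) && (tgt e == x))]).

Definition dforest : Prop :=
  [/\ rooted_forest,
      forall e : edge g, ecol e != 0%N ->
        ncol (src e) = ecol e /\ ncol (tgt e) = ecol e,
      forall x : node g, ncol x = 0%N -> odec x = 0
    & forall e : edge g, ecol e != 0%N -> edec e = 0].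

Definition is_tree : Prop :=
  (0 < #|node g|)%N /\ forall x y : node g, joined finset.setT x y.

Definition col_le (i : nat) : Prop :=
  (forall x : node g, (ncol x <= i)%N) /\ (forall e : edge g, (ecol e <= i)%N).

Definition ecolset (i : nat) : {set edge g} := [set e | ecol e == i]%SET.

Definition bi1 : nat := (\sum_(e : edge g) \sum_(j < d) edec e j)%N.
Definition bi2 : nat :=
  (#|[set x : node g | ~~ isroot x & ncol x == 0%N]%SET|
   + #|[set e : edge g | ecol e == 0%N]%SET|)%N.

End Graph.

Definition is_subforest (g : dgraph) (A : {set node g} * {set edge g}) : bool :=
  [forall e in A.2, (src e \in A.1) && (tgt e \in A.1)].

Definition subforest (g : dgraph) :=
  {A : {set node g} * {set edge g} | is_subforest A}.
HB.instance Definition _ g := Choice.on (subforest g).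

Definition sN (g : dgraph) (A : subforest g) : {set node g} := (val A).1.
Definition sE (g : dgraph) (A : subforest g) : {set edge g} := (val A).2.

Lemma sub_src (g : dgraph) (A : subforest g) (e : edge g) :
  e \in sE A -> src e \in sN A.
Proof. by move=> eA; have /forall_inP/(_ e eA)/andP[] := valP A. Qed.

Lemma sub_tgt (g : dgraph) (A : subforest g) (e : edge g) :
  e \in sE A -> tgt e \in sN A.
Proof. by move=> eA; have /forall_inP/(_ e eA)/andP[] := valP A. Qed.

Definition subgraph (g : dgraph) (A : subforest g) : dgraph :=
  @DGraph {x : node g | x \in sN A} {e : edge g | e \in sE A}
    (fun e => Sub (src (val e)) (sub_src (valP e)))
    (fun e => Sub (tgt (val e)) (sub_tgt (valP e)))
    (fun e => typ (val e)) (fun x => ncol (val x)) (fun e => ecol (val e))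
    (fun x => ndec (val x)) (fun x => odec (val x)) (fun e => edec (val e)).

Lemma induced_subproof (g : dgraph) (N : {set node g}) :
  is_subforest (N, [set e : edge g | (src e \in N) && (tgt e \in N)]%SET).
Proof. by apply/forall_inP => e; rewrite inE. Qed.

Definition induced (g : dgraph) (N : {set node g}) : subforest g :=
  Sub _ (induced_subproof N).

Definition redeco (g : dgraph) nc ec n o e : dgraph :=
  @DGraph (node g) (edge g) (@src g) (@tgt g) (@typ g) nc ec n o e.

(* the map S *)
Definition forget (g : dgraph) : dgraph :=
  redeco (fun=> 0%N) (fun=> 0%N) (@ndec g) (fun=> 0) (@edec g).

Definition empty_forest : dgraph :=
  @DGraph void void (fun e => match e with end) (fun e => match e with end)
    (fun e => match e with end) (fun=> 0%N) (fun=> 0%N) (fun=> 0) (fun=> 0)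
    (fun=> 0).

Definition bullet (i : nat) (k : mindex) : dgraph :=
  @DGraph unit void (fun e => match e with end) (fun e => match e with end)
    (fun e => match e with end) (fun=> i) (fun=> 0%N) (fun=> k) (fun=> 0)
    (fun=> 0).

Definition sumf (A B C : Type) (f : A -> C) (h : B -> C) (x : A + B) : C :=
  match x with inl a => f a | inr b => h b end.

Definition dunion (g h : dgraph) : dgraph :=
  @DGraph (node g + node h)%type (edge g + edge h)%type
    (sumf (fun e => inl (src e)) (fun e => inr (src e)))
    (sumf (fun e => inl (tgt e)) (fun e => inr (tgt e)))
    (sumf (@typ g) (@typ h)) (sumf (@ncol g) (@ncol h))
    (sumf (@ecol g) (@ecol h)) (sumf (@ndec g) (@ndec h))
    (sumf (@odec g) (@odec h)) (sumf (@edec g) (@edec h)).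

Section Contraction.
Variable g : dgraph.

Definition block (x : node g) : {set node g} :=
  [set y | joined [set e | ecol e != 0%N]%SET x y]%SET.

Definition blocks : {set {set node g}} := [set block x | x : node g]%SET.

Lemma block_in (x : node g) : block x \in blocks.
Proof. exact: imset_f. Qed.

Definition to_block (x : node g) : {C : {set node g} | C \in blocks} :=
  exist _ (block x) (block_in x).

(* the map K; all the nodes of a block have the same colour *)
Definition Kcontract : dgraph :=
  @DGraph {C : {set node g} | C \in blocks} {e : edge g | ecol e == 0%N}
    (fun e => to_block (src (val e))) (fun e => to_block (tgt (val e)))
    (fun e => typ (val e))
    (fun C => \max_(x in val C) ncol x) (fun e => ecol (val e))
    (fun C => \sum_(x in val C) ndec x)
    (fun C => \sum_(x in val C) odec x
       + \sum_(e : edge g | (ecol e != 0%N) && (src e \in val C)) mtyp (typ e))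
    (fun e => edec (val e)).

(* the component of x is entirely of colour i *)
Definition mono (i : nat) (x : node g) : bool :=
  [forall y, joined finset.setT x y ==> (ncol y == i)]
  && [forall e : edge g, joined finset.setT x (src e) ==> (ecol e == i)].

Definition Phi (i : nat) : dgraph :=
  dunion (subgraph (induced [set x | ~~ mono i x]%SET))
         (bullet i (\sum_(x | mono i x) ndec x)).

Definition Phat (i : nat) : dgraph :=
  redeco (@ncol g) (@ecol g) (@ndec g)
    (fun x => if (ncol x == i)
                 && [exists y, isroot y && joined (ecolset g i) x y]
              then 0 else odec x)
    (@edec g).

(* the map J; the merged root is None *)
Definition join_roots : dgraph :=
  let q (x : node g) : option {x : node g | ~~ isroot x} := insub x in
  @DGraph (option {x : node g | ~~ isroot x}) (edge g)
    (fun e => q (src e)) (fun e => q (tgt e)) (@typ g)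
    (fun x => if x is Some y then ncol (val y)
              else \max_(z : node g | isroot z) ncol z)
    (@ecol g)
    (fun x => if x is Some y then ndec (val y)
              else \sum_(z : node g | isroot z) ndec z)
    (fun x => if x is Some y then odec (val y)
              else \sum_(z : node g | isroot z) odec z)
    (@edec g).

(* I_k^t for i = 0 and hat J_k^t for i = 2; the new root None is joined to
   every root of g, i.e. to the root of g when g is a tree *)
Definition plant (i : nat) (t : L) (k : mindex) : dgraph :=
  @DGraph (option (node g)) ({x : node g | isroot x} + edge g)%type
    (sumf (fun=> None) (fun e => Some (src e)))
    (sumf (fun r => Some (val r)) (fun e => Some (tgt e)))
    (sumf (fun=> t) (@typ g))
    (fun x => if x is Some y then ncol y else i)
    (sumf (fun=> 0%N) (@ecol g))
    (fun x => if x is Some y then ndec y else 0)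
    (fun x => if x is Some y then odec y else 0)
    (sumf (fun=> k) (@edec g)).

End Contraction.

Definition Khat (i : nat) (g : dgraph) : dgraph := Phat (Phi (Kcontract g) i) i.

Definition JKhat2 (g : dgraph) : dgraph := join_roots (Khat 2 g).

Section Cut.
Variables (g : dgraph) (A : subforest g).
Variables (eps : {ffun edge g -> mindex}) (nA : {ffun node g -> mindex}).

Definition sub_tree : Prop :=
  (exists x, x \in sN A) /\ {in sN A &, forall x y, joined (sE A) x y}.

(* membership of A in frakA_2(F, hat F) *)
Definition frakA2 : Prop :=
  [/\ (forall x : node g, ncol x = 2%N -> x \in sN A)
        /\ (forall e : edge g, ecol e = 2%N -> e \in sE A),
      (* A meets each component in a connected set containing the root *)
      {in sN A &, forall x y, joined finset.setT x y -> joined (sE A) x y}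
        /\ (forall x : node g, isroot x -> x \in sN A)
    & (* the component of hat F_1 at x is contained in A or disjoint from it *)
      forall x : node g, ncol x = 1%N ->
        let CN := [set y | joined (ecolset g 1) x y]%SET in
        let CE := [set e in ecolset g 1 | src e \in CN]%SET in
        (CN \subset sN A /\ CE \subset sE A)
        \/ (CN :&: sN A)%SET = finset.set0 /\ (CE :&: sE A)%SET = finset.set0].

Definition cut_supp : Prop :=
  [/\ forall x j, (nA x j <= ndec x j)%N,
      forall x, x \notin sN A -> nA x = 0
    & forall e, ~~ ((e \notin sE A) && (src e \in sN A)) -> eps e = 0].

(* the decorations n - n_A, n_A + pi(eps - e 1_{E_A}), e 1_{E_F \ E_A} + eps *)
Definition cut_n (x : node g) : mindex := [ffun j => (ndec x j - nA x j)%N].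
Definition cut_o (x : node g) : odeco :=
  mvec (nA x) + \sum_(e : edge g | src e == x)
    (mvec (eps e) - mvec (if e \in sE A then edec e else 0)).
Definition cut_e (e : edge g) : mindex :=
  (if e \in sE A then 0 else edec e) + eps e.

Definition cut_left : dgraph :=
  @subgraph (redeco (@ncol g) (@ecol g)
               (fun x => nA x + \sum_(e : edge g | src e == x) eps e)
               (@odec g) (@edec g)) A.

Definition cut_right : dgraph :=
  redeco (fun x => if x \in sN A then 2%N else ncol x)
         (fun e => if e \in sE A then 2%N else ecol e)
         cut_n (fun x => odec x + cut_o x) cut_e.

Definition extracted : dgraph :=
  redeco (fun x => (x \in sN A) : nat) (fun e => (e \in sE A) : nat)
         cut_n cut_o cut_e.

Definition cut_coef (R : realType) : R :=
  (\prod_(x : node g) \prod_(j < d) 'C(ndec x j, nA x j))%N%:R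
  / (\prod_(e : edge g) \prod_(j < d) (eps e j)`!)%N%:R.

End Cut.

(* The coefficients, on pairs of basis elements of H_o and hat H_2, of Delta_2
   on these quotients, i.e. of (K (x) J hat K_2) Delta_2.  The sum is finite. *)
Definition Delta2 (R : realType) (g : dgraph) (c : iclass * iclass) : R :=
  \sum_(z \in [set z : subforest g * {ffun edge g -> mindex}
                         * {ffun node g -> mindex}
       | [/\ frakA2 z.1.1, cut_supp z.1.1 z.1.2 z.2,
             cls (Kcontract (cut_left z.1.1 z.1.2 z.2)) = c.1
           & cls (JKhat2 (cut_right z.1.1 z.1.2 z.2)) = c.2]])
    cut_coef z.1.2 z.2 R.

Definition F_circ (g : dgraph) : Prop := [/\ dforest g, is_tree g & col_le g 1].

Definition F_two (g : dgraph) : Prop :=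
  [/\ dforest g, col_le g 2,
      forall x : node g, isroot x -> ncol x = 2%N
    & forall x y : node g, ncol x = 2%N -> ncol y = 2%N ->
        joined finset.setT x y -> joined (ecolset g 2) x y].

Definition H_circ : set iclass :=
  [set c | exists2 g, F_circ g & c = cls (Kcontract g)].
Definition H_two : set iclass :=
  [set c | exists2 g, F_two g & c = cls (JKhat2 g)].

Definition bideg (c : iclass) : nat * nat := (bi1 (rep c), bi2 (rep c)).
Definition Xmon (k : mindex) : iclass := cls (bullet 2 k).
Definition one2 : iclass := cls (JKhat2 empty_forest).
Definition tprod (c c' : iclass) : iclass :=
  cls (join_roots (dunion (rep c) (rep c'))).
Definition hatJ (t : L) (k : mindex) (c : iclass) : iclass :=
  cls (plant (rep c) 2 t k).

End DecoratedForests.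

Definition node_type (d : nat) (L : finType) := {mset (L * mindex d)%type}%mset.
Definition rule (d : nat) (L : finType) := L -> set (node_type d L).

Section Rules.
Variables (R : realType) (d : nat) (L : finType).
Variables (s : 'I_d -> R) (deg : L -> R) (rl : rule d L).
Local Notation mindex := (mindex d).
Local Notation dgraph := (dgraph d L).
Local Notation node_type := (node_type d L).
Local Notation iclass := (iclass d L).

Definition mnorm (k : mindex) : R := \sum_(j < d) (k j)%:R * s j.
Definition onorm (a : odeco d L) : R :=
  \sum_(j < d) (a.1 j)%:~R * s j + \sum_(t : L) (a.2 t)%:~R * deg t.

Definition deg_minus (g : dgraph) : R :=
  \sum_(e : edge g | ecol e == 0%N) (deg (typ e) - mnorm (edec e))
  + \sum_(x : node g) mnorm (ndec x).
Definition deg_plus (g : dgraph) : R :=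
  \sum_(e : edge g | ecol e != 2%N) (deg (typ e) - mnorm (edec e))
  + \sum_(x : node g) mnorm (ndec x)
  + \sum_(x : node g | ncol x != 2%N) onorm (odec x).

(* trees with no colour; o = 0 is then part of dforest *)
Definition frakT (g : dgraph) : Prop := [/\ dforest g, is_tree g & col_le g 0].

Definition ntype (g : dgraph) (x : node g) : node_type :=
  seq_mset [seq (typ e, edec e) | e <- enum (edge g) & src e == x].

Definition msum (g : dgraph) (M : edge g -> node_type) (y : node g) : node_type :=
  \big[msetD/mset0]_(e : edge g | src e == y) M e.

Definition normal_rule : Prop :=
  forall t M N, rl t N -> (M `<=` N)%mset -> rl t M.

Definition conforms (g : dgraph) (x : node g) : Prop :=
  (forall e : edge g, tgt e = x -> rl (typ e) (ntype x))
  /\ (isroot x -> exists t, rl t (ntype x)).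

Definition T_circ (g : dgraph) : Prop :=
  frakT g /\ forall x : node g, conforms x.
Definition T_two (g : dgraph) : Prop :=
  frakT g /\ forall x : node g, ~~ isroot x -> conforms x.
Definition T_minus (g : dgraph) : Prop :=
  [/\ T_circ g, deg_minus g < 0,
      forall x : node g, isroot x -> ndec x = 0
    & ~ exists (t : L) (k : mindex) (h : dgraph),
          [/\ 0 < deg t, frakT h & dgraph_iso g (plant h 0 t k)]].

Definition subcritical : Prop :=
  exists reg : L -> R, forall t,
    ((reg t)%:E < (deg t)%:E
       + ereal_inf [set (\sum_(p <- enum_mset N) (reg p.1 - mnorm p.2))%:E
                   | N in rl t])%E.

(* the set partial^m N *)
Definition dertype (m : mindex) (N : node_type) : set node_type :=
  [set N' | exists (u : seq (L * mindex)) (v : seq mindex),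
     [/\ N = seq_mset u, size v = size u, \sum_(k <- v) k = m
       & N' = seq_mset [seq (p.1.1, p.1.2 + p.2) | p <- zip u v]]].

(* Nbar e is the set of the same name; an element of cal M(y) is a family
   indexed by the edges going out of y. *)
Inductive Nbar (g : dgraph) : edge g -> node_type -> Prop :=
  NbarI (e : edge g) (N : node_type) (M : edge g -> node_type) :
    rl (typ e) N -> (ntype (tgt e) `<=` N)%mset ->
    (forall e', src e' = tgt e -> Nbar e' (M e')) ->
    Nbar e ((N `\` ntype (tgt e)) `+` msum M (tgt e))%mset.

Definition complete_rule : Prop :=
  normal_rule /\
  forall (g : dgraph) (r : node g), T_minus g -> isroot r ->
  forall (t : L) (N : node_type) (M : edge g -> node_type) (m : mindex),
    rl t N -> (ntype r `<=` N)%mset ->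
    (forall e, src e = r -> Nbar e (M e)) ->
    mnorm m + deg_minus g < 0 ->
    dertype m ((N `\` ntype r) `+` msum M r)%mset `<=` rl t.

Definition mark (g : dgraph) (x : node g) (a : odeco d L) : dgraph :=
  redeco (fun y => (y == x) : nat) (fun=> 0%N) (@ndec d L g)
         (fun y => if y == x then a else 0) (@edec d L g).

(* The set D(x, T).  The contraction is K, not K_1 = Phi_1 K: read literally,
   Phi_1 would multiply the tree by a component (bullet, 1, 0, 0, 0), and it
   would erase alpha when A = F.  The same applies to Lambda below.  By the
   definition of K, alpha includes the types of the edges of A. *)
Definition frakD (g : dgraph) (x : node g) : set (odeco d L) :=
  [set a | exists (f : dgraph) (A : subforest f)
             (eps : {ffun edge f -> mindex}) (nA : {ffun node f -> mindex}),
     [/\ frakT f, sub_tree A /\ {in sN A, forall y, conforms y},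
         cut_supp A eps nA, T_minus (cut_left A eps nA)
       & dgraph_iso (mark x a) (Kcontract (extracted A eps nA))]].

(* the two alternatives are mutually exclusive *)
Definition Lambda (g : dgraph) : Prop :=
  [/\ dforest g, dgraph_iso g (Kcontract g)
    & forall x : node g,
        ((ncol x = 0%N \/ ncol x = 2%N) /\ odec x = 0)
        \/ (ncol x = 1%N /\ @frakD (forget g) x (odec x))].

Definition B_circ : set iclass :=
  [set c | [/\ H_circ c, Lambda (rep c) & T_circ (forget (rep c))]].
Definition B_plus : set iclass :=
  [set c | [/\ H_two c, Lambda (rep c) & T_two (forget (rep c))]].

(* the elements of B_plus spanning J_- *)
Definition B_ideal : set iclass :=
  [set c | B_plus c /\ exists a b : iclass,
     [/\ B_plus a, B_plus b, a <> one2 d L, deg_plus (rep a) <= 0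
       & c = cls (JKhat2 (dunion (rep a) (rep b)))]].

End Rules.

Section Series.
Variables (R : realType) (d : nat) (L : finType).
Local Notation iclass := (iclass d L).
Implicit Types (S : set iclass) (f h : iclass -> R).

(* the space <S> of formal series *)
Definition is_series S f : Prop :=
  [/\ forall c, f c != 0 -> S c,
      forall n, finite_set [set c | f c != 0 /\ bideg c = n]
    & exists k, forall c, f c != 0 -> ((bideg c).2 <= k)%N].

Definition series_pred S : {pred iclass -> R^o} := fun f => `[< is_series S f >].

Lemma series_submod_closed S : submod_closed (series_pred S).
Proof.
split.
  apply/asboolP; split => [c|n|]; rewrite ?eqxx //.
    rewrite (_ : [set _ | _] = set0) ?finite_set0//.
    by apply/seteqP; split => c //= []; rewrite eqxx.
  by exists 0%N => c; rewrite eqxx.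
move=> a f h /asboolP[f1 f2 [k f3]] /asboolP[h1 h2 [k' h3]].
have fh c : (a *: f + h) c != 0 -> f c != 0 \/ h c != 0.
  move=> H; apply: contrapT => /not_orP[/negP/negPn/eqP fc /negP/negPn/eqP hc].
  by move: H; rewrite /= !fctE fc hc scaler0 addr0 eqxx.
apply/asboolP; split.
- by move=> c /fh[/f1|/h1].
- move=> n; apply: sub_finite_set (_ : _ `<=`
    [set c | f c != 0 /\ bideg c = n] `|` [set c | h c != 0 /\ bideg c = n]) _.
    by move=> c [/fh[]]; [left|right].
  by rewrite finite_setU.
- exists (maxn k k') => c /fh[/f3|/h3] le; rewrite leq_max le ?orbT//.
Qed.

HB.instance Definition _ S :=
  GRing.isSubmodClosed.Build R (iclass -> R^o) (series_pred S)
    (series_submod_closed S).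

Definition fseries S := {f : iclass -> R^o | f \in series_pred S}.
HB.instance Definition _ S := SubType.on (fseries S).
HB.instance Definition _ S := Choice.on (fseries S).
HB.instance Definition _ S :=
  [SubChoice_isSubLmodule of fseries S by <:].

Definition ind (c : iclass) : iclass -> R := fun c' => (c' == c)%:R.

(* the bilinear extension of the tree product *)
Definition fmul f h : iclass -> R := fun c =>
  \sum_(p \in [set p : iclass * iclass | tprod p.1 p.2 = c]) f p.1 * h p.2.

End Series.

Section Spaces.
Variables (R : realType) (d : nat) (L : finType).
Variables (s : 'I_d -> R) (deg : L -> R) (rl : rule d L).
Local Notation mindex := (mindex d).
Local Notation iclass := (iclass d L).
Local Notation B_plus := (B_plus s deg rl).

Definition That := fseries R B_plus.
HB.instance Definition _ := GRing.Lmodule.on That.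

(* Default value 0 outside of <B_plus>; it is not reached by products of
   elements of That, nor by basis elements c in B_plus. *)
Definition to_That (f : iclass -> R) : That := insubd (0 : That) f.
Definition fval (v : That) : iclass -> R := \val v.
Definition basis (c : iclass) : That := to_That (ind R c).
Definition mulT (u v : That) : That := to_That (fmul (fval u) (fval v)).
Definition oneT : That := basis (one2 d L).
Definition XT (i : 'I_d) : That := basis (Xmon L (munit i)).

Definition Jminus : {pred That} :=
  fun v => fval v \in series_pred (B_ideal s deg rl).

Lemma Jminus_zmod_closed : zmod_closed Jminus.
Proof.
split; first by rewrite /Jminus unfold_in /fval raddf0 rpred0.
move=> u v; rewrite ![_ \in Jminus]unfold_in => uJ vJ.
rewrite /Jminus /fval raddfB.
exact: (@rpredB (iclass -> R^o) (series_pred (B_ideal s deg rl)) _ _ uJ vJ).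
Qed.

HB.instance Definition _ :=
  GRing.isZmodClosed.Build That Jminus Jminus_zmod_closed.

(* The quotient of That by J_-.  Its algebra structure is the one for which
   the projection pT is a morphism. *)
Definition Tplus := Quotient.quot Jminus.
Definition pT (u : That) : Tplus := \pi_Tplus u.

Definition calJ (t : L) (k : mindex) (tau : iclass) : Tplus :=
  pT (basis (hatJ t k tau)).

Definition Pplus (f : iclass -> R) : iclass -> R := fun c =>
  if `[< B_plus c /\ 0 < deg_plus s deg (rep c) >] then f c else 0.

Section Maps.
Variable A : Tplus -> That.

(* A is determined, coefficient by coefficient and through finite sums, by its
   values on the basis.  The extension of (id (x) A) from finite tensors to
   formal series presupposes this. *)
Definition preserves_series : Prop := forall (v : That) (c : iclass),
  finite_set [set tau | fval v tau * fval (A (pT (basis tau))) c != 0]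
  /\ fval (A (pT v)) c
     = \sum_(tau \in [set: iclass]) fval v tau * fval (A (pT (basis tau))) c.

Definition algebra_morphism : Prop :=
  [/\ linear (A \o pT), A (pT oneT) = oneT,
      {morph A \o pT : u v / mulT u v >-> mulT u v} & preserves_series].

(* The matrix of A only has entries from bidegree n to bidegrees m with
   m_1 >= n_1 and m_2 <= n_2. *)
Definition triangular : Prop := forall tau c : iclass, B_plus tau ->
  fval (A (pT (basis tau))) c != 0 ->
  ((bideg tau).1 <= (bideg c).1)%N /\ ((bideg c).2 <= (bideg tau).2)%N.

(* M (hat J_k^t (x) A) Delta^+_ex tau, with Delta^+_ex = (id (x) pT) Delta2; the
   right factors p.2 that occur are in B_plus *)
Definition MJA (t : L) (k : mindex) (tau : iclass) : iclass -> R := fun c =>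
  \sum_(p \in [set: iclass * iclass])
    Delta2 R (rep tau) p
    * fmul (ind R (hatJ t k p.1)) (fval (A (pT (basis p.2)))) c.

End Maps.

(* (-X)^l / l! *)
Definition negXpow (l : mindex) : iclass -> R := fun c =>
  (-1) ^+ (\sum_(j < d) l j)%N / (\prod_(j < d) (l j)`!)%N%:R
  * ind R (Xmon L l) c.

End Spaces.

(* Main.v *)
Require Import Defs.
From HB Require Import structures.
From mathcomp Require Import all_boot all_order all_algebra.
From mathcomp Require Import finmap multiset generic_quotient.
From mathcomp Require Import all_classical all_reals.
From mathcomp Require Import zify ring lra.

Set Implicit Arguments.
Unset Strict Implicit.
Unset Printing Implicit Defensive.

Import Order.TTheory GRing.Theory Num.Theory.
Local Open Scope classical_set_scope.
Local Open Scope ring_scope.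
Local Open Scope quotient_scope.

(** The classes in [B_plus] form a commutative monoid under the tree product.  A
    class is given by the decoration [n] of its root and by its branches, so
    that it is the product of the monomial [X^n] and of one planted tree
    [hatJ t k tau] for each branch ([factor_root], [B_plus_ind]).  Therefore a
    multiplicative map on the basis can be prescribed at will on the [X_i] and
    on the planted trees ([theta]), and is determined by these values.

    The equation for the planted tree [hatJ t k tau] involves the map only at
    the right factors of the coproduct of [tau].  A cut distributes the nodes
    and edges of [tau] over the two factors, hence a right factor has a second
    bidegree smaller than that of the planted tree ([Delta2_support]).  The
    equations thus are a well-founded recursion ([approx], [antip]), and the
    same induction gives uniqueness ([antipode_unique]).

    Along the recursion one keeps track of the gradings ([good_image]).  From
    a basis element to the terms of its image, the first bidegree does not
    decrease and the second one does not increase.  As the decorations [eps] of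
    the cuts and the monomials [X^l] raise the first bidegree, finitely many
    terms contribute to each coefficient: the right-hand side is a formal
    series ([antip_rhs_series]), and the map extends from the basis to series
    ([antipV], [antipV_mul]).  Moreover the coproduct preserves the degree
    [deg_plus] ([cut_deg]), and so does the recursion, whereas [Pplus] lets only
    positive degrees through.  So a basis element of nonpositive degree other
    than the unit has image zero ([antip_neg]).  This is why the map vanishes on
    the ideal [Jminus] ([antip_ideal]), and why the equation also holds at the
    planted trees that become zero in the quotient.

    It remains to see that [B_plus] is stable under products and under passing
    to branches, although the condition on the extended decorations, through
    [frakD], refers to the whole tree.  In fact [frakD] at a node only depends
    on the type of the edge that enters the node, on its decoration and on its
    type ([frakD_local]): in a witness [(f, A)], the part of [f] outside of [A]
    can be exchanged for that of any other tree in which these data agree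
    ([surgery_frakD]).  Right factors of the coproduct outside of [B_plus]
    correspond to the zero vector of [That], and left factors that lead out of
    [B_plus] are removed by [Pplus]. *)

(** * Isomorphism classes and rooted trees *)

Section Trees.
Variables (d : nat) (L : finType).
Implicit Types g : dgraph d L.

Lemma cls_eqP g (h : dgraph d L) : cls g = cls h <-> dgraph_iso g h.
Proof.
have ofK k : dgraph_iso k (to_dgraph (@of_dgraph d L k)).
  exists enum_rank, enum_rank; split.
  - exact: (Bijective enum_rankK enum_valK).
  - exact: (Bijective enum_rankK enum_valK).
  - by move=> e /=; rewrite !enum_rankK.
  - by move=> x /=; rewrite !enum_rankK.
  - by move=> x /=; rewrite !enum_rankK.
split.
  move=> /eqP; rewrite /cls eqmodE => /asboolP gh.
  exact: dgraph_iso_trans (ofK g) (dgraph_iso_trans gh (dgraph_iso_sym (ofK h))).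
move=> gh; apply/eqP; rewrite /cls eqmodE; apply/asboolP.
exact: dgraph_iso_trans (dgraph_iso_sym (ofK g)) (dgraph_iso_trans gh (ofK h)).
Qed.

Lemma cls_rep (c : iclass d L) : cls (rep c) = c.
Proof.
rewrite -[RHS]reprK; apply/eqP; rewrite /cls eqmodE; apply/asboolP.
apply: dgraph_iso_sym.
exists enum_rank, enum_rank; split.
- exact: (Bijective enum_rankK enum_valK).
- exact: (Bijective enum_rankK enum_valK).
- by move=> e /=; rewrite !enum_rankK.
- by move=> x /=; rewrite !enum_rankK.
- by move=> x /=; rewrite !enum_rankK.
Qed.

Lemma rep_cls g : dgraph_iso (rep (cls g)) g.
Proof. by apply/cls_eqP; rewrite cls_rep. Qed.

Definition rtree_at g (r : node g) (h : node g -> nat) : Prop :=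
  [/\ injective (@tgt d L g), forall e : edge g, tgt e <> r,
      forall x, x <> r -> exists e : edge g, tgt e = x
    & forall e : edge g, (h (src e) < h (tgt e))%N].

Definition rtree g : Prop := exists r h, @rtree_at g r h.

Lemma isrootP g (x : node g) : reflect (forall e : edge g, tgt e <> x) (isroot x).
Proof.
apply: (iffP forallP) => H e; first exact/eqP.
by apply/eqP.
Qed.

Lemma rtree_isroot g r h (x : node g) : rtree_at r h -> isroot x = (x == r).
Proof.
case=> _ hr hx _; apply/isrootP/eqP => [H|->//].
by apply: contrapT => /hx [e he]; apply: (H e).
Qed.

Lemma connect_earc_last g (y u : node g) : connect (@earc d L g) y u ->
  u = y \/ exists2 e : edge g, tgt e = u & connect (@earc d L g) y (src e).
Proof.
case/connectP => p; case/lastP: p => [_ ->|p z]; first by left.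
rewrite rcons_path last_rcons => /andP[pp /existsP[e /andP[/eqP es /eqP <-]]] ->.
by right; exists e => //; rewrite es; apply/connectP; exists p.
Qed.

(** Only one edge enters [y], and an undirected path that leaves the set of
    descendants of [y] has to use it. *)
Lemma joined_above g (E : {set edge g}) (y a b : node g) :
  injective (@tgt d L g) -> (forall e, e \in E -> tgt e <> y) ->
  joined E a b -> connect (@earc d L g) y a -> connect (@earc d L g) y b.
Proof.
move=> inj ey /connectP[p + ->]; elim: p a => //= z p IH a /andP[/existsP[e]].
case/andP=> eE /orP[]/andP[/eqP se /eqP te] pp ya; apply: (IH z) => //.
  apply: connect_trans ya _; apply: connect1; apply/existsP; exists e.
  by rewrite se te !eqxx.
case: (connect_earc_last ya) => [ay|[e' e'a c]].
  by case: (ey e eE); rewrite te.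
by rewrite -se (inj e e') // te.
Qed.

Lemma joinedC g (E : {set edge g}) x y : joined E x y = joined E y x.
Proof.
by apply: sym_connect_sym => u v; apply: eq_existsb => e; rewrite orbC.
Qed.

Lemma joined_trans g (E : {set edge g}) x y z :
  joined E x y -> joined E y z -> joined E x z.
Proof. exact: connect_trans. Qed.

Lemma joined_edge g (E : {set edge g}) e : e \in E -> joined E (src e) (tgt e).
Proof.
by move=> eE; apply: connect1; apply/existsP; exists e; rewrite eE !eqxx.
Qed.

Lemma joined_refl g (E : {set edge g}) x : joined E x x.
Proof. exact: connect0. Qed.

Lemma joined_ind g (E : {set edge g}) (P : node g -> Prop) x y :
  (forall e, e \in E -> P (src e) <-> P (tgt e)) ->
  joined E x y -> P x -> P y.
Proof.
move=> HE /connectP[p + ->]; elim: p x => //= z p IH x /andP[/existsP[e]].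
by case/andP=> eE /orP[]/andP[/eqP se /eqP te] pp px; apply: (IH z) => //;
  rewrite -?se -?te; apply/(HE e eE); rewrite ?se ?te.
Qed.

Lemma height_earc g (h : node g -> nat) x y :
  (forall e : edge g, (h (src e) < h (tgt e))%N) ->
  connect (@earc d L g) x y -> x = y \/ (h x < h y)%N.
Proof.
move=> hh /connectP[p + ->]; elim: p x => [|z p IH] x /=; first by left.
case/andP=> /existsP[e /andP[/eqP <- /eqP ez]] /IH H; right.
rewrite -ez in H *; case: H => [<-|H]; first exact: hh.
exact: ltn_trans (hh e) H.
Qed.

Lemma height_forest g (h : node g -> nat) :
  injective (@tgt d L g) -> (forall e : edge g, (h (src e) < h (tgt e))%N) ->
  rooted_forest g.
Proof.
move=> inj hh; split => // e; apply/negP => /(height_earc hh) [H|H].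
  by have := hh e; rewrite H ltnn.
by have := ltn_trans H (hh e); rewrite ltnn.
Qed.

Definition depth g (x : node g) : nat :=
  #|[set y | connect (@earc d L g) y x]%SET|.

Lemma forest_depth g : rooted_forest g ->
  forall e : edge g, (depth (src e) < depth (tgt e))%N.
Proof.
case=> inj ac e; apply: proper_card; apply/properP; split.
  apply/fintype.subsetP => y; rewrite !inE => /connect_trans; apply.
  by apply: connect1; apply/existsP; exists e; rewrite !eqxx.
by exists (tgt e); rewrite !inE ?connect0.
Qed.

(** Trees are handled through a root and a height function because these are
    easily produced for the trees constructed below, unlike the absence of
    cycles and the connectedness by paths.  Conversely, the depth is a height
    and a node of least depth is the root: no edge leads out of the set of its
    descendants. *)
Lemma rtreeP g : rtree g <-> rooted_forest g /\ is_tree g.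
Proof.
split=> [[r [h [inj hr hx hh]]]|[rf [n0 jo]]].
  split; first exact: height_forest hh.
  have jr : forall n x, (h x < n)%N -> joined finset.setT r x.
    elim=> // n IH x hn; case: (eqVneq x r) => [->|/eqP/hx[e ex]].
      exact: joined_refl.
    rewrite -ex; apply: joined_trans (joined_edge _); last by rewrite inE.
    by apply: IH; rewrite -ex in hn; exact: leq_trans (hh e) hn.
  split; first by apply/card_gt0P; exists r.
  move=> x y; apply: (@joined_trans _ _ _ r).
    by rewrite joinedC; exact: (jr (h x).+1).
  exact: (jr (h y).+1).
have [inj ac] := rf; have hh := forest_depth rf.
have [x0 _] := card_gt0P n0.
pose r := [arg min_(x < x0) depth x].
have rmin (x : node g) : (depth r <= depth x)%N.
  by rewrite /r; case: arg_minnP => // i _ im; exact: im.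
have hr (e : edge g) : tgt e <> r.
  by move=> er; have := hh e; rewrite er ltnNge rmin.
exists r, (@depth g); split => // x xr.
have : connect (@earc d L g) r x.
  by apply: (joined_above (E := finset.setT) inj (a := r)) => //; exact: connect0.
by case/connect_earc_last => // [[e ex _]]; exists e.
Qed.

(** The root of [A] is its node of least depth: if no edge of [A] entered
    another node [y], then by [joined_above] all the nodes of [A] would be
    descendants of [y]. *)
Lemma subtree_root g (A : subforest g) : rooted_forest g -> sub_tree A ->
  exists r, [/\ r \in sN A, forall e, e \in sE A -> tgt e <> r
     & forall y, y \in sN A -> y <> r -> exists2 e, e \in sE A & tgt e = y].
Proof.
move=> rf [[x0 x0A] jo]; have [inj ac] := rf; have hh := forest_depth rf.
pose r := [arg min_(x < x0 in sN A) depth x].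
have [rA rmin] : r \in sN A /\ forall x, x \in sN A -> (depth r <= depth x)%N.
  by rewrite /r; case: arg_minnP => // i iA im; split=> // x; apply: im.
exists r; split => // [e eA er|y yA yr].
  by have := hh e; rewrite er ltnNge rmin ?sub_src.
apply: contrapT => H.
have : connect (@earc d L g) y r.
  apply: (joined_above (E := sE A) inj (a := y)) => //.
  - by move=> e eA ey; apply: H; exists e.
  - exact: jo.
case/(height_earc hh) => // lt; move: (rmin _ yA); rewrite leqNgt lt//.
Qed.

End Trees.

(** * Trees given by a parent function *)

Lemma inj_surj_bij (T U : Type) (f : T -> U) :
  injective f -> (forall y, exists x, f x = y) -> bijective f.
Proof.
move=> inj sur; have [g gP] := choice sur.
by exists g => // x; apply: inj.
Qed.

Section ParentTrees.
Variables (d : nat) (L : finType).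

(** In a tree every node but the root is the end of exactly one edge, so the
    other nodes can also serve as edges, and the tree is given by the parent
    function on them; [None] stands for the root.  This encodes the trees
    whose edges have colour 0, the only ones left after contraction. *)
Record ptree := PTree {
  pV : finType;
  par : pV -> option pV;
  ptyp : pV -> L;
  pcol : pV -> nat;
  pn : pV -> mindex d;
  po : pV -> odeco d L;
  pe : pV -> mindex d }.

Definition gr (c : nat) (n : mindex d) (o : odeco d L) (P : ptree) : dgraph d L :=
  @DGraph d L (option (pV P)) (pV P) (@par P) Some (@ptyp P)
    (oapp (@pcol P) c) (fun=> 0%N) (oapp (@pn P) n) (oapp (@po P) o) (@pe P).

Definition acyc (P : ptree) : Prop :=
  exists h : pV P -> nat, forall v u, par v = Some u -> (h u < h v)%N.

Definition piso (P Q : ptree) : Prop :=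
  exists f : pV P -> pV Q,
    [/\ bijective f, forall v, par (f v) = omap f (par v)
      & forall v, [/\ ptyp (f v) = ptyp v, pcol (f v) = pcol v, pn (f v) = pn v,
                      po (f v) = po v & pe (f v) = pe v]].

Lemma piso_sym P Q : piso P Q -> piso Q P.
Proof.
case=> f [[g fK gK] fp fd]; exists g; split; first by exists f.
  move=> v; rewrite -{2}(gK v) fp; case: (par (g v)) => //= u.
  by rewrite fK.
by move=> v; have [] := fd (g v); rewrite gK.
Qed.

Lemma piso_trans Q P S : piso P Q -> piso Q S -> piso P S.
Proof.
case=> f [bf fp fd] [g [bg gp gd]]; exists (g \o f); split.
- exact: bij_comp.
- by move=> v /=; rewrite gp fp; case: (par v).
- by move=> v /=; have [-> -> -> -> ->] := gd (f v); have := fd v.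
Qed.

Lemma gr_iso c n o P Q : piso P Q -> dgraph_iso (gr c n o P) (gr c n o Q).
Proof.
case=> f [[g fK gK] fp fd]; exists (omap f), f; split.
- by exists (omap g); case=> //= x; rewrite ?fK ?gK.
- by exists g.
- by move=> e /=; rewrite fp.
- by case=> //= v; have [] := fd v.
- by move=> e; have [] := fd e.
Qed.

(** No edge ends at [None], so that an isomorphism fixes it. *)
Lemma gr_iso_inv c n o P c' n' o' Q :
  dgraph_iso (gr c n o P) (gr c' n' o' Q) ->
  [/\ c = c', n = n', o = o' & piso P Q].
Proof.
case=> fN [fE [[gN fNK gNK] [gE fEK gEK] st nn ee]].
have fS v : fN (Some v) = Some (fE v) by have [_ <-] := st v.
have f0 : fN None = None.
  case e: (fN None) => [w|//].
  have := fS (gE w); rewrite gEK -e => /(can_inj fNK) //.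
have := nn None; rewrite f0 /= => -[-> -> ->]; split=> //.
exists fE; split; first by exists gE.
  move=> v; have [/= -> _] := st v; case: (par v) => /= [u|]; first exact: fS.
  exact: f0.
move=> v; have [? ? ?] := ee v; have := nn (Some v); rewrite fS /=.
by case=> ? ? ?; split.
Qed.

Lemma gr_rtree c n o P : acyc P -> rtree (gr c n o P).
Proof.
case=> h hP; exists None, (fun x => if x is Some v then (h v).+1 else 0%N).
split => /=; [exact: Some_inj|by []| |].
- by case=> [v _|//]; exists v.
- by move=> v; case e: (par v) => [u|//]; rewrite ltnS; apply: hP.
Qed.

Lemma rtree_acyc c n o P : rtree (gr c n o P) -> acyc P.
Proof.
case=> r [h [_ _ _ hh]]; exists (fun v => h (Some v)) => v u vu.
by have := hh v; rewrite /= vu.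
Qed.

Lemma rtree_at_gr (g : dgraph d L) (r : node g) h : rtree_at r h ->
  (forall e : edge g, ecol e = 0%N) ->
  exists P, [/\ acyc P, dgraph_iso g (gr (ncol r) (ndec r) (odec r) P),
    (forall v : pV P, exists2 x : node g, x <> r &
       [/\ pcol v = ncol x, pn v = ndec x & po v = odec x])
    & (pV P = edge g) ].
Proof.
move=> [inj hr hx hh] e0.
pose f (x : node g) : option (edge g) := [pick e | tgt e == x].
have ft e : f (tgt e) = Some e.
  by rewrite /f; case: pickP => [e' /eqP/inj->//|/(_ e)]; rewrite eqxx.
have fr : f r = None by rewrite /f; case: pickP => // e /eqP /hr.
pose P := @PTree (edge g) (fun e => f (src e)) (@typ d L g)
  (fun e => ncol (tgt e)) (fun e => ndec (tgt e)) (fun e => odec (tgt e))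
  (@edec d L g).
exists P; split => //.
- exists (fun e => h (tgt e)) => v u /=; rewrite /f; case: pickP => // e /eqP es [<-].
  by rewrite es.
- exists f, id; split.
  + exists (oapp (@tgt d L g) r); last by case=> [e|] /=; rewrite ?ft ?fr.
    move=> x; case: (eqVneq x r) => [->|/eqP/hx[e <-]]; rewrite ?fr ?ft //.
  + by exists id.
  + by move=> e /=; rewrite ft.
  + by move=> x; case: (eqVneq x r) => [->|/eqP/hx[e <-]]; rewrite ?fr ?ft.
  + by move=> e; split=> //=; rewrite e0.
- by move=> e; exists (tgt e) => //; exact: hr.
Qed.

Definition psum (P Q : ptree) : ptree :=
  @PTree (pV P + pV Q)%type
    (sumf (fun v => omap inl (par v)) (fun v => omap inr (par v)))
    (sumf (@ptyp P) (@ptyp Q)) (sumf (@pcol P) (@pcol Q)) (sumf (@pn P) (@pn Q))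
    (sumf (@po P) (@po Q)) (sumf (@pe P) (@pe Q)).

Definition plantP (t : L) (k : mindex d) (c : nat) (n : mindex d) (o : odeco d L)
    (P : ptree) : ptree :=
  @PTree (option (pV P)) (omap (@par P)) (oapp (@ptyp P) t) (oapp (@pcol P) c)
    (oapp (@pn P) n) (oapp (@po P) o) (oapp (@pe P) k).

Definition pempty : ptree :=
  @PTree void (fun e => match e with end) (fun e => match e with end)
   (fun=> 0%N) (fun=> 0) (fun=> 0) (fun=> 0).

(** Induced structure on a set of nodes; a node whose parent is left out is
    attached to the root. *)
Definition restr (P : ptree) (S : pred (pV P)) : ptree :=
  @PTree {v : pV P | S v} (fun v => obind insub (par (val v)))
    (fun v => ptyp (val v)) (fun v => pcol (val v)) (fun v => pn (val v))
    (fun v => po (val v)) (fun v => pe (val v)).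

Lemma psumC P Q : piso (psum P Q) (psum Q P).
Proof.
exists (fun x => match x with inl a => inr a | inr b => inl b end); split.
- by exists (fun x => match x with inl a => inr a | inr b => inl b end); case.
- by case=> v /=; case: (par v).
- by case.
Qed.

Lemma psumA P Q S : piso (psum (psum P Q) S) (psum P (psum Q S)).
Proof.
exists (fun x => match x with inl (inl a) => inl a | inl (inr b) => inr (inl b)
  | inr c => inr (inr c) end); split.
- exists (fun x => match x with inl a => inl (inl a) | inr (inl b) => inl (inr b)
  | inr (inr c) => inr c end); by do ?case.
- by case=> [[]|] v /=; case: (par v).
- by do ?case.
Qed.

Lemma psum0 P : piso (psum pempty P) P.
Proof.
exists (fun x => match x with inl a => of_void _ a | inr b => b end); split.
- by exists inr => //; do ?case.
- by case=> [[]|] v //=; case: (par v).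
- by do ?case.
Qed.

Lemma acyc_psum P Q : acyc P -> acyc Q -> acyc (psum P Q).
Proof.
case=> f fP [g gP]; exists (sumf f g).
by case=> v u /=; case e: (par v) => [w|//] [<-] /=; [exact: fP|exact: gP].
Qed.

Lemma acyc_restr P S : acyc P -> acyc (@restr P S).
Proof.
case=> f fP; exists (fun v => f (val v)) => v u /=.
by case e: (par (val v)) => [w|//] /=; case: insubP => // w' _ ww' [<-]; rewrite ww'; apply: fP.
Qed.

Lemma acyc_plantP t k c n o P : acyc P -> acyc (plantP t k c n o P).
Proof.
case=> f fP; exists (fun x => if x is Some v then (f v).+1 else 0%N).
by case=> //= v [u|//] [] /fP.
Qed.

Section Descendants.
Variables (P : ptree) (v : pV P).
Definition desc (w : pV P) : bool := connect (fun u w => par w == Some u) v w.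
Definition sdesc : pred (pV P) := fun w => (w != v) && desc w.
Definition ndesc : pred (pV P) := fun w => ~~ desc w.

Lemma desc_par w u : par w = Some u -> w != v -> desc w = desc u.
Proof.
move=> wu wv; apply/idP/idP => [|H].
  case/connectP => p; case/lastP: p => [_ /= wv'|p z]; first by rewrite wv' eqxx in wv.
  rewrite rcons_path last_rcons => /andP[pp /eqP zp] wz.
  by move: zp; rewrite -wz wu => -[->]; apply/connectP; exists p.
by apply: connect_trans H _; apply: connect1; rewrite /= wu.
Qed.

Lemma desc_None w : par w = None -> w != v -> desc w = false.
Proof.
move=> w0 wv; apply/negP.
case/connectP => p; case/lastP: p => [_ /= wv'|p z]; first by rewrite wv' eqxx in wv.
by rewrite rcons_path last_rcons => /andP[pp /eqP zp] wz; move: zp; rewrite -wz w0.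
Qed.

Definition branchP : ptree := restr sdesc.
Definition restP : ptree := restr ndesc.

Lemma desc_refl : desc v. Proof. exact: connect0. Qed.

(** The node [v] becomes the root of its branch, hence the node [None] of the
    planted tree; the parent of a child of [v] is then [None] in the branch. *)
Lemma branch_split : par v = None ->
  piso P (psum (plantP (ptyp v) (pe v) (pcol v) (pn v) (po v) branchP) restP).
Proof.
move=> v0; apply: piso_sym.
exists (sumf (oapp val v) val); split.
- apply: inj_surj_bij => [|w]; last first.
    case: (boolP (desc w)) => dw; last by exists (inr (Sub w dw)).
    case: (eqVneq w v) => [->|wv]; first by exists (inl None).
    have sw : sdesc w by rewrite /sdesc wv dw.
    by exists (inl (Some (Sub w sw))).
  have sdesc_ne (x : {w | sdesc w}) : val x <> v.
    by move=> xv; have := valP x; rewrite /sdesc xv eqxx.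
  have sdn (x : {w | sdesc w}) (y : {w | ndesc w}) : val x <> val y.
    move=> xy; have /andP[_] := valP x; rewrite xy => dy.
    by case/negP: (valP y : ~~ desc (val y)).
  have nv (y : {w | ndesc w}) : v <> val y.
    by move=> vy; have := valP y; rewrite -vy /ndesc desc_refl.
  case=> [[x|]|x] [[y|]|y] e.
  + by congr (inl (Some _)); exact: val_inj.
  + by case: (sdesc_ne x).
  + by case: (sdn x y).
  + by case: (sdesc_ne y).
  + by [].
  + by case: (nv y).
  + by case: (sdn y x).
  + by case: (nv x).
  + by congr inr; exact: val_inj.
- case=> [[w|]|w] //=.
    case pw: (par (val w)) => [u|] /=; last first.
      by have /andP[wv dw] := valP w; rewrite desc_None in dw.
    case: insubP => [w' _ <-//|]; rewrite /sdesc negb_and negbK.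
    have /andP[wv dw] := valP w.
    by rewrite -(desc_par pw wv) dw orbF => /eqP ->.
  have wv : val w != v.
    by apply/eqP => wv; have := valP w : ~~ desc (val w); rewrite wv desc_refl.
  case pw: (par (val w)) => [u|//] /=.
  case: insubP => [w' _ <-//|] /=; rewrite negbK -(desc_par pw wv) => dw.
  by case/negP: (valP w : ~~ desc (val w)).
- by case=> [[w|]|w].
Qed.
End Descendants.

Lemma desc_iso P Q (f : pV P -> pV Q) : bijective f ->
  (forall v, par (f v) = omap f (par v)) ->
  forall v w, desc (f v) (f w) = desc v w.
Proof.
move=> bf fp v w; have [g fK gK] := bf.
rewrite /desc; apply/idP/idP => /connectP[p pp e]; apply/connectP.
  exists (map g p); last by rewrite -[v]fK last_map -e fK.
  rewrite -[v]fK; elim: p (f v) pp {e} => //= z p IH x /andP[/eqP xz pp].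
  rewrite IH // andbT; move: xz; rewrite -{1}[z]gK fp.
  by case: (par (g z)) => //= u [<-]; rewrite fK.
exists (map f p); last by rewrite last_map -e.
elim: p v pp {e} => //= z p IH x /andP[/eqP xz pp].
by rewrite IH // andbT fp xz.
Qed.

Lemma restr_iso P Q (f : pV P -> pV Q) (S : pred (pV P)) (T : pred (pV Q)) :
  bijective f -> (forall v, par (f v) = omap f (par v)) ->
  (forall v, [/\ ptyp (f v) = ptyp v, pcol (f v) = pcol v, pn (f v) = pn v,
                      po (f v) = po v & pe (f v) = pe v]) ->
  (forall v, T (f v) = S v) -> piso (restr S) (restr T).
Proof.
move=> [g fK gK] fp fd TS.
have Tf (v : {v | S v}) : T (f (val v)) by rewrite TS; exact: (valP v).
exists (fun v => Sub (f (val v)) (Tf v)); split.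
- apply: inj_surj_bij => [x y [] /(can_inj fK) xy|y]; first exact: val_inj.
  have Sy : S (g (val y)) by rewrite -TS gK; exact: (valP y).
  by exists (Sub (g (val y)) Sy); apply: val_inj; rewrite /= gK.
- move=> v /=; rewrite fp; case: (par (val v)) => //= u.
  case: insubP => [w wS wu|]; case: insubP => [x xS xu|] //=; last 2 first.
  + by rewrite -TS wS.
  + by rewrite TS => /negP.
  by congr Some; apply: val_inj; rewrite /= wu xu.
- by move=> v; have := fd (val v).
Qed.

Lemma branch_iso P Q (f : pV P -> pV Q) v : bijective f ->
  (forall v, par (f v) = omap f (par v)) ->
  (forall v, [/\ ptyp (f v) = ptyp v, pcol (f v) = pcol v, pn (f v) = pn v,
                      po (f v) = po v & pe (f v) = pe v]) ->
  piso (branchP v) (branchP (f v)).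
Proof.
move=> bf fp fd; apply: (restr_iso bf fp fd) => w.
by rewrite /sdesc (desc_iso bf) // (bij_eq bf).
Qed.

Lemma restr_emb P Q (f : pV P -> pV Q) (S : pred (pV P)) (T : pred (pV Q)) :
  injective f -> (forall v, S v -> par (f v) = omap f (par v)) ->
  (forall v, [/\ ptyp (f v) = ptyp v, pcol (f v) = pcol v, pn (f v) = pn v,
                      po (f v) = po v & pe (f v) = pe v]) ->
  (forall v, T (f v) = S v) -> (forall w, T w -> exists v, f v = w) ->
  piso (restr S) (restr T).
Proof.
move=> inj fp fd TS sT.
have Tf (v : {v | S v}) : T (f (val v)) by rewrite TS; exact: (valP v).
exists (fun v => Sub (f (val v)) (Tf v)); split.
- apply: inj_surj_bij => [x y [] /inj xy|y]; first exact: val_inj.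
  have [v vy] := sT _ (valP y).
  have Sv : S v by rewrite -TS vy; exact: (valP y).
  by exists (Sub v Sv); apply: val_inj.
- move=> v /=; rewrite fp; last exact: (valP v).
  case: (par (val v)) => //= u.
  case: insubP => [w wS wu|]; case: insubP => [x xS xu|] //=; last 2 first.
  + by rewrite -TS wS.
  + by rewrite TS => /negP.
  by congr Some; apply: val_inj; rewrite /= wu xu.
- by move=> v; have := fd (val v).
Qed.

Lemma restr_true P (S : pred (pV P)) : (forall v, S v) -> piso (restr S) P.
Proof.
move=> St; exists val; split=> //.
- by apply: inj_surj_bij; [exact: val_inj|move=> v; exists (Sub v (St v))].
- move=> v /=; case: (par (val v)) => //= u.
  by rewrite insubT.
Qed.

Lemma desc_emb P Q (f : pV P -> pV Q) : injective f ->
  (forall v w, (par (f v) == Some (f w)) = (par v == Some w)) ->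
  (forall v w, par w = Some (f v) -> exists u, f u = w) ->
  forall v w, desc (f v) w <-> exists2 u, f u = w & desc v u.
Proof.
move=> inj fp fs v w; split=> [/connectP[p pp ->]|[u <-]].
  have [q -> qq] : exists2 q, p = map f q & path (fun u w => par w == Some u) v q.
    elim: p v pp => [|z p IH] v /=; first by exists [::].
    case/andP => /eqP zv; have [u uz] := fs _ _ zv; rewrite -uz => /IH[q -> qq].
    by exists (u :: q) => //=; rewrite -fp uz zv eqxx.
  by exists (last v q); [rewrite last_map|apply/connectP; exists q].
case/connectP => p pp ->; apply/connectP; exists (map f p); last by rewrite last_map.
by elim: p v pp => //= z p IH v /andP[vz /IH ->]; rewrite fp vz.
Qed.

Lemma branch_emb P Q (f : pV P -> pV Q) v : injective f ->
  (forall v w, par v = Some w -> par (f v) = Some (f w)) ->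
  (forall v w, par (f v) = Some (f w) -> par v = Some w) ->
  (forall v w, par w = Some (f v) -> exists u, f u = w) ->
  (forall v, [/\ ptyp (f v) = ptyp v, pcol (f v) = pcol v, pn (f v) = pn v,
                      po (f v) = po v & pe (f v) = pe v]) ->
  piso (branchP v) (branchP (f v)).
Proof.
move=> inj f1 f2 f3 fd.
have fp u w : (par (f u) == Some (f w)) = (par u == Some w).
  by apply/eqP/eqP; [exact: f2|exact: f1].
have de := desc_emb inj fp f3.
apply: (restr_emb inj) => //.
- move=> w; rewrite /sdesc => /andP[wv dw]; case pw: (par w) => [u|] /=; first exact: f1.
  by rewrite desc_None in dw.
- move=> w; rewrite /sdesc (inj_eq inj); congr (_ && _).
  by apply/idP/idP => [/de[u /inj->]//|dw]; apply/de; exists w.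
- by move=> w; rewrite /sdesc => /andP[_ /de[u uw _]]; exists u.
Qed.

Lemma branch_psuml P Q (v : pV P) : piso (branchP v) (@branchP (psum P Q) (inl v)).
Proof.
apply: (@branch_emb P (psum P Q) inl) => //= [a b []//|a b ->//|a b|a [b|b]/=].
- by case: (par a) => //= u [->].
- by exists b.
- by case: (par b).
Qed.

Lemma branch_psumr P Q (v : pV Q) : piso (branchP v) (@branchP (psum P Q) (inr v)).
Proof.
apply: (@branch_emb Q (psum P Q) inr) => //= [a b []//|a b ->//|a b|a [b|b]/=].
- by case: (par a) => //= u [->].
- by case: (par b).
- by exists b.
Qed.

Lemma branch_plantP t k c n o P : acyc P ->
  piso P (@branchP (plantP t k c n o P) None).
Proof.
move=> [h hP].
have all w : @sdesc (plantP t k c n o P) None (Some w).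
  rewrite /sdesc /=; suff H m : forall w, (h w < m)%N ->
    @desc (plantP t k c n o P) None (Some w) by exact: (H (h w).+1).
  elim: m => // m IH {}w hw; case pw: (par w) => [u|].
    rewrite (@desc_par (plantP t k c n o P) None (Some w) (Some u)) //= ?pw //.
    by apply: IH; exact: leq_trans (hP _ _ pw) hw.
  by apply: connect1; rewrite /= pw.
exists (fun v => Sub (Some v) (all v)); split.
- apply: inj_surj_bij => [x y [] //|[[w|] sw]]; first by exists w; exact: val_inj.
  by have := sw; rewrite /sdesc eqxx.
- move=> v /=; case: (par v) => [u|] /=; first by rewrite insubT //=; congr Some; exact: val_inj.
  by case: insubP => // -[w sw]; rewrite /sdesc eqxx.
- by [].
Qed.

End ParentTrees.

(** * Joining and planting *)

Section Classes.
Variables (d : nat) (L : finType).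
Implicit Types g : dgraph d L.
Local Notation ptree := (ptree d L).

Lemma iso_isroot g (h : dgraph d L) (fN : node g -> node h) (fE : edge g -> edge h) :
  bijective fN -> bijective fE ->
  (forall e, src (fE e) = fN (src e) /\ tgt (fE e) = fN (tgt e)) ->
  forall x, isroot (fN x) = isroot x.
Proof.
move=> bN [gE gK Kg] st x; apply/isrootP/isrootP => H e ex; last first.
  apply: (H (gE e)); apply: (bij_inj bN); have [_ <-] := st (gE e).
  by rewrite Kg.
by apply: (H (fE e)); have [_ ->] := st e; rewrite ex.
Qed.

Lemma dunion_iso g (g' h h' : dgraph d L) :
  dgraph_iso g g' -> dgraph_iso h h' -> dgraph_iso (dunion g h) (dunion g' h').
Proof.
move=> [f [fE [[f' fK f'K] [fE' fEK fE'K] st nn ee]]].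
move=> [k [kE [[k' kK k'K] [kE' kEK kE'K] st' nn' ee']]].
exists (fun x => match x with inl a => inl (f a) | inr b => inr (k b) end).
exists (fun x => match x with inl a => inl (fE a) | inr b => inr (kE b) end).
split.
- exists (fun x => match x with inl a => inl (f' a) | inr b => inr (k' b) end);
  by case=> x; rewrite ?fK ?f'K ?kK ?k'K.
- exists (fun x => match x with inl a => inl (fE' a) | inr b => inr (kE' b) end);
  by case=> x; rewrite ?fEK ?fE'K ?kEK ?kE'K.
- by case=> e /=; [have [-> ->] := st e|have [-> ->] := st' e].
- by case=> x /=; [have := nn x|have := nn' x].
- by case=> e /=; [have := ee e|have := ee' e].
Qed.

Lemma join_roots_iso g (h : dgraph d L) :
  dgraph_iso g h -> dgraph_iso (join_roots g) (join_roots h).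
Proof.
move=> [f [fE [bf bE st nn ee]]].
have fr := iso_isroot bf bE st.
have pf (y : {x : node g | ~~ isroot x}) : ~~ isroot (f (val y)).
  by rewrite fr (valP y).
have qf x : insub (f x) =
    omap (fun y => Sub (f (val y)) (pf y)) (insub x : option {x : node g | ~~ isroot x}) 
    :> option {x : node h | ~~ isroot x}.
  case: insubP => [u u1 u2|]; case: insubP => [v v1 v2|] //=; last 2 first.
  + by rewrite -fr u1.
  + by rewrite fr => /negP.
  by congr Some; apply: val_inj; rewrite /= u2 v2.
have bigr (T : Type) (idx : T) (op : Monoid.com_law idx) F :
  \big[op/idx]_(z : node h | isroot z) F z =
  \big[op/idx]_(z : node g | isroot z) F (f z).
  rewrite (reindex f); last exact: onW_bij.
  by apply: eq_bigl => z; rewrite fr.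
exists (omap (fun y => Sub (f (val y)) (pf y))), fE; split => //.
- apply: inj_surj_bij => [[x|] [y|] //= [] /(bij_inj bf) xy|[y|]].
  + by congr Some; exact: val_inj.
  + have [f' fK f'K] := bf.
    have py : ~~ isroot (f' (val y)) by rewrite -fr f'K (valP y).
    by exists (Some (Sub (f' (val y)) py)) => /=; congr Some; apply: val_inj; rewrite /= f'K.
  + by exists None.
- by move=> e /=; have [-> ->] := st e; rewrite !qf.
- case=> [x|] /=; first exact: nn.
  split; rewrite bigr; apply: eq_bigr => z _; by have [] := nn z.
Qed.

Lemma plant_iso g (h : dgraph d L) i t k :
  dgraph_iso g h -> dgraph_iso (plant g i t k) (plant h i t k).
Proof.
move=> [f [fE [bf bE st nn ee]]].
have fr := iso_isroot bf bE st.
have pf (y : {x : node g | isroot x}) : isroot (f (val y)).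
  by rewrite fr (valP y).
exists (omap f), (fun x => match x with inl a => inl (Sub (f (val a)) (pf a)) | inr b => inr (fE b) end).
split.
- have [f' fK f'K] := bf; exists (omap f'); by case=> //= x; rewrite ?fK ?f'K.
- have [f' fK f'K] := bf; have [fE' fEK fE'K] := bE.
  apply: inj_surj_bij => [[x|x] [y|y] // []|[y|y]].
  + by move=> /(bij_inj bf) xy; congr inl; exact: val_inj.
  + by move=> /(bij_inj bE) ->.
  + have py : isroot (f' (val y)) by rewrite -fr f'K (valP y).
    by exists (inl (Sub (f' (val y)) py)); congr inl; apply: val_inj; rewrite /= f'K.
  + by exists (inr (fE' y)); rewrite fE'K.
- by case=> e //=; have [-> ->] := st e.
- by case=> [x|] //=; exact: nn.
- by case=> [x|e] //=; exact: ee.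
Qed.

Lemma tprod_cls g (h : dgraph d L) :
  tprod (cls g) (cls h) = cls (join_roots (dunion g h)).
Proof.
by apply/cls_eqP; apply: join_roots_iso; apply: dunion_iso; exact: rep_cls.
Qed.

Lemma join_gr c1 n1 o1 (P : ptree) c2 n2 o2 Q :
  dgraph_iso (join_roots (dunion (gr c1 n1 o1 P) (gr c2 n2 o2 Q)))
             (gr (maxn c1 c2) (n1 + n2) (o1 + o2) (psum P Q)).
Proof.
set g := dunion _ _.
have rt (x : node g) : isroot x = (x == inl None) || (x == inr None).
  apply/isrootP/orP => [H|[]/eqP -> [] //].
  case: x H => [[v|]|[v|]] H; [|by left|..|by right].
  - by case: (H (inl v)).
  - by case: (H (inr v)).
have bigr (T : Type) (idx : T) (op : Monoid.com_law idx) F :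
  \big[op/idx]_(z : node g | isroot z) F z = op (F (inl None)) (F (inr None)).
  rewrite (bigD1 (inl None)) ?rt //= (bigD1 (inr None)) ?rt //=.
  rewrite big1 ?Monoid.mulm1 // => z; rewrite rt.
  by case: eqP => //= _; case: eqP.
pose f (x : option {x : node g | ~~ isroot x}) : option (pV P + pV Q) :=
  obind (fun y => match val y with inl a => omap inl a | inr b => omap inr b end) x.
have nrl (v : pV P) : ~~ @isroot _ _ g (inl (Some v)) by rewrite rt.
have nrr (v : pV Q) : ~~ @isroot _ _ g (inr (Some v)) by rewrite rt.
have fq (x : node g) : f (insub x) =
    match x with inl a => omap inl a | inr b => omap inr b end.
  case: insubP => [u _ <- //|].
  by rewrite rt negbK => /orP[] /eqP ->.
exists f, id; split => //.
- apply: inj_surj_bij => [[[[[v|]|[v|]] nx]|] [[[[w|]|[w|]] ny]|] //= |[[v|v]|]].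
  all: try by exfalso; move: nx; rewrite rt.
  all: try by exfalso; move: ny; rewrite rt.
  + by case=> vw; congr Some; apply: val_inj; rewrite /= vw.
  + by case=> vw; congr Some; apply: val_inj; rewrite /= vw.
  + by exists (Some (exist (fun x : node g => ~~ isroot x) _ (nrl v))).
  + by exists (Some (exist (fun x : node g => ~~ isroot x) _ (nrr v))).
  + by exists None.
- by exists id.
- by case=> e; rewrite /join_roots /= !fq.
- case=> [[[[v|]|[v|]] nx]|]; last by rewrite /= !bigr.
  + by [].
  + by exfalso; move: nx; rewrite rt.
  + by [].
  + by exfalso; move: nx; rewrite rt.
- by case.
Qed.

Lemma tprod_gr n1 (P : ptree) n2 Q :
  tprod (cls (gr 2 n1 0 P)) (cls (gr 2 n2 0 Q)) = cls (gr 2 (n1 + n2) 0 (psum P Q)).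
Proof.
rewrite tprod_cls; apply/cls_eqP; apply: dgraph_iso_trans (join_gr _ _ _ _ _ _ _ _) _.
by rewrite addr0; exact: dgraph_iso_refl.
Qed.

Lemma isroot_gr c n o (P : ptree) (x : node (gr c n o P)) : isroot x = (x == None).
Proof.
apply/isrootP/eqP => [|-> //]; case: x => // v H.
by case: (H v).
Qed.

Lemma plant_gr i t k c n o (P : ptree) :
  dgraph_iso (plant (gr c n o P) i t k) (gr i 0 0 (plantP t k c n o P)).
Proof.
exists id, (fun x => match x with inl _ => None | inr v => Some v end); split.
- by exists id.
- apply: inj_surj_bij => [[[x rx]|x] [[y ry]|y] //|].
  + move=> _; congr inl; apply: val_inj => /=; move: rx ry.
    by rewrite !isroot_gr => /eqP -> /eqP ->.
  + by case=> ->.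
  + have r0 : @isroot _ _ (gr c n o P) None by rewrite isroot_gr.
    by case=> [v|]; [exists (inr v)|exists (inl (exist (fun x : node (gr c n o P) => isroot x) _ r0))].
- case=> [[x rx]|x] //=; split=> //.
  by move: rx; rewrite isroot_gr => /eqP ->.
- by case=> [[x|]|].
- by case=> [[x rx]|x].
Qed.

Lemma hatJ_cls t k g : hatJ t k (cls g) = cls (plant g 2 t k).
Proof. by apply/cls_eqP; apply: plant_iso; exact: rep_cls. Qed.

Lemma hatJ_gr t k c n o (P : ptree) :
  hatJ t k (cls (gr c n o P)) = cls (gr 2 0 0 (plantP t k c n o P)).
Proof. by rewrite hatJ_cls; apply/cls_eqP; exact: plant_gr. Qed.

Lemma Xmon_gr k : Xmon L k = cls (gr 2 k 0 (pempty d L)).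
Proof.
apply/cls_eqP; exists (fun=> None), id; split => //.
- by exists (fun=> tt) => [[]|[]].
- by exists id.
Qed.

Lemma join_roots_point g (x0 : node g) :
  (forall x : node g, x = x0) -> (edge g -> False) ->
  dgraph_iso (join_roots g) (gr (ncol x0) (ndec x0) (odec x0) (pempty d L)).
Proof.
move=> all ne.
have rt (x : node g) : isroot x by apply/isrootP => e; case: (ne e).
have nr (y : {x : node g | ~~ isroot x}) : False by case: y => x; rewrite rt.
exists (fun=> None), (fun e => match ne e with end); split.
- apply: inj_surj_bij => [|[[]|]]; last by exists None.
  by case=> [x|] [y|].
- by apply: inj_surj_bij => [e|[]]; case: (ne e).
- by move=> e; case: (ne e).
- have bigr (T : Type) (idx : T) (op : Monoid.com_law idx) F :
    \big[op/idx]_(z : node g | isroot z) F z = F x0.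
    rewrite (bigD1 x0) ?rt //= big1 ?Monoid.mulm1 // => z.
    by rewrite (all z) eqxx andbF.
  by case=> [x|]; [case: (nr x)|split; rewrite [RHS]/= bigr].
- by move=> e; case: (ne e).
Qed.

Lemma Phi_empty_point (h : dgraph d L) : (node h -> False) ->
  dgraph_iso (join_roots (Phat (Phi h 2) 2)) (gr 2 0 0 (pempty d L)).
Proof.
move=> nh.
have all (x : node (Phat (Phi h 2) 2)) : x = inr tt.
  by case: x => [[x H]|[]] //; case: (nh x).
have ne : edge (Phat (Phi h 2) 2) -> False.
  by case=> [[e _]|[]]; case: (nh (src e)).
have -> : gr 2 0 0 (pempty d L) = gr (@ncol _ _ (Phat (Phi h 2) 2) (inr tt))
    (@ndec _ _ (Phat (Phi h 2) 2) (inr tt))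
    (@odec _ _ (Phat (Phi h 2) 2) (inr tt)) (pempty d L).
  congr gr; last by rewrite [RHS]/=; case: ifP.
  by rewrite [RHS]/= big1 // => x; case: (nh x).
exact: join_roots_point.
Qed.

Lemma one2_gr : one2 d L = cls (gr 2 0 0 (pempty d L)).
Proof.
apply/cls_eqP; apply: Phi_empty_point.
by case=> C /imsetP[[]].
Qed.

End Classes.

(** * Contraction of trees without coloured edges *)

Section Contractions.
Variables (d : nat) (L : finType).
Implicit Types g : dgraph d L.

Lemma joined_none g (E : {set edge g}) x y :
  (forall e, e \notin E) -> joined E x y -> y = x.
Proof.
move=> E0 H; apply: (joined_ind (P := fun z => z = x)) H _ => // e eE.
by case/negP: (E0 e).
Qed.

Lemma block_trivial g (x : node g) : (forall e : edge g, ecol e = 0%N) ->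
  block x = [set x]%SET.
Proof.
move=> e0; apply/setP => y; rewrite !inE; apply/idP/eqP => [|->].
  by apply: joined_none => e; rewrite inE e0.
exact: joined_refl.
Qed.

Lemma Kcontract_trivial g : (forall e : edge g, ecol e = 0%N) ->
  dgraph_iso (Kcontract g) g.
Proof.
move=> e0; apply: dgraph_iso_sym.
have e0' (e : edge g) : ecol e == 0%N by rewrite e0.
have bl (x : node g) := block_trivial x e0.
exists (@to_block _ _ g), (fun e => Sub e (e0' e)); split => //.
- apply: inj_surj_bij => [x y /(congr1 val)/=|[C CB]].
    by rewrite !bl => /set1_inj.
  by have /imsetP[x _ Cx] := CB; exists x; apply: val_inj; rewrite /= Cx.
- by apply: inj_surj_bij => [x y /(congr1 val)//|[e e0'']]; exists e; apply: val_inj.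
- move=> x /=; rewrite bl !big_set1; split => //.
  by rewrite big_pred0 ?addr0 // => e; rewrite e0.
Qed.

Lemma iso_K_trivial g : dgraph_iso g (Kcontract g) -> forall e : edge g, ecol e = 0%N.
Proof.
case=> fN [fE [_ _ _ _ ee]] e; have [_ <- _] := ee e.
by have /= /eqP := valP (fE e).
Qed.

Lemma bigmax_cst (T : finType) (P : pred T) (F : T -> nat) (m : nat) (x0 : T) :
  P x0 -> F x0 = m -> (forall x, P x -> (F x <= m)%N) -> \max_(x | P x) F x = m.
Proof.
move=> P0 F0 Pm; apply/eqP; rewrite eqn_leq -{2}F0 leq_bigmax_cond // andbT.
exact/bigmax_leqP.
Qed.

Section Phi.
Variables (h : dgraph d L).
Hypothesis e0 : forall e : edge h, ecol e = 0%N.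
Hypothesis r2 : forall x : node h, isroot x -> ncol x = 2%N /\ odec x = 0.
Variable x0 : node h.
Hypothesis r0 : isroot x0.
Let G := Phat (Phi h 2) 2.

Let nmono_src (e : edge h) : ~~ mono 2 (src e).
Proof.
apply/negP => /andP[_ /forallP/(_ e)]; rewrite e0 implybF => /negP; apply.
exact: joined_refl.
Qed.

Let nmono_tgt (e : edge h) : ~~ mono 2 (tgt e).
Proof.
apply/negP => /andP[_ /forallP/(_ e)]; rewrite e0 implybF => /negP; apply.
by rewrite joinedC; apply: joined_edge; rewrite inE.
Qed.

Let N := [set x : node h | ~~ mono 2 x]%SET.
Let NP x : x \in N = ~~ mono 2 x. Proof. by rewrite inE. Qed.

Let pE (e : edge h) : e \in sE (induced N).
Proof. by rewrite !inE nmono_src nmono_tgt. Qed.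

Let k (x : node h) : node G :=
  if (insub x : option {x : node h | x \in N}) is Some y then inl y else inr tt.

Let kE (e : edge h) : edge G := inl (Sub e (pE e)).

Let kN (x : node h) (H : x \in N) : k x = inl (Sub x H).
Proof. by rewrite /k insubT. Qed.

Let k_root (x : node h) : isroot (k x) = isroot x.
Proof.
apply/isrootP/isrootP => H.
  move=> e ex; apply: (H (kE e)); have xN : x \in N by rewrite NP -ex nmono_tgt.
  by rewrite (kN xN) /=; congr inl; apply: val_inj.
case=> [[e eN]|[]]; rewrite /= => ek; apply: (H e); move: ek.
rewrite /k; case: insubP => // u uN <- [] <-.
by [].
Qed.

(** Components of colour 2 are single nodes here, and [join_roots] merges them
    with the root, whether or not [Phi] has first replaced them by one node. *)
Lemma join_Phi_trivial : dgraph_iso (join_roots h) (join_roots (Phat (Phi h 2) 2)).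
Proof.
have nrN x : ~~ isroot x -> x \in N.
  rewrite NP => /forallPn[e]; rewrite negbK => /eqP <-; exact: nmono_tgt.
pose f (x : option {x : node h | ~~ isroot x}) : option {x : node G | ~~ isroot x} :=
  if x is Some y then insub (k (val y)) else None.
have fq (x : node h) : f (insub x) = insub (k x).
  case: insubP => [u ux <- //|] /=.
  by rewrite negbK => rx; rewrite insubN // negbK k_root.
have E2 (e : edge (Phi h 2)) : e \notin ecolset (Phi h 2) 2.
  by case: e => [[e eN]|[]]; rewrite inE /= e0.
exists f, kE; split.
- apply: inj_surj_bij => [[[x nx]|] [[y ny]|] //=|].
  + rewrite !insubT ?k_root // => nx' ny' [].
    rewrite (kN (nrN _ nx)) (kN (nrN _ ny)) => -[xy].
    by congr Some; apply: val_inj.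
  + by rewrite !insubT ?k_root.
  + by rewrite !insubT ?k_root.
  + case=> [[[[x xN]|[]] nx]|]; last by exists None.
      have nx' : ~~ isroot x by rewrite -k_root (kN xN).
      exists (Some (exist (fun x : node h => ~~ isroot x) x nx')).
      rewrite /= insubT ?k_root // => nk; congr Some; apply: val_inj.
      by rewrite /= (kN xN).
    by exfalso; case/negP: (nx); apply/isrootP; case=> [|[]].
- apply: inj_surj_bij => [e e' [] //|[[e eN]|[]]].
  by exists e; congr inl; apply: val_inj.
- have kq (x : node h) (xN : x \in N) : inl (Sub x xN) = k x by rewrite (kN xN).
  move=> e; split; rewrite [RHS]fq.
    have xN : @src _ _ h e \in N by rewrite NP; exact: nmono_src.
    by rewrite -(kq _ xN) /=; congr insub; congr inl; apply: val_inj.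
  have xN : @tgt _ _ h e \in N by rewrite NP; exact: nmono_tgt.
  by rewrite -(kq _ xN) /=; congr insub; congr inl; apply: val_inj.
- case=> [[x nx]|].
    rewrite /f; rewrite insubT ?k_root // => nk.
    rewrite /= (kN (nrN _ nx)) /=; split => //.
    case: ifP => // /andP[_ /existsP[y /andP[ry jy]]].
    move: (joined_none E2 jy) ry => -> ; rewrite -(kN (nrN _ nx)).
    by move=> rk; exfalso; move/negP: (nk); apply; exact: rk.
  have rG (z : node G) : isroot z -> ncol z = 2%N /\ odec z = 0.
    case: z => [[x xN]|[]] rz; last by split => //=; case: ifP.
    have rx : isroot x by rewrite -k_root (kN xN).
    have [cx ox] := r2 rx.
    by split; rewrite //= ox; case: ifP.
  have rtt : @isroot _ _ G (inr tt) by apply/isrootP; case=> [|[]].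
  split.
  + rewrite /=; transitivity 2%N.
      apply: (@bigmax_cst _ _ _ _ (inr tt : node G)) => //.
      by move=> z /rG[cz _]; exact: eq_leq cz.
    by apply/esym/(@bigmax_cst _ _ _ _ x0) => // [|z /r2[->]//]; have [->] := r2 r0.
  + rewrite /= big_sumType /=.
    transitivity (\sum_(x in N | isroot x) ndec x
                  + \sum_(x : node h | mono 2 x) ndec x).
      congr (_ + _).
        rewrite [RHS]big_sub_cond /=; apply: eq_bigl => x.
        by rewrite -[in RHS]k_root (kN (valP x)); congr isroot; congr inl; apply: val_inj.
      by rewrite (big_pred1 tt) // => -[]; apply/rtt.
    rewrite [RHS](bigID (fun x => x \in N)) /=; congr (_ + _).
      by apply: eq_bigl => x; rewrite andbC.
    apply: eq_bigl => x; rewrite NP negbK andbC.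
    case m: (mono 2 x) => //=; apply/esym/isrootP => e ex.
    by case/negP: (nmono_tgt e); rewrite ex.
  + rewrite /= !big1 // => z; first by case/r2.
    by case/rG.
- by move=> e; split; rewrite //= e0.
Qed.
End Phi.

Lemma JKhat2_trivial g (x0 : node g) : (forall e : edge g, ecol e = 0%N) ->
  (forall x : node g, isroot x -> ncol x = 2%N /\ odec x = 0) -> isroot x0 ->
  dgraph_iso (JKhat2 g) (join_roots g).
Proof.
move=> e0 r2 r0.
have iK := dgraph_iso_sym (Kcontract_trivial e0).
apply: dgraph_iso_trans (join_roots_iso (dgraph_iso_sym iK)).
apply: dgraph_iso_sym.
have [fN [fE [bf bE st nn ee]]] := iK.
have fr := iso_isroot bf bE st; have [f' fK f'K] := bf.
apply: (@join_Phi_trivial (Kcontract g) _ _ (fN x0)).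
- by move=> e /=; exact/eqP/(valP e).
- move=> x; rewrite -[x]f'K fr => /r2.
  by have [-> _ ->] := nn (f' x).
- by rewrite fr.
Qed.

Lemma join_roots_single g (r : node g) : (forall x : node g, isroot x = (x == r)) ->
  dgraph_iso (join_roots g) g.
Proof.
move=> rt.
pose f (x : option {x : node g | ~~ isroot x}) : node g := oapp val r x.
have fq (x : node g) : f (insub x) = x.
  by case: insubP => [u _ <- //|]; rewrite rt negbK => /eqP ->.
have bigr (T : Type) (idx : T) (op : Monoid.com_law idx) F :
    \big[op/idx]_(z : node g | isroot z) F z = F r.
  by rewrite (eq_bigl _ _ rt) big_pred1_eq.
exists f, id; split => //.
- apply: inj_surj_bij => [[[x nx]|] [[y ny]|] //=|x].
  + by move=> xy; congr Some; apply: val_inj.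
  + by move=> xr; exfalso; move/negP: (nx); apply; rewrite rt xr.
  + by move=> yr; exfalso; move/negP: (ny); apply; rewrite rt yr.
  + by exists (insub x); rewrite fq.
- by exists id.
- by move=> e /=; rewrite !fq.
- by case=> [//|]; split; rewrite [RHS]/= bigr.
Qed.

Lemma JKhat2_gr n (P : ptree d L) : dgraph_iso (JKhat2 (gr 2 n 0 P)) (gr 2 n 0 P).
Proof.
apply: dgraph_iso_trans (join_roots_single (isroot_gr (o := 0) (P := P))).
apply: (@JKhat2_trivial (gr 2 n 0 P) None) => //.
- by move=> x; rewrite isroot_gr => /eqP ->.
- by rewrite isroot_gr.
Qed.

Lemma exists_root g (y : node g) : rooted_forest g ->
  exists2 r : node g, isroot r & connect (@earc d L g) r y.
Proof.
move=> rf; have hh := forest_depth rf.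
suff H n : forall y : node g, (depth y < n)%N ->
  exists2 r : node g, isroot r & connect (@earc d L g) r y by exact: (H (depth y).+1).
elim: n => // n IH {}y yn; case: (boolP (isroot y)) => [ry|].
  by exists y => //; exact: connect0.
case/forallPn => e; rewrite negbK => /eqP ey; move: yn; rewrite -ey => yn.
have [r rr rc] := IH (src e) (leq_trans (hh e) yn).
exists r => //; apply: connect_trans rc (connect1 _).
by apply/existsP; exists e; rewrite !eqxx.
Qed.

Lemma joined_connect g (x y : node g) : connect (@earc d L g) x y -> joined finset.setT x y.
Proof.
apply: connect_sub => u v /existsP[e /andP[/eqP <- /eqP <-]].
by apply: joined_edge; rewrite inE.
Qed.

Lemma join_Phi_colours (h : dgraph d L) (x : node (join_roots (Phat (Phi h 2) 2))) :
  (forall z : node h, (ncol z <= 2)%N) ->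
  (isroot x -> ncol x = 2%N) /\
  (~~ isroot x -> exists e : edge h, ncol x = ncol (tgt e)).
Proof.
move=> cn; pose G := Phat (Phi h 2) 2.
have rN (u : node (join_roots G)) : isroot u = (u == None).
  apply/isrootP/eqP => [|-> e].
    case: u => // -[x' nx] H; case/forallPn: (nx) => e; rewrite negbK => /eqP ex.
    exfalso; apply: (H e).
    by rewrite -[LHS]/(insub (@tgt _ _ G e)) ex insubT.
  rewrite -[LHS]/(insub (@tgt _ _ G e)); case: insubP => // /negP[].
  by apply/forallPn; exists e; rewrite negbK.
have cG (z : node G) : (ncol z <= 2)%N by case: z => [[z zN]|[]] //=; exact: cn.
split; rewrite rN; case: x => [[z nz]|] // _.
  rewrite -[LHS]/(\max_(z : node G | isroot z) ncol z).
  apply: (@bigmax_cst _ _ _ _ (inr tt : node G)); last by move=> z' _; exact: cG.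
    by apply/isrootP; case=> [|[]].
  by [].
case/forallPn: (nz) => e; rewrite negbK => /eqP ez.
have -> : ncol (Some (exist (fun x : node G => ~~ isroot x) z nz) : node (join_roots G))
   = ncol z by [].
by rewrite -ez; case: e {ez} => [[e eN]|[]]; exists e.
Qed.

Lemma block_colour g (y : node g) :
  (forall e : edge g, ecol e != 0%N -> ncol (src e) = ecol e /\ ncol (tgt e) = ecol e) ->
  \max_(x in block y) ncol x = ncol y.
Proof.
move=> cole; apply: (@bigmax_cst _ _ _ _ y) => //.
  by rewrite inE; exact: joined_refl.
move=> x; rewrite inE => J; apply: eq_leq.
apply: (joined_ind (P := fun z => ncol z = ncol y) _ J) => // e.
by rewrite inE => /cole[-> ->].
Qed.

(** The nodes of colour 2 of an element of [F_two] are contracted to the root: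
    a node of colour 2 that an edge of another colour enters would be separated
    by that edge from the root of its component, although both have colour 2. *)
Lemma JKhat2_colours g : F_two g ->
  (forall x : node (JKhat2 g), isroot x -> ncol x = 2%N) /\
  (forall x : node (JKhat2 g), ~~ isroot x -> ncol x <> 2%N).
Proof.
move=> [[rf cole _ _] [cn ce] r2 c2]; have [inj ac] := rf.
have cK (z : node (Kcontract g)) : (ncol z <= 2)%N.
  by apply/bigmax_leqP => x _; exact: cn.
split=> x; have [H1 H2] := join_Phi_colours x cK; first exact: H1.
move=> /H2 [[e e0] ->].
rewrite -[ncol _]/(\max_(x in block (@tgt _ _ g e)) ncol x) (block_colour _ cole) => cy.
have ynb : forall e', e' \in ecolset g 2 -> tgt e' <> tgt e.
  by move=> e'; rewrite inE => e'2 /inj ee; rewrite ee (eqP e0) in e'2.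
have [r rr rc] := exists_root (tgt e) rf.
have : joined (ecolset g 2) (tgt e) r.
  by apply: c2 => //; [exact: r2|rewrite joinedC; exact: joined_connect].
move/(joined_above inj ynb) => /(_ (connect0 _ _)) /connect_earc_last [ry|[e' er _]].
  by move/isrootP: rr => /(_ e); rewrite ry.
by move/isrootP: rr => /(_ e').
Qed.

End Contractions.

(** * Invariance under isomorphism *)

Section IsoInvariance.
Variables (R : realType) (d : nat) (L : finType).
Variables (s : 'I_d -> R) (deg : L -> R) (rl : rule d L).
Implicit Types g : dgraph d L.

Lemma frakTP g : frakT g <->
  [/\ rtree g, forall x : node g, ncol x = 0%N /\ odec x = 0
    & forall e : edge g, ecol e = 0%N].
Proof.
split=> [[[rf c1 c2 c3] it [cn ce]]|[/rtreeP[rf it] c e0]].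
  split; first exact/rtreeP.
    move=> x; have c0 : ncol x = 0%N by apply/eqP; rewrite -leqn0.
    by split => //; exact: c2.
  by move=> e; apply/eqP; rewrite -leqn0.
split => //; last by split=> [x|e]; rewrite ?e0 //; have [->] := c x.
by split => // [e|x|e]; rewrite ?e0 //; have [] := c x.
Qed.

Lemma ntypeE g (x : node g) p :
  ntype x p = \sum_(e : edge g | src e == x) ((typ e, edec e) == p : nat).
Proof.
rewrite /ntype mset_seqE count_map count_filter -sum1_count big_enum_cond /=.
by rewrite [RHS]big_mkcond [LHS]big_mkcond; apply: eq_bigr => e _ /=;
  case: (src e == x); rewrite ?andbT ?andbF //; case: (_ == p).
Qed.

Section OneIso.
Variables (g h : dgraph d L) (fN : node g -> node h) (fE : edge g -> edge h).
Hypothesis bN : bijective fN.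
Hypothesis bE : bijective fE.
Hypothesis st : forall e, src (fE e) = fN (src e) /\ tgt (fE e) = fN (tgt e).
Hypothesis nn : forall x, [/\ ncol (fN x) = ncol x, ndec (fN x) = ndec x
                    & odec (fN x) = odec x].
Hypothesis ee : forall e, [/\ typ (fE e) = typ e, ecol (fE e) = ecol e
                    & edec (fE e) = edec e].

Lemma iso_ntype x : ntype (fN x) = ntype x.
Proof.
apply/msetP => p; rewrite !ntypeE (reindex fE) /=; last exact: onW_bij.
apply: eq_big => e; first by have [-> _] := st e; rewrite (bij_eq bN).
by move=> _; have [-> _ ->] := ee e.
Qed.

Lemma iso_conforms x : conforms rl x -> conforms rl (fN x).
Proof.
have [fN' fK f'K] := bN; have [fE' fEK fE'K] := bE.
rewrite /conforms iso_ntype => -[c1 c2]; split; last by rewrite (iso_isroot bN bE).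
move=> e ex; have := c1 (fE' e); have [<- _ _] := ee (fE' e); rewrite fE'K; apply.
by apply: (can_inj fK); have [_ <-] := st (fE' e); rewrite fE'K.
Qed.

Lemma iso_rtree_at r (k : node g -> nat) : rtree_at r k ->
  exists k', @rtree_at d L h (fN r) k'.
Proof.
have [fN' fK f'K] := bN; have [fE' fEK fE'K] := bE.
have st' e : src e = fN (src (fE' e)) /\ tgt e = fN (tgt (fE' e)).
  by rewrite -{1 3}[e]fE'K; exact: st.
case=> inj er ex kk; exists (k \o fN'); split.
- move=> e1 e2; have [_ ->] := st' e1; have [_ ->] := st' e2 => /(can_inj fK)/inj.
  exact: (can_inj fE'K).
- by move=> e; have [_ ->] := st' e => /(can_inj fK)/er.
- move=> x xr; have [|e ex'] := ex (fN' x).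
    by move=> fx; apply: xr; rewrite -fx f'K.
  by exists (fE e); have [_ ->] := st e; rewrite ex' f'K.
- by move=> e; have [-> ->] := st' e; rewrite /= !fK.
Qed.

Lemma iso_frakT : frakT g -> frakT h.
Proof.
have [fN' fK f'K] := bN; have [fE' fEK fE'K] := bE.
move=> /frakTP[[r [k rk]] c e0]; apply/frakTP; split.
- by have [k' rk'] := iso_rtree_at rk; exists (fN r), k'.
- by move=> x; have [] := nn (fN' x); rewrite f'K => -> _ ->.
- by move=> e; have [_] := ee (fE' e); rewrite fE'K => ->.
Qed.

Lemma iso_deg_minus : deg_minus s deg h = deg_minus s deg g.
Proof.
rewrite /deg_minus; congr (_ + _).
  rewrite (reindex fE) /=; last exact: onW_bij.
  apply: eq_big => e; first by have [_ -> _] := ee e.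
  by move=> _; have [-> _ ->] := ee e.
rewrite (reindex fN) /=; last exact: onW_bij.
by apply: eq_bigr => e _; have [_ -> _] := nn e.
Qed.
End OneIso.

Lemma iso_T_minus g (h : dgraph d L) :
  dgraph_iso g h -> T_minus s deg rl g -> T_minus s deg rl h.
Proof.
move=> gh [[fT fc] dm nr np].
have hg := dgraph_iso_sym gh.
have [fN [fE [bN bE st nn ee]]] := gh; have [fN' fK f'K] := bN.
split.
- split; first exact: iso_frakT bN bE st nn ee fT.
  by move=> x; rewrite -[x]f'K; apply: iso_conforms bN bE st ee _ _; apply: fc.
- by rewrite (iso_deg_minus bN bE nn ee).
- move=> x; rewrite -[x]f'K (iso_isroot bN bE st) => /nr.
  by have [_ -> _] := nn (fN' x).
- move=> [t [k [h' [p1 p2 p3]]]]; apply: np; exists t, k, h'; split => //.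
  exact: dgraph_iso_trans gh p3.
Qed.

End IsoInvariance.

(** Two nodes of the same type have the same multiset of edge labels; this
    matches the edges themselves. *)
Lemma perm_map_bij (T T' K : eqType) (f : T -> K) (f' : T' -> K) (s : seq T) (s' : seq T') :
  uniq s -> uniq s' -> perm_eq (map f' s') (map f s) ->
  exists b : T' -> option T,
    [/\ forall e', e' \in s' -> exists e, [/\ b e' = Some e, e \in s & f e = f' e'],
        forall e1 e2 e, b e1 = Some e -> b e2 = Some e -> e1 = e2,
        forall e' e, b e' = Some e -> e' \in s'
      & forall e, e \in s -> exists e', b e' = Some e ].
Proof.
elim: s' s => [|a s' IH] s us /=.
  move=> _ ps; have -> : s = [::] by case: s ps {us} => //= x s /perm_size.
  by exists (fun=> None); split.
case/andP=> as' us' ps.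
have /mapP[b bs fb] : f' a \in map f s by rewrite -(perm_mem ps) mem_head.
have pr := perm_to_rem bs.
have ps' : perm_eq (map f' s') (map f (rem b s)).
  rewrite -(perm_cons (f' a)); apply: perm_trans ps _.
  by rewrite fb -map_cons; exact: perm_map.
have [B [B1 B2 B3 B4]] := IH _ (rem_uniq b us) us' ps'.
have memB e' e : B e' = Some e -> e \in rem b s.
  move=> Be; have [e1 [Be1 e1s _]] := B1 _ (B3 _ _ Be).
  by move: Be1; rewrite Be => -[->].
have nb : b \notin rem b s by rewrite mem_rem_uniqF.
exists (fun e => if e == a then Some b else B e); split.
- move=> e'; rewrite inE; case: eqVneq => [-> _|_ /= /B1[e [Be es fe]]].
    by exists b.
  by exists e; split => //; exact: mem_rem es.
- move=> e1 e2 e; case: eqVneq => [->|_]; case: eqVneq => [->|_] //.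
  + by move=> [<-] /memB; rewrite (negbTE nb).
  + by move=> /memB + [eb]; rewrite -eb (negbTE nb).
  + exact: B2.
- move=> e' e; rewrite inE; case: eqVneq => //= _; exact: B3.
- move=> e; rewrite (perm_mem pr) inE => /orP[/eqP ->|/B4[e' Be']].
    by exists a; rewrite eqxx.
  exists e'; case: eqVneq => // ea; move: (B3 _ _ Be').
  by rewrite ea (negbTE as').
Qed.

(** * Substitution of a subtree for a node *)

Lemma joined_src (d : nat) (L : finType) (g : dgraph d L) (E : {set edge g}) (x y : node g) :
  (forall e, e \in E -> src e <> x /\ tgt e <> x) -> joined E x y -> y = x.
Proof.
move=> Ex J; apply: (joined_ind (P := fun z => z = x)) J _ => // e /Ex[]; by split.
Qed.

Lemma block_joined (d : nat) (L : finType) (g : dgraph d L) (x y : node g) :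
  joined [set e | ecol e != 0%N]%SET x y -> block x = block y.
Proof.
move=> xy; apply/setP => z; rewrite !inE; apply/idP/idP; apply: joined_trans => //.
by rewrite joinedC.
Qed.

Section Extracted.
Variables (d : nat) (L : finType).
Variables (f : dgraph d L) (A : subforest f).
Variables (eps : {ffun edge f -> mindex d}) (nA : {ffun node f -> mindex d}).
Hypothesis At : sub_tree A.
Let E := extracted A eps nA.

Lemma ecol_extracted : [set e : edge E | ecol e != 0%N]%SET = sE A.
Proof. by apply/setP => e; rewrite !inE /=; case: (e \in sE A). Qed.

Lemma block_in_extracted (y : node E) : y \in sN A -> block y = sN A.
Proof.
move=> yA; apply/setP => z; rewrite inE ecol_extracted; apply/idP/idP => [J|zA].
  apply: (joined_ind (g := E) (P := fun z => z \in sN A)) J yA => e eA.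
  by rewrite sub_src // sub_tgt.
by have [_] := At; apply.
Qed.

Lemma block_out_extracted (y : node E) : y \notin sN A -> block y = [set y]%SET.
Proof.
move=> yA; apply/setP => z; rewrite !inE ecol_extracted; apply/idP/eqP => [|->]; last first.
  exact: joined_refl.
apply: joined_src => e eA; split=> ey; move: yA; rewrite -ey.
  by move/negP; apply; apply: sub_src.
by move/negP; apply; apply: sub_tgt.
Qed.

End Extracted.

Section Surgery.
Variables (R : realType) (d : nat) (L : finType).
Variables (s : 'I_d -> R) (deg : L -> R) (rl : rule d L).
Variables (f : dgraph d L) (A : subforest f).
Variables (eps : {ffun edge f -> mindex d}) (nA : {ffun node f -> mindex d}).
Hypothesis fT : frakT f.
Hypothesis At : sub_tree A.
Hypothesis Ac : {in sN A, forall y, conforms rl y}.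
Hypothesis cs : cut_supp A eps nA.
Hypothesis Tm : T_minus s deg rl (cut_left A eps nA).
Variables (g' : dgraph d L) (x' : node g').
Hypothesis gT : frakT g'.
Variable gam : edge g' -> option (edge f).
Hypothesis gam1 : forall e' e, gam e' = Some e ->
  [/\ src e' = x', e \notin sE A, src e \in sN A, typ e = typ e'
    & cut_e A eps e = edec e'].
Hypothesis gam2 : forall e', src e' = x' -> exists e, gam e' = Some e.
Hypothesis gam3 : forall e1 e2 e, gam e1 = Some e -> gam e2 = Some e -> e1 = e2.
Hypothesis gam4 : forall e, e \notin sE A -> src e \in sN A ->
  exists e', gam e' = Some e.
Variable rA : node f.
Hypothesis rA_in : rA \in sN A.
Hypothesis rA_root : forall e, e \in sE A -> tgt e <> rA.
Hypothesis rA_other : forall y, y \in sN A -> y <> rA ->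
  exists2 e, e \in sE A & tgt e = y.
Hypothesis inc : forall e', tgt e' = x' -> rl (typ e') (ntype rA).
Hypothesis rc : exists t, rl t (ntype rA).
Hypothesis nx : ndec x' = \sum_(y in sN A) cut_n nA y.

Local Notation NA := {y : node f | y \in sN A}.
Local Notation EA := {e : edge f | e \in sE A}.
Local Notation N' := {z : node g' | z != x'}.

Let rA' : NA := Sub rA rA_in.
Let emb (z : node g') : NA + N' :=
  if insub z is Some w then inr w else inl rA'.

(** The tree [g'] with the subtree [A] of [f] in place of the node [x']: the
    edge into [x'] now ends at the root of [A], and an edge out of [x'] starts
    where the edge of [f] that [gam] associates with it leaves [A].  Such an
    edge keeps its decoration in [f], which becomes the one in [g'] when [eps]
    is added. *)
Definition surgery : dgraph d L :=
  @DGraph d L (NA + N')%type (EA + edge g')%type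
    (sumf (fun e => inl (Sub (src (val e)) (sub_src (valP e))))
          (fun e' => if gam e' is Some e then inl (insubd rA' (src e))
                     else emb (src e')))
    (sumf (fun e => inl (Sub (tgt (val e)) (sub_tgt (valP e))))
          (fun e' => emb (tgt e')))
    (sumf (fun e => typ (val e)) (@typ d L g'))
    (fun=> 0%N) (fun=> 0%N)
    (sumf (fun y => ndec (val y)) (fun z => ndec (val z)))
    (fun=> 0)
    (sumf (fun e => edec (val e))
          (fun e' => if gam e' is Some e then edec e else edec e')).

Let embx : emb x' = inl rA'.
Proof. by rewrite /emb insubN // eqxx. Qed.

Let embn (z : N') : emb (val z) = inr z.
Proof. by rewrite /emb insubT ?(valP z) //= => H; congr inr; apply: val_inj. Qed.

Let embne z (H : z != x') : emb z = inr (Sub z H).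
Proof. by rewrite /emb insubT. Qed.

Let emb_inj : injective emb.
Proof.
move=> z1 z2; rewrite /emb; case: insubP => [u _ <-|]; case: insubP => [v _ <-|] //.
- by move=> [->].
- by rewrite !negbK => /eqP -> /eqP ->.
Qed.

Let emb_l z y : emb z = inl y -> z = x' /\ y = rA'.
Proof.
by rewrite /emb; case: insubP => // ; rewrite negbK => /eqP -> [].
Qed.

Let surgA_subproof : is_subforest (g := surgery)
  ([set u | if u is inl _ then true else false]%SET,
   [set e | if e is inl _ then true else false]%SET).
Proof. by apply/forall_inP; case=> e; rewrite inE // !inE. Qed.

Let A' : subforest surgery := Sub _ surgA_subproof.

Let NA'P (u : node surgery) : u \in sN A' = if u is inl _ then true else false.
Proof. by rewrite inE. Qed.
Let EA'P (u : edge surgery) : u \in sE A' = if u is inl _ then true else false.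
Proof. by rewrite inE. Qed.

Let epsf (e : EA + edge g') : mindex d :=
  match e with inl _ => 0
     | inr e' => if gam e' is Some e then eps e else 0 end.
Let nAf (u : NA + N') : mindex d :=
  match u with inl y => nA (val y) | inr _ => 0 end.
Let eps' : {ffun edge surgery -> mindex d} := [ffun e : edge surgery => epsf e].
Let nA' : {ffun node surgery -> mindex d} := [ffun u : node surgery => nAf u].

Let eps0 e : e \in sE A -> eps e = 0.
Proof. by move=> eA; have [_ _] := cs; apply; rewrite eA. Qed.

(** The edges out of a node of [A] belong to [A] or leave it, and the latter
    are matched by [gam] with edges out of [x']; so all that happens on the
    nodes of [A] is the same in the two trees. *)
Lemma surgery_out (T : Type) (idx : T) (op : Monoid.com_law idx) (y : NA)
    (F : edge f -> T) (F' : edge surgery -> T) :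
  (forall e : EA, F' (inl e) = F (val e)) ->
  (forall e' e, gam e' = Some e -> F' (inr e') = F e) ->
  \big[op/idx]_(e : edge surgery | src e == inl y) F' e =
  \big[op/idx]_(e : edge f | src e == val y) F e.
Proof.
move=> F1 F2; rewrite big_sumType [RHS](bigID (mem (sE A))) /=; congr (op _ _).
  rewrite (eq_bigl (fun e => (e \in sE A) && (src e == val y))); last first.
    by move=> e; rewrite andbC.
  rewrite big_sub_cond; apply: eq_big => [e|e _]; last exact: F1.
  by rewrite (inj_eq (@inl_inj _ _)) -val_eqE.
have H e' : (match gam e' with Some e => inl (insubd rA' (src e))
                     | None => emb (src e') end == inl y :> NA + N')
    = [exists e, (gam e' == Some e) && (src e == val y)].
  case ge: (gam e') => [e|]; last first.
    apply/eqP/existsP => [/emb_l[/gam2[e]]|[e /andP[]] //].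
    by rewrite ge.
  have [_ _ eA _ _] := gam1 ge.
  rewrite (inj_eq (@inl_inj _ _)) -val_eqE val_insubd eA.
  apply/idP/existsP => [ey|[e1 /andP[/eqP[->]]] //].
  by exists e; rewrite eqxx.
rewrite (eq_bigl _ _ H).
pose P e := (src e == val y) && (e \notin sE A).
transitivity (\big[op/idx]_(e | P e) \big[op/idx]_(e' | gam e' == Some e) F e).
  rewrite (exchange_big_dep (fun e' => [exists e, (gam e' == Some e) && (src e == val y)])) /=.
    apply: eq_bigr => e' /existsP[e /andP[/eqP ge ey]].
    rewrite (big_pred1 e) => [|e1]; first exact: F2.
    rewrite ge; apply/andP/eqP => [[_ /eqP[]]//|->]; rewrite eqxx; split=> //.
    by have [_ eA _ _ _] := gam1 ge; rewrite /P ey eA.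
  by move=> e e' /andP[ey _] ge; apply/existsP; exists e; rewrite ge.
apply: eq_bigr => e /andP[/eqP ey eA].
have [|e' ge] := gam4 eA; first by rewrite ey (valP y).
rewrite (big_pred1 e') // => e2; apply/eqP/eqP => [g2|->//].
exact: gam3 g2 ge.
Qed.

Lemma surgery_ntype (y : NA) : ntype (inl y : node surgery) = ntype (val y).
Proof.
apply/msetP => p; rewrite !ntypeE.
apply: (surgery_out _ y) => [//|e' e ge] /=.
by have [_ _ _ <- _] := gam1 ge; rewrite ge.
Qed.

Lemma surgery_frakT : frakT surgery.
Proof.
apply/frakTP; split => //.
have /frakTP[[rf [hf [injf _ _ hhf]]] _ _] := fT.
have /frakTP[[rg [hg [injg rgP rgO hhg]]] _ _] := gT.
(* The heights of [g'] are multiplied by [M] to leave room for those of [A]. *)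
pose M := (\max_(y : node f) hf y).+1.
have hM y : (hf y < M)%N by rewrite ltnS; apply: leq_bigmax.
pose H (u : NA + N') := match u with inl y => (hg x' * M + hf (val y))%N
   | inr z => (hg (val z) * M)%N end.
exists (emb rg), H; split.
- move=> [e1|e1] [e2|e2] /=.
  + by move=> [/injf e12]; congr inl; apply: val_inj.
  + move/esym/emb_l => [_ [er]]; exfalso.
    by have := rA_root (valP e1); apply.
  + move/emb_l => [_ [er]]; exfalso.
    by have := rA_root (valP e2); apply.
  + by move/emb_inj/injg ->.
- move=> [e|e] /=; last by move/emb_inj/rgP.
  move/esym/emb_l => [_ [er]].
  by have := rA_root (valP e); apply.
- move=> [y|z] ur; last first.
    have [|e ez] := rgO (val z); first by move=> zr; apply: ur; rewrite -zr embn.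
    by exists (inr e); rewrite /= ez embn.
  case: (eqVneq y rA') => [yr|yr].
    have [|e ex] := rgO x'; first by move=> xr; apply: ur; rewrite -xr embx yr.
    by exists (inr e); rewrite /= ex embx yr.
  have [|e eA ey] := rA_other (valP y).
    by move=> yr'; case/eqP: yr; apply: val_inj.
  by exists (inl (Sub e eA)); rewrite /=; congr inl; apply: val_inj.
- have Hemb z : (hg z * M <= H (emb z))%N.
    rewrite /emb; case: insubP => [u _ <- //|]; rewrite negbK => /eqP -> /=.
    exact: leq_addr.
  case=> [e|e'] /=; first by rewrite ltn_add2l hhf.
  apply: leq_trans (Hemb _).
  apply: (@leq_trans ((hg (src e')).+1 * M)%N); last by rewrite leq_mul2r hhg orbT.
  case ge: (gam e') => [e|] /=.
    by have [-> _ _ _ _] := gam1 ge; rewrite mulSn addnC ltn_add2r hM.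
  rewrite mulSn /emb; case: insubP => [u _ uz /=|].
    by rewrite uz -[X in (X < _)%N]add0n ltn_add2r.
  by rewrite negbK => /eqP/gam2[e]; rewrite ge.
Qed.

Lemma surgery_sub_tree : sub_tree A'.
Proof.
split; first by exists (inl rA'); rewrite NA'P.
case=> [y|z] [y'|z']; rewrite !NA'P // => _ _.
have [_ jo] := At; have J := jo _ _ (valP y) (valP y').
suff H : forall H : val y' \in sN A, joined (sE A') (inl y) (inl (Sub (val y') H)).
  by rewrite (_ : y' = (Sub (val y') (valP y') : NA)) //; apply: val_inj.
apply: (joined_ind (P := fun w => forall H : w \in sN A,
     joined (sE A') (inl y) (inl (Sub w H)))) J _.
  move=> e eA.
  have J : joined (sE A') (inl (Sub (src e) (sub_src eA)) : node surgery) (inl (Sub (tgt e) (sub_tgt eA))).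
    have := @joined_edge _ _ surgery (sE A') (inl (Sub e eA)).
    rewrite EA'P => /(_ isT); congr joined; congr inl; exact: val_inj.
  split=> H H'.
    by apply: joined_trans (H (sub_src eA)) _; rewrite (bool_irrelevance H' (sub_tgt eA)).
  apply: joined_trans (H (sub_tgt eA)) _; rewrite joinedC.
  by rewrite (bool_irrelevance H' (sub_src eA)).
by move=> H; rewrite (_ : (Sub (val y) H : NA) = y); [exact: joined_refl|apply: val_inj].
Qed.

Lemma surgery_conforms : {in sN A', forall y, conforms rl y}.
Proof.
case=> [y|z]; rewrite NA'P // => _; rewrite /conforms surgery_ntype.
have [c1 c2] := Ac (valP y).
split=> [[e|e'] /= |].
- by case=> ey; apply: c1; rewrite -ey.
- by move/emb_l => [ex ->]; exact: inc.
move=> ry; case: (eqVneq (val y) rA) => [->|/eqP yr]; first exact: rc.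
have [e eA ey] := rA_other (valP y) yr.
exfalso; move/isrootP: ry => /(_ (inl (Sub e eA))); apply; congr inl; exact: val_inj.
Qed.

Lemma surgery_cut_supp : cut_supp A' eps' nA'.
Proof.
have [c1 c2 c3] := cs; split.
- by case=> [y|z] j; rewrite ffunE /=; [exact: c1|rewrite ffunE].
- by case=> [y|z]; rewrite NA'P // ffunE.
- case=> [e|e']; rewrite EA'P ffunE //= NA'P.
  by case: (gam e').
Qed.

Lemma surgery_cut_left : dgraph_iso (cut_left A eps nA) (cut_left A' eps' nA').
Proof.
have /frakTP[_ fc fe] := fT.
have iN (y : NA) : (inl y : node surgery) \in sN A' by rewrite NA'P.
have iE (y : EA) : (inl y : edge surgery) \in sE A' by rewrite EA'P.
exists (fun y => Sub (inl y) (iN y)), (fun e => Sub (inl e) (iE e)); split.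
- apply: inj_surj_bij => [x y [] //|[[y|z] H]].
    by exists y; apply: val_inj.
  by exfalso; move: H; rewrite NA'P.
- apply: inj_surj_bij => [x y [] //|[[y|z] H]].
    by exists y; apply: val_inj.
  by exfalso; move: H; rewrite EA'P.
- by move=> e; split; apply: val_inj; congr inl; apply: val_inj.
- move=> y; have [c0 o0] := fc (val y); split => //=.
  rewrite ffunE; congr (_ + _).
  apply: (surgery_out _ y) => [e|e' e ge]; rewrite ffunE //= ?ge //.
  by rewrite eps0 // (valP e).
- by move=> e; split=> //=; rewrite fe.
Qed.

Lemma mvec0 : mvec L (0 : mindex d) = 0.
Proof. by congr pair; apply/ffunP => j; rewrite !ffunE. Qed.

Lemma surgery_cut_o (y : NA) : cut_o A' eps' nA' (inl y : node surgery) = cut_o A eps nA (val y).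
Proof.
rewrite /cut_o ffunE; congr (_ + _).
apply: (surgery_out _ y) => [e|e' e ge]; rewrite EA'P ffunE.
  by rewrite (valP e) (eps0 (valP e)).
by rewrite /epsf ge; have [_ /negbTE-> _ _ _] := gam1 ge.
Qed.

Lemma surgery_sum (T : Type) (idx : T) (op : Monoid.com_law idx) (F : node surgery -> T)
   (F0 : node f -> T) : (forall y : NA, F (inl y) = F0 (val y)) ->
  \big[op/idx]_(u in sN A') F u = \big[op/idx]_(y in sN A) F0 y.
Proof.
move=> FF; rewrite big_sumType /= [X in op _ X]big_pred0; last by move=> z; rewrite NA'P.
rewrite Monoid.mulm1 big_sub; apply: eq_big => [y|y _]; last exact: FF.
by rewrite NA'P.
Qed.

Lemma surgery_frakD : frakD s deg rl x'
  (\sum_(y in sN A) cut_o A eps nA y + \sum_(e in sE A) mtyp d (typ e)).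
Proof.
exists surgery, A', eps', nA'; split.
- exact: surgery_frakT.
- by split; [exact: surgery_sub_tree|exact: surgery_conforms].
- exact: surgery_cut_supp.
- exact: iso_T_minus surgery_cut_left Tm.
have At' := surgery_sub_tree.
set E' := extracted A' eps' nA'.
have bl (y : NA) : block (inl y : node E') = sN A'.
  by apply: block_in_extracted => //; rewrite NA'P.
have br (z : N') : block (inr z : node E') = [set inr z]%SET.
  by apply: block_out_extracted => //; rewrite NA'P.
have be (z : node g') : block (emb z : node E') =
    if z == x' then sN A' else [set emb z]%SET.
  case: eqVneq => [->|zx]; first by rewrite embx bl.
  by rewrite (embne zx) br.
have fe (e' : edge g') : ecol (inr e' : edge E') == 0%N by rewrite /= EA'P.
exists (fun z => @to_block _ _ E' (emb z)), (fun e' => Sub (inr e') (fe e')); split.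
- apply: inj_surj_bij => [z1 z2 /(congr1 val) /=|[C CB]].
    rewrite !be; case: eqP => [->|zx1]; case: eqP => [->|zx2] //.
    + move=> /setP/(_ (emb z2)); rewrite set11 (embne (introN eqP zx2)).
      by rewrite NA'P.
    + move=> /setP/(_ (emb z1)); rewrite set11 (embne (introN eqP zx1)).
      by rewrite NA'P.
    + by move/set1_inj/emb_inj.
  have /imsetP[[y|z] _ CE] := CB.
    by exists x'; apply: val_inj; rewrite /= embx bl CE bl.
  by exists (val z); apply: val_inj; rewrite /= embn CE.
- apply: inj_surj_bij => [e1 e2 /(congr1 val)[]//|[[e|e'] H]].
    by exfalso; move: H; rewrite /= EA'P.
  by exists e'; apply: val_inj.
- move=> e'; split; apply: val_inj; rewrite //=.
  case ge: (gam e') => [e|//].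
  by have [-> _ _ _ _] := gam1 ge; rewrite embx !bl.
- have /frakTP[_ gc ge0] := gT.
  move=> z; rewrite /= be; case: (eqVneq z x') => [->|zx].
    split.
    + apply: (@bigmax_cst _ _ _ _ (inl rA' : node E')); rewrite ?NA'P //.
      by move=> u; case: (u \in sN A').
    + rewrite nx; apply: surgery_sum => y; apply/ffunP => j; by rewrite !ffunE.
    + congr (_ + _); first by apply: surgery_sum => y; exact: surgery_cut_o.
      rewrite big_sumType /= [X in _ + X]big_pred0 ?addr0; last first.
        by move=> e; rewrite EA'P.
      rewrite [RHS]big_sub /=; apply: eq_bigl => e.
      by rewrite EA'P /= NA'P.
  rewrite !big_set1; have [_ oz] := gc z; split.
  + by rewrite (embne zx) NA'P.
  + rewrite (embne zx); apply/ffunP => j; by rewrite !ffunE subn0.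
  + rewrite big_pred0 ?addr0; last first.
      case=> [e|e'] /=; rewrite EA'P // inE (embne zx).
      by apply/negP => /eqP.
    rewrite (embne zx) /cut_o ffunE mvec0 add0r big1 // => -[e|e'] //=.
    case ge: (gam e') => [e|] //= _; rewrite EA'P ffunE /epsf ge mvec0 subr0.
    by [].
- have /frakTP[_ gc ge0] := gT.
  move=> e'; split => //=; first by rewrite EA'P.
  rewrite /cut_e EA'P ffunE /=.
  case ge: (gam e') => [e|]; last by rewrite addr0.
  by have [_ /negbTE eA _ _ <-] := gam1 ge; rewrite /cut_e eA.
Qed.

End Surgery.

(** * Locality of the extended decorations *)

Section Locality.
Variables (R : realType) (d : nat) (L : finType).
Variables (s : 'I_d -> R) (deg : L -> R) (rl : rule d L).

(** A witness [(f, A)] at [x] gives one at [x']: the conditions on it bear on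
    [A] and on the edges that enter or leave it, hence survive when the rest
    of [f] is replaced by the rest of [g']. *)
Lemma frakD_local (g g' : dgraph d L) (x : node g) (x' : node g') a :
  frakT g -> frakT g' -> ndec x' = ndec x -> ntype x' = ntype x ->
  (forall e', tgt e' = x' -> exists2 e, tgt e = x & typ e = typ e') ->
  frakD s deg rl x a -> frakD s deg rl x' a.
Proof.
move=> gT gT' nx tx inx [f [A [eps [nA [fT [At Ac] cs Tm]]]]].
case=> fN [fE [bN bE st nn ee]].
have /frakTP[/rtreeP[rf _] _ _] := fT.
have [rA [rAin rAr rAo]] := subtree_root rf At.
set E := extracted A eps nA in fN fE bN bE st nn ee.
have colE (C : {set node f}) y : y \in C -> (C = sN A) ->
    \max_(z in C) ncol (z : node E) = 1%N.
  move=> yC CA; apply: (@bigmax_cst _ _ _ _ y) => //.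
    by rewrite /= -CA yC.
  by move=> z _; exact: leq_b1.
have fNx : val (fN x) = sN A.
  have [/= + _ _] := nn x; rewrite eqxx; have /imsetP[y _ ->] := valP (fN x).
  case: (boolP (y \in sN A)) => yA; first by rewrite block_in_extracted.
  by rewrite (block_out_extracted yA) big_set1 /= (negbTE yA).
have fNA z : val (fN z) = sN A -> z = x.
  move=> zA; have [/= + _ _] := nn z; rewrite (colE _ rA) // ?zA //.
  by case: eqP.
pose io (e : edge g) : edge f := val (fE e).
have ioA e : io e \notin sE A by have := valP (fE e); rewrite /=; case: (_ \in _).
have io_inj : injective io by move=> e1 e2 /val_inj/(bij_inj bE).
have io_surj e : e \notin sE A -> exists e0, io e0 = e.
  move=> eA; have e0 : @ecol _ _ E e == 0%N by rewrite /= (negbTE eA).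
  have [fE' _ f'K] := bE; exists (fE' (Sub e e0)).
  by rewrite /io f'K.
have srcA e : (src (io e) \in sN A) <-> src e = x.
  have se : block (src (io e) : node E) = val (fN (src e)) by have [<- _] := st e.
  split=> [eA|ex].
    by apply: fNA; rewrite -se block_in_extracted.
  by rewrite -fNx -ex -se inE; exact: joined_refl.
have tgtA e : tgt e = x -> tgt (io e) \in sN A.
  have te : block (tgt (io e) : node E) = val (fN (tgt e)) by have [_ <-] := st e.
  move=> ex.
  by rewrite -fNx -ex -te inE; exact: joined_refl.
pose lab (h : dgraph d L) (e : edge h) := (typ e, edec e).
have /eq_seq_msetP pe : seq_mset [seq lab g' e | e <- enum (edge g') & src e == x']
     = seq_mset [seq lab g e | e <- enum (edge g) & src e == x] by exact: tx.
have [|| b [b1 b2 b3 b4]] := perm_map_bij _ _ pe; try by rewrite filter_uniq // enum_uniq.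
have memx (h : dgraph d L) (y : node h) e :
    (e \in [seq e <- enum (edge h) | src e == y]) = (src e == y).
  by rewrite mem_filter mem_enum andbT.
pose gam e' := omap io (b e').
have -> : a = \sum_(y in sN A) cut_o A eps nA y + \sum_(e in sE A) mtyp d (typ e).
  have [_ _ /=] := nn x; rewrite eqxx fNx => <-; congr (_ + _).
  apply: eq_bigl => e; case: (boolP (e \in sE A)) => //= eA.
  by rewrite sub_src.
have tio e : tgt e = x -> tgt (io e) = rA.
  move=> ex; apply: contrapT => er.
  have [e2 e2A e2e] := rAo _ (tgtA _ ex) er.
  have [inj _] := rf; move: (ioA e); rewrite -(inj _ _ e2e).
  by rewrite e2A.
apply: (@surgery_frakD _ _ _ s deg rl f A eps nA fT At Ac cs Tm g' x' gT' gam _ _ _ _ rA) => //.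
- move=> e' e; rewrite /gam; case be: (b e') => [e0|//] [<-].
  have [e1 [be1]] := b1 _ (b3 _ _ be); rewrite memx => /eqP e1x [ty ed].
  move: be1; rewrite be => -[e01]; rewrite -{e1}e01 in e1x ty ed.
  have := b3 _ _ be; rewrite memx => /eqP ex'.
  have [t1 _ t2] := ee e0; split => //.
  + exact/srcA.
  + by rewrite -ty -t1.
  + by rewrite -ed -t2.
- move=> e' /eqP; rewrite -memx => /b1[e [be _ _]].
  by exists (io e); rewrite /gam be.
- move=> e1 e2 e; rewrite /gam; case be1: (b e1) => [c1|//] [<-].
  case be2: (b e2) => [c2|//] [/io_inj cc].
  by apply: b2 be1 _; rewrite be2 cc.
- move=> e /io_surj[e0 <-] /srcA /eqP; rewrite -memx => /b4[e' be].
  by exists e'; rewrite /gam be.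
- move=> e' /inx[e ex te]; have [c1 _] := Ac _ rAin.
  have := c1 _ (tio _ ex); have [t1 _ _] := ee e.
  by rewrite -te -t1.
- have [c1 c2] := Ac _ rAin; case: (boolP (isroot rA)) => [/c2//|].
  by case/forallPn => e; rewrite negbK => /eqP er; exists (typ e); exact: c1.
- rewrite nx; have [_ /= <- _] := nn x.
  by rewrite fNx.
Qed.

(** By [frakD_local] the set [frakD] at a node is determined by the type of the
    edge that enters it, by its decoration and by its type; no edge enters the
    root, whence the option. *)
Definition Dloc (ot : option L) (n : mindex d) (N : node_type d L) (a : odeco d L) : Prop :=
  exists (g : dgraph d L) (x : node g),
    [/\ frakT g, ndec x = n, ntype x = N,
        (if ot is Some t then exists2 e, tgt e = x & typ e = t else True)
      & frakD s deg rl x a].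

Lemma Dloc_None ot n N a : Dloc ot n N a -> Dloc None n N a.
Proof. by case=> g [x [gT nx tx _ Dx]]; exists g, x. Qed.

Lemma frakD_Dloc (g : dgraph d L) (x : node g) a : frakT g -> frakD s deg rl x a ->
  Dloc None (ndec x) (ntype x) a /\
  (forall e, tgt e = x -> Dloc (Some (typ e)) (ndec x) (ntype x) a).
Proof. by move=> gT Da; split=> [|e ex]; exists g, x; split => //; exists e. Qed.

Lemma Dloc_frakD_root (g : dgraph d L) (x : node g) a : frakT g -> isroot x ->
  Dloc None (ndec x) (ntype x) a -> frakD s deg rl x a.
Proof.
move=> gT /isrootP rx [g0 [x0 [gT0 nx tx _ Dx]]].
by apply: frakD_local Dx => // e' /rx.
Qed.

Lemma Dloc_frakD (g : dgraph d L) (x : node g) e a : frakT g -> tgt e = x ->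
  Dloc (Some (typ e)) (ndec x) (ntype x) a -> frakD s deg rl x a.
Proof.
move=> gT ex [g0 [x0 [gT0 nx tx ix Dx]]].
apply: frakD_local Dx => // e' ex'.
have /frakTP[[r [h [inj _ _ _]]] _ _] := gT.
by rewrite (inj e' e) // ex' ex.
Qed.

Definition kids (P : ptree d L) (ov : option (pV P)) : node_type d L :=
  seq_mset [seq (ptyp w, pe w) | w <- enum (pV P) & par w == ov].

Lemma kids_ntype c n o (P : ptree d L) (ov : node (gr c n o P)) : ntype ov = kids ov.
Proof. by []. Qed.

Lemma kids_emb (P Q : ptree d L) (f : pV P -> pV Q) ov ov' : injective f ->
  (forall w, ptyp (f w) = ptyp w /\ pe (f w) = pe w) ->
  (forall w, (par (f w) == ov') = (par w == ov)) ->
  (forall w', par w' = ov' -> exists w, f w = w') ->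
  kids ov' = kids ov.
Proof.
move=> inj fl fp fs; apply/eq_seq_msetP.
have -> : [seq (ptyp w, pe w) | w <- enum (pV P) & par w == ov]
   = map (fun w => (ptyp w, pe w)) (map f [seq w <- enum (pV P) | par w == ov]).
  by rewrite -map_comp; apply: eq_map => w /=; have [-> ->] := fl w.
apply/perm_map/uniq_perm.
- by apply: filter_uniq; exact: enum_uniq.
- by rewrite (map_inj_uniq inj); apply: filter_uniq; exact: enum_uniq.
move=> w'; rewrite mem_filter mem_enum andbT; apply/eqP/mapP => [w'v|[w + ->]].
  have [w ww] := fs _ w'v; exists w => //.
  by rewrite mem_filter mem_enum andbT -fp ww w'v.
by rewrite mem_filter mem_enum andbT -fp => /eqP.
Qed.

Lemma kids_iso (P Q : ptree d L) (f : pV P -> pV Q) ov : bijective f ->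
  (forall v, par (f v) = omap f (par v)) ->
  (forall w, ptyp (f w) = ptyp w /\ pe (f w) = pe w) ->
  kids (omap f ov) = kids ov.
Proof.
move=> bf fp fl; have inj := bij_inj bf; apply: (kids_emb inj) => //.
  move=> w; rewrite fp; apply/eqP/eqP => [|->//].
  by case: (par w) ov => [u|] [v|] //= [/inj ->].
by move=> w' _; have [f' _ f'K] := bf; exists (f' w').
Qed.

Lemma kids_psuml (P Q : ptree d L) (v : pV P) :
  kids (Some (inl v : pV (psum P Q))) = kids (Some v).
Proof.
apply: (@kids_emb P (psum P Q) inl) => //= [a b []//|w|[w|w] /=].
- by case: (par w).
- by exists w.
- by case: (par w).
Qed.

Lemma kids_psumr (P Q : ptree d L) (v : pV Q) :
  kids (Some (inr v : pV (psum P Q))) = kids (Some v).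
Proof.
apply: (@kids_emb Q (psum P Q) inr) => //= [a b []//|w|[w|w] /=].
- by case: (par w).
- by case: (par w).
- by exists w.
Qed.

Lemma kids_plantP t k c n o (P : ptree d L) (ov : option (pV P)) :
  kids (Some ov : option (pV (plantP t k c n o P))) = kids ov.
Proof.
by apply: (@kids_emb P (plantP t k c n o P) Some) => //=; case=> [w _|//]; exists w.
Qed.

(** The conditions that [B_plus] imposes on the nodes other than the root, in a
    form that only involves a node and its children, so that they pass to
    products, to branches and to planted trees. *)
Definition goodP (P : ptree d L) : Prop := forall v : pV P,
  (pcol v = 0%N /\ po v = 0 \/
   pcol v = 1%N /\ Dloc (Some (ptyp v)) (pn v) (kids (Some v)) (po v))
  /\ rl (ptyp v) (kids (Some v)).

Lemma goodP_emb (P Q : ptree d L) (f : pV P -> pV Q) :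
  (forall v, [/\ ptyp (f v) = ptyp v, pcol (f v) = pcol v, pn (f v) = pn v
               & po (f v) = po v]) ->
  (forall v, kids (Some (f v)) = kids (Some v)) -> goodP Q -> goodP P.
Proof.
by move=> fd fk Qg v; have := Qg (f v); rewrite fk; have [-> -> -> ->] := fd v.
Qed.

Lemma goodP_iso P Q : piso P Q -> goodP Q -> goodP P.
Proof.
case=> f [bf fp fd]; apply: (goodP_emb (f := f)) => v; have := fd v; first by case.
move=> _; apply: (kids_iso (Some v) bf fp) => w.
by have [-> _ _ _ ->] := fd w.
Qed.

Lemma goodP_psum P Q : goodP (psum P Q) <-> goodP P /\ goodP Q.
Proof.
split=> [H|[HP HQ]].
  split; first by apply: (@goodP_emb P (psum P Q) inl) H => // v; exact: kids_psuml.
  by apply: (@goodP_emb Q (psum P Q) inr) H => // v; exact: kids_psumr.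
by case=> v; [have := HP v; rewrite kids_psuml|have := HQ v; rewrite kids_psumr].
Qed.

Lemma goodP_plantP t k c n o P : goodP (plantP t k c n o P) <->
  goodP P /\ ((c = 0%N /\ o = 0 \/
      c = 1%N /\ Dloc (Some t) n (kids (None : option (pV P))) o) /\
      rl t (kids (None : option (pV P)))).
Proof.
split=> [H|[HP H0]].
  split; last by have := H None; rewrite kids_plantP.
  by apply: (@goodP_emb P (plantP t k c n o P) Some) H => // v; exact: kids_plantP.
by case=> [v|]; [have := HP v|]; rewrite kids_plantP.
Qed.

Lemma iso_forget (g h : dgraph d L) : dgraph_iso g h -> dgraph_iso (forget g) (forget h).
Proof.
case=> fN [fE [bN bE st nn ee]]; exists fN, fE; split => //.
  by move=> x; have [_ ? _] := nn x.
by move=> e; have [? _ ?] := ee e.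
Qed.

Section AroundGr.
Variables (c : nat) (n : mindex d) (o : odeco d L) (P : ptree d L) (g : dgraph d L).
Hypothesis gP : dgraph_iso (gr c n o P) g.

Definition root_cond : Prop :=
  ((c = 0%N \/ c = 2%N) /\ o = 0) \/
  (c = 1%N /\ Dloc None n (kids (None : option (pV P))) o).

Lemma Lambda_gr : acyc P -> goodP P -> root_cond ->
  [/\ Lambda s deg rl g, frakT (forget g),
      forall x : node (forget g), ~~ isroot x -> conforms rl x
    & (exists t, rl t (kids (None : option (pV P)))) ->
        forall x : node (forget g), conforms rl x].
Proof.
move=> aP good rootc; have [fN [fE [bN bE st nn ee]]] := gP.
have [fN' fK f'K] := bN; have [fE' fEK fE'K] := bE.
have rt : rtree g.
  have [r [h rh]] := gr_rtree c n o aP.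
  by have [k rk] := iso_rtree_at bN bE st rh; exists (fN r), k.
have e0 (e : edge g) : ecol e = 0%N.
  by rewrite -[e]fE'K; have [_ -> _] := ee (fE' e).
have fT : frakT (forget g) by apply/frakTP; split.
have [fN2 [fE2 [bN2 bE2 st2 nn2 ee2]]] := iso_forget gP.
have ntx ov : @ntype _ _ (forget g) (fN ov) = kids ov.
  rewrite -(@kids_ntype c n o); exact: (@iso_ntype _ _ (gr c n o P) g fN fE).
have ex v : @tgt _ _ g (fE v) = fN (Some v) by have [_ ->] := st v.
have inj : injective (@tgt _ _ g) by have [r [h []]] := rt.
have conf v : @conforms _ _ rl (forget g) (fN (Some v)).
  have [_ rv] := good v.
  split; last by move/isrootP => /(_ (fE v)); rewrite /= ex.
  move=> e /= ; rewrite -ex => /inj ->; rewrite ex ntx.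
  by have [-> _ _] := ee v.
split => //.
- split.
  + have [rf it] := (rtreeP g).1 rt; split => // [e|x|e]; rewrite ?e0 //.
    rewrite -[x]f'K; have [-> _ ->] := nn (fN' x).
    case: (fN' x) => [v|] /=; first by case: (good v) => -[[_ ->]|[-> _]].
    by case: rootc => [[_ ->//]|[-> _]].
  + exact: dgraph_iso_sym (Kcontract_trivial e0).
  + move=> x; rewrite -[x]f'K; have [-> nd ->] := nn (fN' x).
    case: (fN' x) nd => [v|] /= nd.
      case: (good v) => -[[-> ->]|[-> Dv]] _; first by left; split; [left|].
      right; split => //; apply: (@Dloc_frakD (forget g) _ (fE v)) => //=.
      by rewrite nd ntx; have [-> _ _] := ee v.
    case: rootc => [[c02 ->]|[-> D0]]; [by left|right; split => //].
    apply: Dloc_frakD_root => //; last by rewrite /= nd ntx.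
    apply/isrootP => e /=; rewrite -[e]fE'K ex => /(can_inj fK) //.
- move=> x; rewrite -[x]f'K; case: (fN' x) => [v|] nr; first exact: conf.
  exfalso; case/negP: nr; apply/isrootP => e /=; rewrite -[e]fE'K ex.
  by move=> /(can_inj fK).
- move=> rt0 x; rewrite -[x]f'K; case: (fN' x) => [v|]; first exact: conf.
  split; last by rewrite ntx.
  by move=> e /=; rewrite -[e]fE'K ex => /(can_inj fK).
Qed.

Lemma gr_Lambda : Lambda s deg rl g -> frakT (forget g) ->
  (forall x : node (forget g), ~~ isroot x -> conforms rl x) ->
  (forall v : pV P, pcol v <> 2%N) ->
  [/\ acyc P, goodP P, root_cond &
    (forall x : node (forget g), conforms rl x) ->
      exists t, rl t (kids (None : option (pV P)))].
Proof.
move=> [df _ lam] fT conf c2.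
have [fN [fE [bN bE st nn ee]]] := gP.
have [fN' fK f'K] := bN; have [fE' fEK fE'K] := bE.
have rt : rtree (gr c n o P).
  have /frakTP[[r [h rh]] _ _] := fT.
  have [fM [fF [bM bF stM _ _]]] := dgraph_iso_sym gP.
  by have [k rk] := iso_rtree_at (g := g) bM bF stM rh; exists (fM r), k.
have ntx ov : @ntype _ _ (forget g) (fN ov) = kids ov.
  rewrite -(@kids_ntype c n o); exact: (@iso_ntype _ _ (gr c n o P) g fN fE).
have ex v : @tgt _ _ g (fE v) = fN (Some v) by have [_ ->] := st v.
have rN : @isroot _ _ (forget g) (fN None).
  by apply/isrootP => e /=; rewrite -[e]fE'K ex => /(can_inj fK).
split.
- exact: rtree_acyc rt.
- move=> v; have := lam (fN (Some v)); have [-> nd ->] := nn (Some v).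
  have te : typ (fE v) = ptyp v by have [] := ee v.
  move=> lv; split; last first.
    have [|c1 _] := conf (fN (Some v)).
      by apply/negP => /isrootP/(_ (fE v)); rewrite /= ex.
    by have := c1 (fE v) (ex v); rewrite ntx /= te.
  case: lv => [[[c0|//] o0]|[c1 Dv]]; [by left; split|by case: (c2 v)|right; split => //].
  have [_ /(_ (fE v) (ex v))] := frakD_Dloc fT Dv.
  by rewrite ntx /= te nd.
- have := lam (fN None); have [-> nd ->] := nn None; rewrite /root_cond.
  case=> [[c0 o0]|[c1 Dv]]; [by left|right; split => //].
  by have [] := frakD_Dloc fT Dv; rewrite ntx /= nd.
- by move=> /(_ (fN None)) [_ /(_ rN)]; rewrite ntx.
Qed.

End AroundGr.

Lemma B_plusP c : B_plus s deg rl c <->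
  exists n P, [/\ acyc P, goodP P & c = cls (gr 2 n 0 P)].
Proof.
split=> [[Hc lam [fT conf]]|[n [P [aP good ->]]]].
  have [df iK lamx] := lam.
  have e0 := iso_K_trivial iK.
  have /frakTP[[r [h rh]] _ _] := fT.
  have [g Fg cg] := Hc; have [cr cnr] := JKhat2_colours Fg.
  have gJ : dgraph_iso (JKhat2 g) (rep c) by rewrite {1}cg; exact/dgraph_iso_sym/rep_cls.
  have [fN [fE [bN bE st nn ee]]] := gJ; have [fN' fK f'K] := bN.
  have rtr (x : node (rep c)) : isroot x = (x == r) := rtree_isroot x rh.
  have col2 (x : node (rep c)) : (x == r) = (ncol x == 2%N).
    rewrite -rtr -[x]f'K (iso_isroot bN bE st); have [-> _ _] := nn (fN' x).
    by apply/idP/eqP => [/cr //|]; apply: contraPT => /cnr.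
  have [P [aP Pi Px _]] := rtree_at_gr (g := rep c) rh e0.
  have r2 : @ncol _ _ (rep c) r = 2%N by apply/eqP; rewrite -col2.
  have or : @odec _ _ (rep c) r = 0.
    by case: (lamx r) => -[]; rewrite r2 // => -[].
  move: Pi; rewrite r2 or => Pi.
  have [|aP' good _ _] := gr_Lambda (dgraph_iso_sym Pi) lam fT conf.
    move=> v; have [x xr [-> _ _]] := Px v.
    by apply/eqP; rewrite -col2; apply/eqP.
  exists (@ndec _ _ (rep c) r), P; split => //.
  by apply: etrans (esym (cls_rep c)) _; apply/cls_eqP.
have cr := rep_cls (gr 2 n 0 P).
have [|lam fT conf _] := Lambda_gr (dgraph_iso_sym cr) aP good.
  by left; split; [right|].
split => //.
have [rf it] := (rtreeP _).1 (gr_rtree 2 n 0 aP).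
exists (gr 2 n 0 P); last by apply/cls_eqP/dgraph_iso_sym/JKhat2_gr.
have col (v : pV P) : (pcol v <= 1)%N by case: (good v) => -[[-> _]|[-> _]].
split => //.
- by split => // -[v|] //=; case: (good v) => -[[_ ->]|[-> _]].
- by split => // -[v|] //=; exact: leq_trans (col v) _.
- by move=> x; rewrite isroot_gr => /eqP ->.
- have c2 (x : node (gr 2 n 0 P)) : ncol x = 2%N -> x = None.
    by case: x => //= v v2; have := col v; rewrite v2.
  by move=> x y /c2 -> /c2 -> _; exact: joined_refl.
Qed.

Lemma B_circ_gr (c : nat) n o (P : ptree d L) : acyc P -> goodP P ->
  (c = 0%N /\ o = 0 \/ c = 1%N /\ Dloc None n (kids (None : option (pV P))) o) ->
  (exists t, rl t (kids (None : option (pV P)))) ->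
  B_circ s deg rl (cls (gr c n o P)).
Proof.
move=> aP good rc rt; set G := gr c n o P.
have cr := rep_cls G.
have rc' : root_cond c n o P.
  by case: rc => [[-> ->]|[-> D]]; [left; split; [left|]|right].
have [lam fT _ conf] := Lambda_gr (dgraph_iso_sym cr) aP good rc'.
split => //; last by split => //; exact: conf.
have [rf it] := (rtreeP _).1 (gr_rtree c n o aP).
exists G; last by apply/cls_eqP/dgraph_iso_sym/Kcontract_trivial.
have col (v : pV P) : (pcol v <= 1)%N by case: (good v) => -[[-> _]|[-> _]].
have c1 : (c <= 1)%N by case: rc => -[->].
split => //; last by split => // -[v|] //=.
split => // -[v|] //=; first by case: (good v) => -[[_ ->]|[-> _]].
by case: rc => -[-> //].
Qed.

Lemma B_circ_inv tau : B_circ s deg rl tau ->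
  exists c n o P, [/\ acyc P, (c <= 1)%N & tau = cls (gr c n o P)] /\
     [/\ rtree (rep tau), forall e : edge (rep tau), ecol e = 0%N
     & forall x : node (rep tau), (ncol x <= 1)%N].
Proof.
move=> [[g Fg tg] [df iK _] [fT _]]; have e0 := iso_K_trivial iK.
have /frakTP[[r [h rh]] _ _] := fT.
have [P [aP Pi _ _]] := rtree_at_gr (g := rep tau) rh e0.
have c1 (x : node (rep tau)) : (ncol x <= 1)%N.
  have gK : dgraph_iso (Kcontract g) (rep tau) by rewrite {1}tg; exact/dgraph_iso_sym/rep_cls.
  have [fN [fE [[fN' fK f'K] _ _ nn _]]] := gK.
  rewrite -[x]f'K; have [-> _ _] := nn (fN' x).
  by have [_ _ [cg _]] := Fg; apply/bigmax_leqP => y _; exact: cg.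
exists (@ncol _ _ (rep tau) r), (@ndec _ _ (rep tau) r), (@odec _ _ (rep tau) r), P; split; last by split => //; exists r, h.
split => //; by apply: etrans (esym (cls_rep tau)) _; apply/cls_eqP.
Qed.

End Locality.

(** * Gradings *)

Lemma big_option (T : Type) (idx : T) (op : Monoid.com_law idx) (I : finType)
  (P : pred (option I)) (F : option I -> T) :
  \big[op/idx]_(x | P x) F x =
  op (if P None then F None else idx) (\big[op/idx]_(y | P (Some y)) F (Some y)).
Proof.
rewrite big_mkcond (bigD1 None) //=; congr (op _ _).
rewrite (reindex_omap (@Some I) id) /=; last by case.
by rewrite [RHS]big_mkcond; apply: eq_big => // y; rewrite eqxx.
Qed.

Lemma card_sub_cond (T : finType) (A B : pred T) (C : {set {x : T | A x}}) :
  (forall y, (y \in C) = B (val y)) -> #|C| = #|[set x | A x && B x]%SET|.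
Proof.
move=> CB; rewrite -(card_imset _ val_inj); apply: eq_card => x; rewrite inE.
apply/imsetP/andP => [[y yC ->]|[Ax Bx]]; first by rewrite -CB (valP y).
by exists (Sub x Ax); rewrite ?CB.
Qed.

Section Gradings.
Variables (R : realType) (d : nat) (L : finType).
Variables (s : 'I_d -> R) (deg : L -> R).
Implicit Types g : dgraph d L.
Implicit Types P : ptree d L.
Local Notation mnorm := (mnorm s).
Local Notation onorm := (onorm s deg).

Lemma mnorm0 : mnorm 0 = 0.
Proof. by rewrite /mnorm big1 // => j _; rewrite ffunE mul0r. Qed.

Lemma mnormD a b : mnorm (a + b) = mnorm a + mnorm b.
Proof. by rewrite -big_split; apply: eq_bigr => j _; rewrite ffunE natrD mulrDl. Qed.

Lemma mnorm_sum (I : finType) (Q : pred I) (F : I -> mindex d) :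
  mnorm (\sum_(i | Q i) F i) = \sum_(i | Q i) mnorm (F i).
Proof. by apply: (big_morph mnorm mnormD mnorm0). Qed.

Lemma onorm0 : onorm 0 = 0.
Proof.
by rewrite /onorm !big1 ?addr0 // => j _; rewrite ffunE mulr0z mul0r.
Qed.

Lemma onormD a b : onorm (a + b) = onorm a + onorm b.
Proof.
rewrite /onorm /= addrACA -!big_split; congr (_ + _); apply: eq_bigr => j _ /=;
by rewrite ffunE intrD mulrDl.
Qed.

Lemma onorm_sum (I : finType) (Q : pred I) (F : I -> odeco d L) :
  onorm (\sum_(i | Q i) F i) = \sum_(i | Q i) onorm (F i).
Proof. by apply: (big_morph onorm onormD onorm0). Qed.

(** The root counts here, contrary to [bi2], because it is no longer the root
    once the tree is planted. *)
Definition zero_count g : nat :=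
  (#|[set x : node g | ncol x == 0%N]%SET| + #|[set e : edge g | ecol e == 0%N]%SET|)%N.

Section Iso.
Variables (g h : dgraph d L).
Hypothesis gh : dgraph_iso g h.

Lemma bi1_iso : bi1 h = bi1 g.
Proof.
case: gh => fN [fE [bN bE st nn ee]]; rewrite /bi1 (reindex fE) /=; last exact: onW_bij.
by apply: eq_bigr => e _; have [_ _ ->] := ee e.
Qed.

Lemma bi2_iso : bi2 h = bi2 g.
Proof.
case: gh => fN [fE [bN bE st nn ee]]; rewrite /bi2 -!sum1_card; congr (_ + _)%N.
  rewrite (reindex fN) /=; last exact: onW_bij.
  apply: eq_bigl => x; rewrite !inE (iso_isroot bN bE st).
  by have [-> _ _] := nn x.
rewrite (reindex fE) /=; last exact: onW_bij.
by apply: eq_bigl => e; rewrite !inE; have [_ -> _] := ee e.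
Qed.

Lemma zero_count_iso : zero_count h = zero_count g.
Proof.
case: gh => fN [fE [bN bE st nn ee]]; rewrite /zero_count -!sum1_card; congr (_ + _)%N.
  rewrite (reindex fN) /=; last exact: onW_bij.
  by apply: eq_bigl => x; rewrite !inE; have [-> _ _] := nn x.
rewrite (reindex fE) /=; last exact: onW_bij.
by apply: eq_bigl => e; rewrite !inE; have [_ -> _] := ee e.
Qed.

Lemma deg_plus_iso : deg_plus s deg h = deg_plus s deg g.
Proof.
case: gh => fN [fE [bN bE st nn ee]]; rewrite /deg_plus; congr (_ + _ + _).
- rewrite (reindex fE) /=; last exact: onW_bij.
  apply: eq_big => [e|e _]; first by have [_ -> _] := ee e.
  by have [-> _ ->] := ee e.
- rewrite (reindex fN) /=; last exact: onW_bij.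
  by apply: eq_bigr => e _; have [_ -> _] := nn e.
- rewrite (reindex fN) /=; last exact: onW_bij.
  apply: eq_big => [e|e _]; first by have [-> _ _] := nn e.
  by have [_ _ ->] := nn e.
Qed.
End Iso.

Lemma bideg_cls g : bideg (cls g) = (bi1 g, bi2 g).
Proof.
by rewrite /bideg (bi1_iso (dgraph_iso_sym (rep_cls g))) (bi2_iso (dgraph_iso_sym (rep_cls g))).
Qed.

Lemma deg_cls g : deg_plus s deg (rep (cls g)) = deg_plus s deg g.
Proof. exact: deg_plus_iso (dgraph_iso_sym (rep_cls g)). Qed.

Definition pbi1 P : nat := (\sum_v \sum_(j < d) pe (p := P) v j)%N.
Definition pbi2 P : nat := (#|[set v : pV P | pcol v == 0%N]%SET| + #|pV P|)%N.
Definition pdeg P : R := \sum_(v : pV P)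
  (deg (ptyp v) - mnorm (pe v) + mnorm (pn v) + (if pcol v != 2%N then onorm (po v) else 0)).

Lemma bi1_gr c n o P : bi1 (gr c n o P) = pbi1 P.
Proof. by []. Qed.

Lemma zero_count_gr c n o P : zero_count (gr c n o P) = ((c == 0%N) + pbi2 P)%N.
Proof.
rewrite /zero_count /pbi2 addnA; congr (_ + _)%N; last first.
  by rewrite -cardsT; apply: eq_card => v; rewrite !inE.
rewrite -!sum1_card big_option /= !inE; congr (_ + _)%N.
by apply: eq_bigl => v; rewrite !inE.
Qed.

Lemma bi2_gr c n o P : bi2 (gr c n o P) = pbi2 P.
Proof.
rewrite /bi2 /pbi2; congr (_ + _)%N; last first.
  by rewrite -cardsT; apply: eq_card => v; rewrite !inE.
rewrite -!sum1_card big_option /= !inE isroot_gr eqxx add0n.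
by apply: eq_bigl => v; rewrite !inE isroot_gr.
Qed.

Lemma deg_gr c n o P : deg_plus s deg (gr c n o P) =
  pdeg P + mnorm n + (if c != 2%N then onorm o else 0).
Proof.
rewrite /pdeg big_split big_split /= /deg_plus !big_option /= [\sum_(v | pcol v != 2%N) _]big_mkcond /=.
have H (e m a b q : R) : e + (m + a) + (b + q) = e + a + q + m + b by ring.
exact: H.
Qed.

Lemma pbi1_psum P Q : pbi1 (psum P Q) = (pbi1 P + pbi1 Q)%N.
Proof. by rewrite /pbi1 big_sumType. Qed.

Lemma pbi2_psum P Q : pbi2 (psum P Q) = (pbi2 P + pbi2 Q)%N.
Proof.
rewrite /pbi2 card_sum addnACA; congr (_ + _)%N.
rewrite -!sum1_card big_sumType /=; congr (_ + _)%N; apply: eq_bigl => v; by rewrite !inE.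
Qed.

Lemma pdeg_psum P Q : pdeg (psum P Q) = pdeg P + pdeg Q.
Proof. by rewrite /pdeg big_sumType. Qed.

Lemma pbi1_plantP t k c n o P : pbi1 (plantP t k c n o P) = (\sum_(j < d) k j + pbi1 P)%N.
Proof. by rewrite /pbi1 big_option. Qed.

Lemma pbi2_plantP t k c n o P : pbi2 (plantP t k c n o P) = ((c == 0%N) + pbi2 P).+1.
Proof.
rewrite /pbi2 card_option addnS addnA; congr (_ + _).+1.
rewrite -!sum1_card big_option /= !inE; congr (_ + _)%N.
by apply: eq_bigl => v; rewrite !inE.
Qed.

Lemma pdeg_plantP t k c n o P : pdeg (plantP t k c n o P) =
  deg t - mnorm k + (mnorm n + (if c != 2%N then onorm o else 0) + pdeg P).
Proof. by rewrite /pdeg big_option /= !addrA. Qed.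

Lemma hatJ_grades t k g : rtree g -> (forall e : edge g, ecol e = 0%N) ->
  bideg (hatJ t k (cls g)) = (\sum_(j < d) k j + bi1 g, (zero_count g).+1)%N /\
  deg_plus s deg (rep (hatJ t k (cls g))) = deg t - mnorm k + deg_plus s deg g.
Proof.
move=> [r [h rh]] e0; have [P [aP Pi _ _]] := rtree_at_gr rh e0.
rewrite (proj2 (cls_eqP _ _) Pi) hatJ_gr bideg_cls deg_cls bi1_gr bi2_gr deg_gr.
rewrite pbi1_plantP pbi2_plantP pdeg_plantP /= mnorm0.
rewrite -(bi1_iso Pi) -(zero_count_iso Pi) -(deg_plus_iso Pi) zero_count_gr deg_gr bi1_gr; split => //.
ring.
Qed.

Lemma join_roots_isroot g (x : node (join_roots g)) : isroot x = (x == None).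
Proof.
apply/isrootP/eqP => [|-> e].
  case: x => // -[x' nx] H; case/forallPn: (nx) => e; rewrite negbK => /eqP ex.
  exfalso; apply: (H e).
  by rewrite -[LHS]/(insub (@tgt _ _ g e)) ex insubT.
rewrite -[LHS]/(insub (@tgt _ _ g e)); case: insubP => // /negP[].
by apply/forallPn; exists e; rewrite negbK.
Qed.

Lemma bi2_join_roots g : (bi2 (join_roots g) <= zero_count g)%N.
Proof.
rewrite /bi2 /zero_count leq_add2r -sum1_card big_option /= !inE join_roots_isroot eqxx add0n.
pose C := [set y : {x : node g | ~~ isroot x} | ncol (val y) == 0%N]%SET.
rewrite (eq_bigl (mem C)); last by move=> y; rewrite !inE join_roots_isroot.
rewrite sum1_card (@card_sub_cond _ _ (fun x => ncol x == 0%N)); last first.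
  by move=> y; rewrite inE.
by apply/subset_leq_card/fintype.subsetP => x; rewrite !inE => /andP[].
Qed.

Lemma deg_join_roots g : (exists x : node g, isroot x) ->
  (forall x : node g, isroot x -> ncol x = 2%N) ->
  deg_plus s deg (join_roots g) = deg_plus s deg g.
Proof.
move=> [x0 r0] r2; rewrite /deg_plus; congr (_ + _ + _).
  rewrite big_option /= mnorm_sum [RHS](bigID (@isroot _ _ g)) /=; congr (_ + _).
  by rewrite -(big_sub (fun x : node g => ~~ isroot x) (fun x => mnorm (ndec x))).
have m2 : \max_(z : node g | isroot z) ncol z = 2%N.
  by apply: (@bigmax_cst _ _ _ _ x0) => //; [exact: r2|move=> x /r2 ->].
rewrite big_option /= m2 eqxx add0r.
rewrite -(big_sub_cond (fun x : node g => ~~ isroot x) (fun x => ncol x != 2%N)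
   (fun x => onorm (odec x))).
apply: eq_bigl => x; case: (boolP (isroot x)) => [/r2 ->|nr]; first by rewrite andbF.
by rewrite unfold_in nr.
Qed.

Section PhiGrades.
Variable (h : dgraph d L).
Hypothesis e0 : forall e : edge h, ecol e = 0%N.
Let G := Phat (Phi h 2) 2.
Let N := [set x : node h | ~~ mono 2 x]%SET.

Let inE2 (e : edge h) : e \in sE (induced N).
Proof.
have n2 : (ecol e == 2%N) = false by rewrite e0.
rewrite !inE; apply/andP; split; apply/negP => /andP[_ /forallP/(_ e)];
rewrite n2 implybF => /negP; apply; first exact: joined_refl.
by rewrite joinedC; apply: joined_edge; rewrite inE.
Qed.

Let mono_col (x : node h) : mono 2 x -> ncol x = 2%N.
Proof.
by case/andP => /forallP/(_ x) + _; rewrite joined_refl => /eqP.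
Qed.

Lemma bi1_Phi : bi1 G = bi1 h.
Proof.
rewrite /bi1 big_sumType /= [X in (_ + X)%N]big1 ?addn0; last by case.
rewrite -(big_sub (sE (induced N)) (fun e => \sum_(j < d) edec e j)%N).
by apply: eq_bigl => e; rewrite inE2.
Qed.

Lemma zero_count_Phi : (zero_count G <= zero_count h)%N.
Proof.
rewrite /zero_count -(sum1_card (mem [set x : node G | _]%SET)).
rewrite -(sum1_card (mem [set x : edge G | _]%SET)) !big_sumType /=; apply: leq_add.
  rewrite [X in (_ + X)%N]big1 ?addn0; last by case; rewrite inE.
  pose C := [set y : {x : node h | x \in N} | ncol (val y) == 0%N]%SET.
  rewrite (eq_bigl (mem C)); last by move=> y; rewrite !inE.
  rewrite sum1_card (@card_sub_cond _ _ (fun x => ncol x == 0%N)); last first.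
    by move=> y; rewrite inE.
  by apply/subset_leq_card/fintype.subsetP => x; rewrite !inE => /andP[].
rewrite [X in (_ + X)%N]big1 ?addn0; last by case.
pose C := [set y : {x : edge h | x \in sE (induced N)} | ecol (val y) == 0%N]%SET.
rewrite (eq_bigl (mem C)); last by move=> y; rewrite !inE.
rewrite sum1_card (@card_sub_cond _ _ (fun x => ecol x == 0%N)); last first.
  by move=> y; rewrite inE.
by apply/subset_leq_card/fintype.subsetP => x; rewrite !inE => /andP[].
Qed.

Lemma deg_Phi : deg_plus s deg G = deg_plus s deg h.
Proof.
rewrite /deg_plus !big_sumType /=; congr (_ + _ + _).
- rewrite [X in _ + X]big_pred0 ?addr0; last by case.
  rewrite -(big_sub_cond (sE (induced N)) (fun e => ecol e != 2%N)
    (fun e => deg (typ e) - mnorm (edec e))).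
  by apply: eq_bigl => e; rewrite inE2.
- rewrite (big_pred1 tt) /= ?mnorm_sum => [|[]//].
  rewrite [RHS](bigID (mem N)) /=; congr (_ + _).
    by rewrite -(big_sub (fun x => x \in N) (fun x => mnorm (ndec x))).
  by apply: eq_bigl => x; rewrite inE negbK.
- rewrite [X in _ + X]big_pred0 ?addr0; last by case.
  transitivity (\sum_(x : {x | x \in N} | ncol (val x) != 2%N) onorm (odec (val x))).
    by apply: eq_bigr => x /negbTE; rewrite /= => ->.
  rewrite -(big_sub_cond (fun x => x \in N) (fun x => ncol x != 2%N)
    (fun x => onorm (odec x))).
  apply: eq_bigl => x; rewrite unfold_in inE; case m: (mono 2 x) => //=.
  by rewrite mono_col.
Qed.

Lemma root_Phi : (forall x : node h, isroot x -> ncol x = 2%N) ->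
  (exists x : node G, isroot x) /\ (forall x : node G, isroot x -> ncol x = 2%N).
Proof.
move=> r2; split; first by exists (inr tt); apply/isrootP; case=> [|[]].
case=> [[x xN]|[]] //= /isrootP rx; apply: r2; apply/isrootP => e ex.
apply: (rx (inl (Sub e (inE2 e)))); congr inl; exact: val_inj.
Qed.
End PhiGrades.

Section ContractGrades.
Variable (h : dgraph d L).
Let K := Kcontract h.

Lemma sum_blocks (T : Type) (idx : T) (op : Monoid.com_law idx) (F : node h -> T) :
  \big[op/idx]_(C : node K) \big[op/idx]_(x in val C) F x = \big[op/idx]_x F x.
Proof.
rewrite (partition_big (@to_block _ _ h) predT) //=.
apply: eq_bigr => C _; apply: eq_bigl => x.
have /imsetP[y _ Cy] := valP C; apply/idP/eqP => [xC|<-]; last first.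
  by rewrite /= inE; exact: joined_refl.
by apply: val_inj; rewrite /= Cy; apply/esym/block_joined; move: xC; rewrite Cy inE.
Qed.

Lemma bi1_K : bi1 K = (\sum_(e : edge h | ecol e == 0%N) \sum_(j < d) edec e j)%N.
Proof.
by rewrite (big_sub (fun e : edge h => ecol e == 0%N) (fun e => \sum_(j < d) edec e j)%N).
Qed.

Lemma zero_count_K : (zero_count K <= zero_count h)%N.
Proof.
rewrite /zero_count; apply: leq_add.
  pose pk (C : {set node h}) : option (node h) := [pick y in C].
  have pkP (C : node K) : exists2 y, pk (val C) = Some y & y \in val C.
    rewrite /pk; case: pickP => [y yC|/= no]; first by exists y.
    have /imsetP[y _ Cy] := valP C; have := no y.
    by rewrite Cy inE joined_refl.
  have pk_inj : injective (fun C : node K => pk (val C)).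
    move=> C C'; have [y -> yC] := pkP C; have [y' -> yC'] := pkP C' => -[yy].
    have /imsetP[z _ Cz] := valP C; have /imsetP[z' _ Cz'] := valP C'.
    apply: val_inj; rewrite /= Cz Cz'; move: yC yC'; rewrite Cz Cz' !inE -yy.
    by move=> /block_joined -> /block_joined ->.
  have Si : injective (@Some (node h)) by move=> ? ? [].
  rewrite -(card_imset _ pk_inj) -(card_imset _ Si).
  apply/subset_leq_card/fintype.subsetP => x /imsetP[C + ->].
  have [y -> yC] := pkP C; rewrite inE => /eqP c0; apply: imset_f.
  rewrite inE -leqn0 -c0; exact: leq_bigmax_cond.
rewrite (@card_sub_cond _ _ (fun x => ecol x == 0%N)); last first.
  by move=> y; rewrite inE.
by apply/subset_leq_card/fintype.subsetP => x; rewrite !inE => /andP[].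
Qed.

Hypothesis h1 : forall e : edge h, ecol e != 0%N ->
  [/\ ecol e = 2%N, ncol (src e) = 2%N & ncol (tgt e) = 2%N].

Let col_block x : \max_(y in block x) ncol y = ncol (x : node h).
Proof. by apply: block_colour => e /h1[-> -> ->]. Qed.

Lemma deg_K : deg_plus s deg K = deg_plus s deg h.
Proof.
rewrite /deg_plus; congr (_ + _ + _).
- transitivity (\sum_(e : {e : edge h | ecol e == 0%N}) (deg (typ (val e)) - mnorm (edec (val e)))).
    by apply: eq_bigl => e; rewrite /= (eqP (valP e)).
  rewrite -(big_sub (fun e : edge h => ecol e == 0%N) (fun e => deg (typ e) - mnorm (edec e))).
  apply: eq_bigl => e; rewrite unfold_in; case: (boolP (ecol e == 0%N)) => [/eqP -> //|].
  by case/h1 => ->.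
- rewrite -[RHS]sum_blocks; apply: eq_bigr => C _; exact: mnorm_sum.
- rewrite [RHS]big_mkcond -[RHS]sum_blocks [LHS]big_mkcond; apply: eq_bigr => C _.
  have /imsetP[y _ Cy] := valP C.
  have colC x : x \in val C -> ncol x = \max_(y in val C) ncol y.
    by rewrite Cy col_block inE => /block_joined xy; rewrite -col_block -xy col_block.
  rewrite -[ncol C]/(\max_(y in val C) ncol y).
  case: ifP => c2; last by rewrite big1 // => x /colC ->; rewrite c2.
  rewrite onormD [X in _ + onorm X]big_pred0 ?onorm0 ?addr0 ?onorm_sum => [|e].
    by apply: eq_bigr => x /colC ->; rewrite c2.
  apply/negbTE/negP => /andP[/h1[_ s2 _] /colC]; rewrite s2 => c2'.
  by rewrite -c2' in c2.
Qed.

Lemma root_K : (forall x : node h, ncol x <> 2%N -> exists2 e, tgt e = x & ecol e = 0%N) ->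
  forall x : node K, isroot x -> ncol x = 2%N.
Proof.
move=> h3 C /isrootP rC; have /imsetP[y _ Cy] := valP C.
rewrite -[ncol C]/(\max_(y in val C) ncol y) Cy col_block.
apply: contrapT => /h3[e ey /eqP e0]; apply: (rC (Sub e e0)).
by apply: val_inj; rewrite /= Cy ey.
Qed.

End ContractGrades.

(** Nodes and edges disappear in the contraction only inside of colour 2, where
    they contribute to none of the gradings, except for the decoration [ndec],
    which is summed. *)
Lemma JKhat2_grades (h : dgraph d L) :
  (forall e : edge h, ecol e != 0%N ->
     [/\ ecol e = 2%N, ncol (src e) = 2%N & ncol (tgt e) = 2%N]) ->
  (forall x : node h, ncol x <> 2%N -> exists2 e, tgt e = x & ecol e = 0%N) ->
  [/\ bi1 (JKhat2 h) = (\sum_(e : edge h | ecol e == 0%N) \sum_(j < d) edec e j)%N,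
      (bi2 (JKhat2 h) <= zero_count h)%N & deg_plus s deg (JKhat2 h) = deg_plus s deg h].
Proof.
move=> h1 h3; have eK (e : edge (Kcontract h)) : ecol e = 0%N by exact/eqP/(valP e).
have [ex r2] := root_Phi eK (root_K h1 h3).
split.
- by rewrite -bi1_K -(bi1_Phi eK).
- exact: leq_trans (bi2_join_roots _) (leq_trans (zero_count_Phi _) (zero_count_K _)).
- by rewrite deg_join_roots // deg_Phi // deg_K.
Qed.

End Gradings.

(** * Support of the coproduct *)

Section Coproduct.
Variables (R : realType) (d : nat) (L : finType).
Variables (s : 'I_d -> R) (deg : L -> R).
Local Notation mnorm := (mnorm s).
Local Notation onorm := (onorm s deg).

Definition eps1 (g : dgraph d L) (eps : {ffun edge g -> mindex d}) : nat :=
  (\sum_(e : edge g) \sum_(j < d) eps e j)%N.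

Section Cut.
Variable g : dgraph d L.
Hypothesis gt : rtree g.
Hypothesis e0 : forall e : edge g, ecol e = 0%N.
Hypothesis c1 : forall x : node g, (ncol x <= 1)%N.
Variables (A : subforest g).
Variables (eps : {ffun edge g -> mindex d}) (nA : {ffun node g -> mindex d}).
Hypothesis fA : frakA2 A.
Hypothesis cs : cut_supp A eps nA.

Lemma frakA2_tree : sub_tree A.
Proof.
have [_ [jo ro] _] := fA; have [r [h rh]] := gt.
have /rtreeP[_ [_ jg]] := gt.
split; first by exists r; apply: ro; rewrite (rtree_isroot _ rh).
by move=> x y xA yA; apply: jo.
Qed.

Lemma cut_left_rtree : rtree (cut_left A eps nA).
Proof.
have /rtreeP[rf _] := gt; have hh := forest_depth rf; have [inj _] := rf.
have [r [rA rr ro]] := subtree_root rf frakA2_tree.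
exists (Sub r rA), (fun x => depth (val x)); split.
- by move=> x y [] /inj xy; apply: val_inj.
- by move=> e [] er; apply: rr er; exact: valP e.
- move=> x xr; have [|e eA ex] := ro (val x) (valP x).
    by move=> er; apply: xr; apply: val_inj.
  by exists (Sub e eA); apply: val_inj.
- by move=> e; apply: hh.
Qed.

Lemma cut_left_e0 (e : edge (cut_left A eps nA)) : ecol e = 0%N.
Proof. exact: e0. Qed.

Lemma eps_out e : e \in sE A -> eps e = 0.
Proof. by move=> eA; have [_ _] := cs; apply; rewrite eA. Qed.

Lemma col_right (x : node g) : @ncol _ _ (cut_right A eps nA) x = 2%N <-> x \in sN A.
Proof.
rewrite /=; case: ifP => // xA; split=> // c2.
by have := c1 x; rewrite c2.
Qed.

Lemma nonroot_right (x : node g) : x \notin sN A -> exists2 e, tgt e = x & e \notin sE A.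
Proof.
move=> xA; have [_ [_ ro] _] := fA; have [r [h [inj hr ho _]]] := gt.
have [|e ex] := ho x.
  move=> xr; move/negP: xA; apply; apply: ro; rewrite xr.
  by apply/isrootP => e; exact: hr.
by exists e => //; apply: contra xA; rewrite -ex; exact: sub_tgt.
Qed.

Lemma ecol_right (e : edge g) : (@ecol _ _ (cut_right A eps nA) e == 0%N) = (e \notin sE A).
Proof. by rewrite /=; case: ifP => // _; rewrite e0. Qed.

Lemma right_grades :
  [/\ bi1 (JKhat2 (cut_right A eps nA)) =
        (\sum_(e : edge g | e \notin sE A) \sum_(j < d) cut_e A eps e j)%N,
      (bi2 (JKhat2 (cut_right A eps nA)) <= zero_count (cut_right A eps nA))%N
    & deg_plus s deg (JKhat2 (cut_right A eps nA)) = deg_plus s deg (cut_right A eps nA)].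
Proof.
have [||h1 h2 h3] := @JKhat2_grades R d L s deg (cut_right A eps nA).
- move=> e; rewrite ecol_right negbK => eA; split; last 2 first.
  + by apply/col_right; exact: sub_src.
  + by apply/col_right; exact: sub_tgt.
  by rewrite /= eA.
- move=> x /col_right/negP/nonroot_right[e ex eA]; exists e => //.
  by apply/eqP; rewrite ecol_right.
split => //; rewrite h1; apply: eq_bigl => e; exact: ecol_right.
Qed.

(** Every edge goes to one side of the cut, and [eps] adds to the decorations on
    the right. *)
Lemma cut_bi1 : (bi1 (cut_left A eps nA) + bi1 (JKhat2 (cut_right A eps nA)) =
  bi1 g + eps1 eps)%N.
Proof.
have [-> _ _] := right_grades; rewrite /bi1 /eps1.
rewrite -(@big_sub _ _ addn _ (mem (sE A)) (fun e => \sum_(j < d) edec e j)%N).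
rewrite -[RHS]big_split /= [RHS](bigID (mem (sE A))) /=.
congr (_ + _)%N; apply: eq_bigr => e eA.
  by rewrite [X in (_ + X)%N]big1 ?addn0 // => j _; rewrite eps_out // ffunE.
rewrite -big_split; apply: eq_bigr => j _.
by rewrite /cut_e (negbTE eA) ffunE.
Qed.

Lemma cut_zero_count : (zero_count (cut_left A eps nA) + bi2 (JKhat2 (cut_right A eps nA)) <= zero_count g)%N.
Proof.
have [_ h _] := right_grades; apply: leq_trans (leq_add (leqnn _) h) _.
rewrite /zero_count addnACA.
have -> : #|[set x : node (cut_left A eps nA) | ncol x == 0]%SET| =
   #|[set x | (x \in sN A) && (@ncol _ _ g x == 0%N)]%SET|.
  by apply: card_sub_cond => y; rewrite inE.
have -> : #|[set e : edge (cut_left A eps nA) | ecol e == 0]%SET| =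
   #|[set x | (x \in sE A) && (@ecol _ _ g x == 0%N)]%SET|.
  by apply: card_sub_cond => y; rewrite inE.
apply: leq_add.
  rewrite -[X in (_ <= X)%N](cardsID (sN A)); apply: leq_add.
    by apply/subset_leq_card/fintype.subsetP => x; rewrite !inE => /andP[-> ->].
  apply/subset_leq_card/fintype.subsetP => x; rewrite !inE /=.
  by case: ifP.
rewrite -[X in (_ <= X)%N](cardsID (sE A)); apply: leq_add.
  by apply/subset_leq_card/fintype.subsetP => x; rewrite !inE => /andP[-> ->].
apply/subset_leq_card/fintype.subsetP => x; rewrite !inE /=.
by case: ifP.
Qed.

Lemma mnorm_cut x : mnorm (cut_n nA x) = mnorm (ndec x) - mnorm (nA x).
Proof.
apply/eqP; rewrite eq_sym subr_eq -mnormD; apply/eqP; congr (mnorm _).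
apply/ffunP => j; rewrite !ffunE; have [le _ _] := cs.
by apply/esym; exact: subnK (le x j).
Qed.

(** The cut transfers [nA] from right to left; what [eps] takes from the degree
    of the edges on the right reappears in the nodes on the left. *)
Lemma cut_deg : deg_plus s deg (cut_left A eps nA) +
  deg_plus s deg (JKhat2 (cut_right A eps nA)) = deg_plus s deg g.
Proof.
have [_ _ ->] := right_grades.
have c2 (x : node g) : ncol x != 2%N by apply: contraTneq (c1 x) => ->.
have e2 (e : edge g) : ecol e != 2%N by rewrite e0.
have dl : deg_plus s deg (cut_left A eps nA) =
    \sum_(e in sE A) (deg (typ e) - mnorm (edec e)) +
    (\sum_(x in sN A) mnorm (nA x) +
       \sum_(x in sN A) \sum_(e : edge g | src e == x) mnorm (eps e)) +
    \sum_(x in sN A) onorm (odec x).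
  rewrite /deg_plus; congr (_ + _ + _).
  - rewrite [RHS]big_sub; apply: eq_bigl => e; exact: e2.
  - rewrite -big_split [RHS]big_sub; apply: eq_bigr => x _.
    by rewrite /= mnormD mnorm_sum.
  - rewrite [RHS]big_sub; apply: eq_bigl => x; exact: c2.
have dr : deg_plus s deg (cut_right A eps nA) =
    (\sum_(e : edge g | e \notin sE A) (deg (typ e) - mnorm (edec e)) -
     \sum_(e : edge g | e \notin sE A) mnorm (eps e)) +
    (\sum_(x : node g) mnorm (ndec x) - \sum_(x : node g) mnorm (nA x)) + \sum_(x : node g | x \notin sN A) onorm (odec x).
  rewrite /deg_plus; congr (_ + _ + _).
  - rewrite -sumrB; apply: eq_big => [e|e].
      by rewrite /=; case: ifP => // _; rewrite e2.
    rewrite /=; case: ifP => // eA _; rewrite /cut_e eA mnormD opprD addrA //.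
  - by rewrite -sumrB; apply: eq_bigr => x _; rewrite -mnorm_cut.
  - apply: eq_big => [x|x] /=; first by case: ifP => // _; rewrite c2.
    case: ifP => // xA _; congr (onorm _); rewrite /cut_o.
    have [_ nA0 eps0] := cs; rewrite nA0 ?xA // mvec0 add0r big1 ?addr0 // => e /eqP ex.
    rewrite eps0 ?ex ?xA ?andbF // ifF ?mvec0 ?subr0 //.
    by apply: contraFF xA => eA; rewrite -ex; exact: sub_src.
have dg : deg_plus s deg g = \sum_(e : edge g) (deg (typ e) - mnorm (edec e)) +
    \sum_(x : node g) mnorm (ndec x) + \sum_(x : node g) onorm (odec x).
  rewrite /deg_plus; congr (_ + _ + _).
    by rewrite big_mkcond; apply: eq_bigr => e _; rewrite e2.
  by rewrite big_mkcond; apply: eq_bigr => x _; rewrite c2.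
have se : \sum_(x in sN A) \sum_(e : edge g | src e == x) mnorm (eps e) =
     \sum_(e : edge g | e \notin sE A) mnorm (eps e).
  rewrite (exchange_big_dep predT) //= (bigID (mem (sE A))) /= big1 ?add0r; last first.
    by move=> e eA; rewrite big1 // => x _; rewrite eps_out // mnorm0.
  apply: eq_bigr => e eA; case: (boolP (src e \in sN A)) => sA.
    rewrite (big_pred1 (src e)) // => x; rewrite /= eq_sym.
    by case: eqP => [->|]; rewrite ?andbF ?andbT.
  have [_ _ eps0] := cs; rewrite eps0 ?mnorm0 ?big1 //.
  by rewrite eA (negbTE sA).
have sn : \sum_(x in sN A) mnorm (nA x) = \sum_(x : node g) mnorm (nA x).
  rewrite [RHS](bigID (mem (sN A))) /= [X in _ + X]big1 ?addr0 // => x xA.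
  by have [_ nA0 _] := cs; rewrite nA0 ?mnorm0.
rewrite dl dr dg [in RHS](bigID (mem (sE A))) /=.
rewrite [\sum_(x : node g) onorm (odec x)](bigID (mem (sN A))) /=.
rewrite se sn.
have H (a b q w x y z : R) : a + (b + q) + w + (x - q + (y - b) + z) = a + x + y + (w + z).
  by ring.
exact: H.
Qed.

End Cut.

Variables (rl : rule d L).

(** All that the recursion uses of the coproduct.  The decorations [k] and [k']
    are independent because the recursion plants the left factor with a shifted
    decoration. *)
Lemma Delta2_support tau t k p : B_circ s deg rl tau -> Delta2 R (rep tau) p != 0 ->
  exists (A : subforest (rep tau)) (eps : {ffun edge (rep tau) -> mindex d})
    (nA : {ffun node (rep tau) -> mindex d}),
  [/\ cut_supp A eps nA,
      p = (cls (cut_left A eps nA), cls (JKhat2 (cut_right A eps nA)))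
   & [/\ (forall k', bi1 (rep (hatJ t k' p.1)) + bi1 (rep p.2) =
          bi1 (rep (hatJ t k' tau)) + eps1 eps)%N,
      (forall k', bi2 (rep (hatJ t k' p.1)) + bi2 (rep p.2) <= bi2 (rep (hatJ t k tau)))%N,
      (forall k', bi1 (rep (hatJ t k' tau)) =
          \sum_(j < d) k' j + bi1 (rep (hatJ t 0%R tau)))%N,
      (forall k', deg_plus s deg (rep (hatJ t k' p.1)) + deg_plus s deg (rep p.2) =
        deg_plus s deg (rep (hatJ t k tau)) + mnorm k - mnorm k')
    & exists c n o P, acyc P /\ p.1 = cls (gr c n o P)]].
Proof.
move=> /B_circ_inv[c [n [o [P [[aP c1 tg] [rt e0 cl]]]]]] Dp.
have [[[A eps] nA] /= [fA cs p1 p2]] : exists z : subforest (rep tau) * {ffun edge (rep tau) -> mindex d}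
      * {ffun node (rep tau) -> mindex d}, [/\ frakA2 z.1.1, cut_supp z.1.1 z.1.2 z.2,
             cls (Kcontract (cut_left z.1.1 z.1.2 z.2)) = p.1
           & cls (JKhat2 (cut_right z.1.1 z.1.2 z.2)) = p.2].
  apply: contrapT => /forallNP no; case/eqP: Dp; apply: fsbig1 => z zP.
  by case: (no z).
have lt := cut_left_rtree rt eps nA fA.
have le0 := cut_left_e0 e0.
have Kl : cls (cut_left A eps nA) = p.1.
  by rewrite -p1; apply/cls_eqP/dgraph_iso_sym/Kcontract_trivial.
exists A, eps, nA; split; [exact: cs|by rewrite Kl p2; case: (p)|].
have gl k' := hatJ_grades s deg t k' lt (le0 _ _ _).
have gt' k' := hatJ_grades s deg t k' rt e0.
rewrite cls_rep in gt'; rewrite Kl in gl.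
have gl1 k' := congr1 fst (proj1 (gl k')); have gl2 k' := congr1 snd (proj1 (gl k')).
have gt1 k' := congr1 fst (proj1 (gt' k')); have gt2 k' := congr1 snd (proj1 (gt' k')).
rewrite /= in gl1 gl2 gt1 gt2.
have [b21 b22] : bi1 (rep p.2) = bi1 (JKhat2 (cut_right A eps nA)) /\
    bi2 (rep p.2) = bi2 (JKhat2 (cut_right A eps nA)).
  have := bideg_cls (JKhat2 (cut_right A eps nA)); rewrite p2.
  by case.
split.
- move=> k'; rewrite gl1 gt1 b21 -!addnA; congr (_ + _)%N; exact: cut_bi1.
- by move=> k'; rewrite gl2 gt2 b22 addSn ltnS; exact: cut_zero_count.
- by move=> k'; rewrite !gt1 [X in (_ + (X + _))%N]big1 // => j _; rewrite ffunE.
- move=> k'; have [_ ->] := gl k'; have [_ ->] := gt' k.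
  rewrite -p2 deg_cls -(cut_deg rt e0 cl fA cs); ring.
- have [r [h rh]] := lt; have [Q [aQ Qi _ _]] := rtree_at_gr rh (le0 _ _ _).
  exists (ncol r), (ndec r), (odec r), Q; split => //.
  by rewrite -Kl; apply/cls_eqP.
Qed.

Lemma finite_ffun (T : finType) (N : nat) :
  finite_set [set f : {ffun T -> nat} | forall x, (f x <= N)%N].
Proof.
pose F (f : {ffun T -> 'I_N.+1}) : {ffun T -> nat} := [ffun x => f x : nat].
apply: (sub_finite_set (B := F @` setT)).
  move=> f fN; exists [ffun x => inord (f x)] => //; apply/ffunP => x.
  by rewrite !ffunE inordK // ltnS.
exact: finite_image finite_finset.
Qed.

Lemma finite_ffun2 (T : finType) (N : nat) :
  finite_set [set f : {ffun T -> mindex d} | forall x j, (f x j <= N)%N].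
Proof.
pose F (f : {ffun T -> {ffun 'I_d -> 'I_N.+1}}) : {ffun T -> mindex d} :=
  [ffun x => [ffun j => f x j : nat]].
apply: (sub_finite_set (B := F @` setT)).
  move=> f fN; exists [ffun x => [ffun j => inord (f x j)]] => //.
  by apply/ffunP => x; apply/ffunP => j; rewrite !ffunE inordK // ltnS.
exact: finite_image finite_finset.
Qed.

(** The first component of the bidegree bounds [eps], and [nA] is bounded by the
    decoration that it is taken from. *)
Lemma Delta2_finite tau N t : B_circ s deg rl tau ->
  finite_set [set p | Delta2 R (rep tau) p != 0 /\
    ((bideg (hatJ t 0%R p.1)).1 + (bideg p.2).1 <= N)%N].
Proof.
move=> Bt; set g := rep tau.
pose M := (\sum_(x : node g) \sum_(j < d) ndec x j)%N.
pose F (z : subforest g * {ffun edge g -> mindex d} * {ffun node g -> mindex d}) :=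
  (cls (cut_left z.1.1 z.1.2 z.2), cls (JKhat2 (cut_right z.1.1 z.1.2 z.2))).
pose S1 : set (subforest g) := setT.
pose S2 := [set f : {ffun edge g -> mindex d} | forall x j, (f x j <= N)%N].
pose S3 := [set f : {ffun node g -> mindex d} | forall x j, (f x j <= M)%N].
have fS1 : finite_set S1.
  apply: (sub_finite_set (B := insubd (induced finset.set0 : subforest g) @` setT)).
    by move=> A _; exists (val A) => //; rewrite valKd.
  exact: finite_image finite_finset.
have fF : finite_set (F @` (S1 `*` S2 `*` S3)).
  apply: finite_image; apply: finite_setX; last exact: finite_ffun2.
  by apply: finite_setX => //; exact: finite_ffun2.
have le1 (T : finType) (f : {ffun T -> mindex d}) x j :
    (f x j <= \sum_x \sum_(j < d) f x j)%N.
  by rewrite (bigD1 x) //= (bigD1 j) //= -addnA leq_addr.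
apply: sub_finite_set fF => p [Dp pN].
have [A [eps [nA [cs pF [h1 _ _ _ _]]]]] := Delta2_support t 0 Bt Dp.
exists (A, eps, nA) => //; split; first split => //.
  move=> x j; apply: leq_trans (le1 _ _ _ _) _; apply: leq_trans pN.
  by rewrite h1 leq_addl.
move=> x j; have [le _ _] := cs; apply: leq_trans (le x j) _.
by rewrite /M (bigD1 x) //= (bigD1 j) //= -addnA leq_addr.
Qed.

End Coproduct.

(** * The monoid of classes of trees *)

Section ClassMonoid.
Variables (R : realType) (d : nat) (L : finType).
Variables (s : 'I_d -> R) (deg : L -> R) (rl : rule d L).
Local Notation ptree := (ptree d L).
Local Notation iclass := (iclass d L).
Local Notation Bp := (B_plus s deg rl).
Local Notation Bo := (B_circ s deg rl).
Local Notation dg c := (deg_plus s deg (rep c)).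

(** The tree product is well behaved on all of these classes, and not only on
    [B_plus]; the planted left factors of the coproduct are among them. *)
Definition rooted2 (c : iclass) : Prop := exists n P, c = cls (gr 2 n 0 P).

Lemma B_plus_rooted2 c : Bp c -> rooted2 c.
Proof. by move=> /B_plusP[n [P [_ _ ->]]]; exists n, P. Qed.

Lemma B_plus_one : Bp (one2 d L).
Proof.
apply/B_plusP; exists 0, (pempty d L); split; last exact: one2_gr; last by case.
by exists (fun=> 0%N); case.
Qed.

Lemma B_plus_Xmon (k : mindex d) : Bp (Xmon L k).
Proof.
apply/B_plusP; exists k, (pempty d L); split; last exact: Xmon_gr; last by case.
by exists (fun=> 0%N); case.
Qed.

Lemma B_plus_tprod a b : Bp a -> Bp b -> Bp (tprod a b).
Proof.
move=> /B_plusP[n [P [aP gP ->]]] /B_plusP[m [Q [aQ gQ ->]]].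
rewrite tprod_gr; apply/B_plusP; exists (n + m), (psum P Q); split => //.
  exact: acyc_psum.
exact/goodP_psum.
Qed.

Lemma tprodC a b : rooted2 a -> rooted2 b -> tprod a b = tprod b a.
Proof.
move=> [n [P ->]] [m [Q ->]]; rewrite !tprod_gr addrC; apply/cls_eqP/gr_iso.
exact: psumC.
Qed.

Lemma tprodA a b c : rooted2 a -> rooted2 b -> rooted2 c ->
  tprod a (tprod b c) = tprod (tprod a b) c.
Proof.
move=> [n [P ->]] [m [Q ->]] [k [S ->]]; rewrite !tprod_gr addrA.
by apply/cls_eqP/gr_iso/piso_sym/psumA.
Qed.

Lemma tprod1 a : rooted2 a -> tprod (one2 d L) a = a.
Proof.
move=> [n [P ->]]; rewrite one2_gr tprod_gr add0r; apply/cls_eqP/gr_iso.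
exact: psum0.
Qed.

Lemma rooted2_tprod a b : rooted2 a -> rooted2 b -> rooted2 (tprod a b).
Proof.
by move=> [n [P ->]] [m [Q ->]]; rewrite tprod_gr; exists (n + m), (psum P Q).
Qed.

Lemma bideg_tprod a b : rooted2 a -> rooted2 b ->
  bideg (tprod a b) = ((bideg a).1 + (bideg b).1, (bideg a).2 + (bideg b).2)%N.
Proof.
move=> [n [P ->]] [m [Q ->]].
by rewrite tprod_gr !bideg_cls !bi1_gr !bi2_gr pbi1_psum pbi2_psum.
Qed.

Lemma deg_tprod a b : rooted2 a -> rooted2 b -> dg (tprod a b) = dg a + dg b.
Proof.
move=> [n [P ->]] [m [Q ->]].
by rewrite tprod_gr !deg_cls !deg_gr pdeg_psum mnormD /= !addr0 addrACA.
Qed.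

Lemma pbi1_empty : pbi1 (pempty d L) = 0%N.
Proof. by rewrite /pbi1 big1 // => -[]. Qed.

Lemma pbi2_empty : pbi2 (pempty d L) = 0%N.
Proof.
by rewrite /pbi2 card_void addn0; apply: eq_card0; case.
Qed.

Lemma pdeg_empty : pdeg s deg (pempty d L) = 0.
Proof. by rewrite /pdeg big1 // => -[]. Qed.

Lemma Xmon_grades (k : mindex d) : bideg (Xmon L k) = (0, 0)%N /\ dg (Xmon L k) = mnorm s k.
Proof.
rewrite Xmon_gr bideg_cls deg_cls bi1_gr bi2_gr deg_gr pbi1_empty pbi2_empty pdeg_empty.
by rewrite /= addr0 add0r.
Qed.

Lemma one_grades : bideg (one2 d L) = (0, 0)%N /\ dg (one2 d L) = 0.
Proof.
have <- : Xmon L (0 : mindex d) = one2 d L by rewrite Xmon_gr one2_gr.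
by have [-> ->] := Xmon_grades 0; rewrite mnorm0.
Qed.

Lemma Xmon0 : Xmon L (0 : mindex d) = one2 d L.
Proof. by rewrite Xmon_gr one2_gr. Qed.

Lemma XmonD (k l : mindex d) : tprod (Xmon L k) (Xmon L l) = Xmon L (k + l).
Proof. by rewrite !Xmon_gr tprod_gr; apply/cls_eqP/gr_iso/psum0. Qed.

Lemma rooted2_hatJ t k c n o (P : ptree) : rooted2 (hatJ t k (cls (gr c n o P))).
Proof. by rewrite hatJ_gr; exists 0, (plantP t k c n o P). Qed.

Lemma rooted2_Xmon (k : mindex d) : rooted2 (Xmon L k).
Proof. by rewrite Xmon_gr; exists k, (pempty d L). Qed.

Lemma factor_root n (P : ptree) (v : pV P) : acyc P -> goodP s deg rl P -> par v = None ->
  let tau := cls (gr (pcol v) (pn v) (po v) (branchP v)) in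
  [/\ Bo tau, Bp (hatJ (ptyp v) (pe v) tau), Bp (cls (gr 2 n 0 (restP v)))
    & cls (gr 2 n 0 P) = tprod (hatJ (ptyp v) (pe v) tau) (cls (gr 2 n 0 (restP v)))].
Proof.
move=> aP gP v0 tau; have Pi := branch_split v0.
have [gb gr'] := (goodP_psum _ _ _ _ _).1 (goodP_iso (piso_sym Pi) gP).
have [gbr [rc rt]] := (goodP_plantP _ _ _ _ _ _ _ _ _).1 gb.
have ab : acyc (branchP v) by exact: acyc_restr.
split.
- apply: B_circ_gr => //; last by exists (ptyp v).
  by case: rc => -[-> D]; [left|right; split => //; exact: Dloc_None D].
- rewrite hatJ_gr; apply/B_plusP.
  exists 0, (plantP (ptyp v) (pe v) (pcol v) (pn v) (po v) (branchP v)).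
  by split => //; exact: acyc_plantP.
- by apply/B_plusP; exists n, (restP v); split => //; exact: acyc_restr.
- rewrite hatJ_gr tprod_gr add0r; apply/cls_eqP/gr_iso; exact: Pi.
Qed.

Lemma acyc_root (P : ptree) (v : pV P) : acyc P -> exists w : pV P, par w = None.
Proof.
case=> h hP; suff H m : forall v, (h v < m)%N -> exists w : pV P, par w = None.
  exact: (H (h v).+1).
elim: m => // m IH {}v hv; case pv: (par v) => [u|]; last by exists v.
by apply: (IH u); exact: leq_trans (hP _ _ pv) hv.
Qed.

Lemma B_plus_ind (Q : iclass -> Prop) :
  Q (one2 d L) ->
  (forall i c, Bp c -> Q c -> Q (tprod (Xmon L (munit i)) c)) ->
  (forall t k tau c, Bo tau -> Bp (hatJ t k tau) -> Bp c -> Q c ->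
     Q (tprod (hatJ t k tau) c)) ->
  forall c, Bp c -> Q c.
Proof.
move=> Q1 QX QJ c /B_plusP[n [P [aP gP ->]]].
suff H m : forall (n : mindex d) (P : ptree), acyc P -> goodP s deg rl P -> (\sum_j n j + #|pV P| < m)%N ->
    Q (cls (gr 2 n 0 P)) by exact: (H (\sum_j n j + #|pV P|).+1).
elim: m => // m IH {c aP gP}n {}P aP gP; rewrite ltnS => le.
case: (pickP (fun i => n i != 0%N)) => [i ni|n0].
  pose n' : mindex d := [ffun j => (n j - (j == i))%N].
  have nn' : n = munit i + n'.
    apply/ffunP => j; rewrite !ffunE -[RHS]/((j == i) + (n j - (j == i)))%N.
    by case: eqP => [->|_]; [rewrite subnKC // lt0n|rewrite subn0].
  have -> : cls (gr 2 n 0 P) = tprod (Xmon L (munit i)) (cls (gr 2 n' 0 P)).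
    rewrite Xmon_gr tprod_gr -nn'; apply/cls_eqP/gr_iso/piso_sym; exact: psum0.
  apply: QX; first by apply/B_plusP; exists n', P.
  have sn : (\sum_j n j = 1 + \sum_j n' j)%N.
    transitivity (\sum_j ((j == i) + n' j))%N.
      by apply: eq_bigr => j _; rewrite {1}nn' ffunE [munit i j]ffunE.
    rewrite big_split /=; congr (_ + _)%N; rewrite (bigD1 i) //= eqxx big1 //.
    by move=> j /negbTE ->.
  by apply: IH => //; apply: leq_trans le; rewrite sn -addnA add1n.
have {n0} -> : n = 0.
  by apply/ffunP => j; rewrite ffunE; apply/eqP/negPn/negP; rewrite n0.
case: (pickP (fun v : pV P => par v == None)) => [v /eqP v0|no].
  have [Bt BJ Br ->] := factor_root 0 aP gP v0.
  apply: QJ => //; apply: IH; first exact: acyc_restr.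
    have [_ gr'] := (goodP_psum _ _ _ _ _).1 (goodP_iso (piso_sym (branch_split v0)) gP).
    exact: gr'.
  apply: leq_trans le; rewrite [X in (X + _)%N]big1 ?add0n; last by move=> j _; rewrite ffunE.
  apply: leq_trans (leq_addl _ _).
  have -> : #|pV (restP v)| = #|ndesc v| by rewrite /restP /= card_sig.
  rewrite -(cardC (ndesc v)) -addn1 leq_add2l; apply/card_gt0P; exists v.
  by rewrite !inE /ndesc negbK; exact: desc_refl.
have V0 (v : pV P) : False.
  by have [w /eqP] := acyc_root v aP; rewrite no.
suff -> : cls (gr 2 0 0 P) = one2 d L by [].
rewrite one2_gr; apply/cls_eqP/gr_iso.
exists (fun v => match V0 v with end); split; last 2 first.
- by move=> v; case: (V0 v).
- by move=> v; case: (V0 v).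
by apply: inj_surj_bij => [v|[]]; case: (V0 v).
Qed.

(** A factor of a class is given by a set of branches and by a part of the
    root decoration, so that a class has finitely many factors. *)
Lemma finite_factors c :
  finite_set [set a | rooted2 a /\ exists2 b, rooted2 b & tprod a b = c].
Proof.
have [[n [P ->]]|no] := pselect (rooted2 c); last first.
  rewrite (_ : [set _ | _] = set0) //; apply/seteqP; split => // a [ra [b rb abc]].
  by case: no; rewrite -abc; exact: rooted2_tprod.
pose N := (\sum_j n j)%N.
pose F (z : {ffun 'I_d -> nat} * {set pV P}) : iclass :=
  cls (gr 2 z.1 0 (@restr d L P (mem z.2))).
apply: (sub_finite_set (B := F @` ([set f : {ffun 'I_d -> nat} | forall x, (f x <= N)%N]
    `*` setT))); last first.
  by apply: finite_image; apply: finite_setX; [exact: finite_ffun|exact: finite_finset].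
move=> a [[na [Q ->]] [b [nb [S ->]]]].
rewrite tprod_gr => /cls_eqP/gr_iso_inv[_ nn _ [f [bf fp fd]]].
exists (na, [set f (inl v) | v : pV Q]%SET).
  split => // j /=; apply: (@leq_trans (n j)).
    by rewrite -nn ffunE leq_addr.
  by rewrite /N (bigD1 j) //= leq_addr.
apply/cls_eqP/gr_iso/piso_sym => /=.
have inj := bij_inj bf.
apply: piso_trans (piso_sym (@restr_true d L Q predT (fun=> isT))) _.
apply: (restr_emb (f := fun v => f (inl v))) => //.
- by move=> u v /inj [].
- by move=> v _; rewrite fp /=; case: (par v).
- by move=> v; apply/idP; apply: imset_f.
- by move=> w /imsetP[v _ ->]; exists v.
Qed.

Section Branches.
Variables (T : Type) (idx : T) (op : Monoid.com_law idx).
Variable phi : L -> mindex d -> iclass -> T.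

(** A branch enters through its class and the label of its edge only, which
    makes the product invariant under isomorphism and multiplicative. *)
Definition brprod (P : ptree) : T :=
  \big[op/idx]_(v : pV P | par v == None)
     phi (ptyp v) (pe v) (cls (gr (pcol v) (pn v) (po v) (branchP v))).

Lemma brprod_iso P Q : piso P Q -> brprod Q = brprod P.
Proof.
case=> f [bf fp fd]; rewrite /brprod (reindex f) /=; last exact: onW_bij.
apply: eq_big => v; first by rewrite fp; case: (par v).
move=> _; have [-> -> -> -> ->] := fd v; congr (phi _ _ _).
by apply/cls_eqP/gr_iso/piso_sym; exact: branch_iso.
Qed.

Lemma brprod_psum P Q : brprod (psum P Q) = op (brprod P) (brprod Q).
Proof.
rewrite /brprod big_sumType /=; congr (op _ _); apply: eq_big => v.
- by case: (par v).
- move=> _; congr (phi _ _ _); apply/cls_eqP/gr_iso/piso_sym; exact: branch_psuml.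
- by case: (par v).
- move=> _; congr (phi _ _ _); apply/cls_eqP/gr_iso/piso_sym; exact: branch_psumr.
Qed.

Lemma brprod_empty : brprod (pempty d L) = idx.
Proof. by rewrite /brprod big1 // => -[]. Qed.

Lemma brprod_plantP t k c n o P : acyc P ->
  brprod (plantP t k c n o P) = phi t k (cls (gr c n o P)).
Proof.
move=> aP; rewrite /brprod big_option /= [X in op _ X]big_pred0 ?Monoid.mulm1 //.
congr (phi _ _ _); apply/cls_eqP/gr_iso/piso_sym; exact: branch_plantP.
Qed.
End Branches.

Definition root_data (c : iclass) : mindex d * ptree :=
  match pselect (exists z : mindex d * ptree, c = cls (gr 2 z.1 0 z.2)) with
  | left H => projT1 (cid H)
  | right _ => (0, pempty d L)
  end.

Lemma root_dataP n P : (root_data (cls (gr 2 n 0 P))).1 = n /\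
  piso (root_data (cls (gr 2 n 0 P))).2 P.
Proof.
rewrite /root_data; case: pselect => [H|[]]; last by exists (n, P).
by case: cid => -[m Q] /= /cls_eqP/gr_iso_inv[_ -> _ ?]; split => //; exact: piso_sym.
Qed.

End ClassMonoid.

(** * The algebra of formal series *)

Lemma fsum_seq (R : realType) (I : choiceType) (A : set I) (F : I -> R) (r : seq I) :
  uniq r -> (forall i, A i -> F i != 0 -> i \in r) ->
  \sum_(i \in A) F i = \sum_(i <- r | i \in A) F i.
Proof.
move=> ur Ar; rewrite (fsbigE [seq i <- r | i \in A]) ?filter_uniq //.
- by rewrite big_filter_cond; apply: eq_bigl => i; rewrite andbb.
- by move=> i /=; rewrite mem_filter => /andP[/set_mem].
move=> i Ai; rewrite mem_filter mem_set //=; apply: contraNeq => Fi; exact: Ar.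
Qed.

Section SeriesAlgebra.
Variables (R : realType) (d : nat) (L : finType).
Variables (s : 'I_d -> R) (deg : L -> R) (rl : rule d L).
Local Notation iclass := (iclass d L).
Local Notation Bp := (B_plus s deg rl).
Local Notation rooted2 := (@rooted2 d L).
Local Notation That := (That s deg rl).
Implicit Types f g h : iclass -> R.

Definition supp2 f : Prop := forall c, f c != 0 -> rooted2 c.

Definition divs (c : iclass) : seq iclass := fset_set [set a | rooted2 a /\
  exists2 b, rooted2 b & tprod a b = c].

Lemma divsP c a : a \in divs c <-> rooted2 a /\ exists2 b, rooted2 b & tprod a b = c.
Proof. 
by rewrite /divs in_fset_set; [split; [move=> /set_mem|move=> ?; apply/mem_set]|exact: finite_factors].
Qed.

Lemma divs_uniq c : uniq (divs c). Proof. exact: fset_uniq. Qed.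

Lemma divs_mul a b : rooted2 a -> rooted2 b ->
  a \in divs (tprod a b) /\ b \in divs (tprod a b).
Proof.
move=> ra rb; split; apply/divsP; split => //; first by exists b.
by exists a => //; rewrite tprodC.
Qed.

Lemma divs_trans a b c : a \in divs b -> b \in divs c -> a \in divs c.
Proof.
move=> /divsP[ra [x rx <-]] /divsP[rb [y ry <-]]; apply/divsP; split => //.
exists (tprod x y); first exact: rooted2_tprod.
exact: tprodA.
Qed.

Lemma fmul_supp f h c : fmul f h c != 0 ->
  exists a b, [/\ f a != 0, h b != 0 & tprod a b = c].
Proof.
rewrite /fmul => H.
have [[a b] /= ab] := @fsbigN1 _ _ _ unit _ _ (fun _ p => f p.1 * h p.2) tt H.
by rewrite mulf_eq0 negb_or => /andP[fa hb]; exists a, b.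
Qed.

Lemma fmul_seq (U V : seq iclass) f h c : uniq U -> uniq V ->
  (forall a b, f a != 0 -> h b != 0 -> tprod a b = c -> a \in U /\ b \in V) ->
  fmul f h c = \sum_(a <- U) \sum_(b <- V) (tprod a b == c)%:R * (f a * h b).
Proof.
move=> uU uV UV; rewrite /fmul (fsum_seq (r := [seq (a, b) | a <- U, b <- V])).
- rewrite big_mkcond big_allpairs; apply: eq_bigr => a _; apply: eq_bigr => b _ /=.
  case: eqP => [ab|nab]; first by rewrite mul1r ifT //; apply/mem_set.
  by rewrite mul0r ifF //; apply/negbTE/negP => /set_mem.
- by apply: allpairs_uniq => // -[a b] [a' b'] _ _ [-> ->].
- move=> [a b] /= ab; rewrite mulf_eq0 negb_or => /andP[fa hb].
  by have [aU bV] := UV _ _ fa hb ab; apply/allpairsP; exists (a, b).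
Qed.

Lemma fmulE (D : seq iclass) f h c : uniq D -> supp2 f -> supp2 h ->
  (forall a, a \in divs c -> a \in D) ->
  fmul f h c = \sum_(a <- D) \sum_(b <- D) (tprod a b == c)%:R * (f a * h b).
Proof.
move=> uD sf sh cD; apply: fmul_seq => // a b /sf ra /sh rb ab.
by have [Da Db] := divs_mul ra rb; rewrite ab in Da Db; split; exact: cD.
Qed.

Lemma fmulC f h : supp2 f -> supp2 h -> fmul f h = fmul h f.
Proof.
move=> sf sh; apply/funext => c.
rewrite !(@fmulE (divs c)) ?divs_uniq // exchange_big /=; apply: eq_bigr => a _.
apply: eq_bigr => b _; rewrite [f b * _]mulrC.
case: (eqVneq (f b) 0) => [->|/sf rb]; first by rewrite !mulr0.
case: (eqVneq (h a) 0) => [->|/sh ra]; first by rewrite !(mul0r, mulr0).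
by rewrite tprodC.
Qed.

Lemma supp2_fmul f h : supp2 f -> supp2 h -> supp2 (fmul f h).
Proof. by move=> sf sh c /fmul_supp[a [b [/sf ? /sh ? <-]]]; exact: rooted2_tprod. Qed.

(** All the sums run over the finitely many divisors of [c], a set that contains
    the divisors of its elements. *)
Lemma fmulA f g h : supp2 f -> supp2 g -> supp2 h ->
  fmul f (fmul g h) = fmul (fmul f g) h.
Proof.
move=> sf sg sh; apply/funext => c; set D := divs c.
have uD := divs_uniq c.
have dD x : x \in D -> forall a, a \in divs x -> a \in D.
  by move=> xD a ax; exact: divs_trans ax xD.
have sgh := supp2_fmul sg sh; have sfg := supp2_fmul sf sg.
have del (x : iclass) (F : iclass -> R) : (x \notin D -> F x = 0) ->
    \sum_(y <- D) (x == y)%:R * F y = F x.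
  move=> xD; case: (boolP (x \in D)) => [xI|/[dup] /xD -> xI].
    rewrite (bigD1_seq x) //= eqxx mul1r big1 ?addr0 // => y /negbTE.
    by rewrite eq_sym => ->; rewrite mul0r.
  rewrite big_seq big1 // => y yD; case: eqP => [xy|]; last by rewrite mul0r.
  by rewrite xy yD in xI.
rewrite (fmulE uD sf sgh) // (fmulE uD sfg sh) //.
transitivity (\sum_(a <- D) \sum_(b <- D) \sum_(e <- D)
   (tprod a (tprod b e) == c)%:R * (f a * g b * h e)).
  apply: eq_bigr => a _.
  transitivity (\sum_(y <- D) \sum_(b <- D) \sum_(e <- D)
      (tprod b e == y)%:R * ((tprod a y == c)%:R * (f a * g b * h e))).
    rewrite [LHS]big_seq [RHS]big_seq; apply: eq_bigr => y yD.
    rewrite (fmulE uD sg sh (dD y yD)) !mulr_sumr; apply: eq_bigr => b _.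
    rewrite !mulr_sumr; apply: eq_bigr => e _; ring.
  rewrite exchange_big; apply: eq_bigr => b _; rewrite exchange_big; apply: eq_bigr => e _.
  apply: (del (tprod b e) (fun y => (tprod a y == c)%:R * (f a * g b * h e))) => nD.
  case: (eqVneq (f a) 0) => [->|/sf ra]; first by rewrite !mul0r mulr0.
  case: (eqVneq (g b) 0) => [->|/sg rb]; first by rewrite !(mul0r, mulr0).
  case: (eqVneq (h e) 0) => [->|/sh re]; first by rewrite !(mul0r, mulr0).
  case: eqP => [abc|]; last by rewrite mul0r.
  by case/negP: nD; rewrite /D -abc; apply: (divs_mul ra (rooted2_tprod rb re)).2.
apply/esym.
transitivity (\sum_(y <- D) \sum_(e <- D) \sum_(a <- D) \sum_(b <- D)
      (tprod a b == y)%:R * ((tprod y e == c)%:R * (f a * g b * h e))).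
  rewrite [LHS]big_seq [RHS]big_seq; apply: eq_bigr => y yD; apply: eq_bigr => e _.
  rewrite (fmulE uD sf sg (dD y yD)) mulr_suml mulr_sumr; apply: eq_bigr => a _.
  rewrite mulr_suml mulr_sumr; apply: eq_bigr => b _; ring.
rewrite exchange_big /=.
transitivity (\sum_(e <- D) \sum_(a <- D) \sum_(b <- D)
   (tprod a (tprod b e) == c)%:R * (f a * g b * h e)).
  apply: eq_bigr => e _; rewrite exchange_big; apply: eq_bigr => a _.
  rewrite exchange_big; apply: eq_bigr => b _.
  rewrite (del (tprod a b) (fun y => (tprod y e == c)%:R * (f a * g b * h e))) => [|nD].
    case: (eqVneq (f a) 0) => [->|/sf ra]; first by rewrite !(mul0r, mulr0).
    case: (eqVneq (g b) 0) => [->|/sg rb]; first by rewrite !(mul0r, mulr0).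
    case: (eqVneq (h e) 0) => [->|/sh re]; first by rewrite !(mul0r, mulr0).
    by rewrite tprodA.
  case: (eqVneq (f a) 0) => [->|/sf ra]; first by rewrite !mul0r mulr0.
  case: (eqVneq (g b) 0) => [->|/sg rb]; first by rewrite !(mul0r, mulr0).
  case: (eqVneq (h e) 0) => [->|/sh re]; first by rewrite !(mul0r, mulr0).
  case: eqP => [abc|]; last by rewrite mul0r.
  by case/negP: nD; rewrite /D -abc; apply: (divs_mul (rooted2_tprod ra rb) re).1.
rewrite exchange_big; apply: eq_bigr => a _; rewrite exchange_big //.
Qed.

Lemma fmul_ind f a c : rooted2 a -> supp2 f ->
  fmul (ind R a) f c = \sum_(b <- divs c) (tprod a b == c)%:R * f b.
Proof.
move=> ra sf; have sa : supp2 (ind R a).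
  by move=> b; rewrite /ind; case: (eqVneq b a) => [-> //|_]; rewrite eqxx.
rewrite (fmulE (divs_uniq c) sa sf) // exchange_big; apply: eq_bigr => b _ /=.
case: (boolP (a \in divs c)) => aD.
  rewrite (bigD1_seq a) ?divs_uniq //= /ind eqxx mul1r big1 ?addr0 // => x /negbTE ->.
  by rewrite mul0r mulr0.
rewrite big_seq big1 => [|x xD].
  case: (eqVneq (f b) 0) => [->|/sf rb]; first by rewrite mulr0.
  case: eqP => [abc|]; last by rewrite mul0r.
  by case/negP: aD; rewrite -abc; apply: (divs_mul ra rb).1.
have /negbTE xa : x != a by apply: contraNneq aD => <-.
by rewrite /ind xa mul0r mulr0.
Qed.

Lemma ind_supp2 a : rooted2 a -> supp2 (ind R a).
Proof. by move=> ra b; rewrite /ind; case: (eqVneq b a) => [-> //|_]; rewrite eqxx. Qed.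

Lemma fmul_ind2 a b : rooted2 a -> rooted2 b ->
  fmul (ind R a) (ind R b) = ind R (tprod a b).
Proof.
move=> ra rb; apply/funext => c; rewrite fmul_ind //; last exact: ind_supp2.
rewrite /ind; case: (boolP (b \in divs c)) => bD.
  rewrite (bigD1_seq b) ?divs_uniq //= eqxx mulr1 big1 ?addr0 1?eq_sym // => x /negbTE ->.
  by rewrite mulr0.
rewrite big_seq big1 => [|x xD]; last first.
  have /negbTE -> : x != b by apply: contraNneq bD => <-.
  by rewrite mulr0.
case: eqP => // cab; case/negP: bD; rewrite cab; apply: (divs_mul ra rb).2.
Qed.

Lemma fmul_one f : supp2 f -> fmul (ind R (one2 d L)) f = f.
Proof.
have r1 : rooted2 (one2 d L) by rewrite one2_gr; exists 0, (pempty d L).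
move=> sf; apply/funext => c; rewrite fmul_ind //.
case: (eqVneq (f c) 0) => [c0|/[dup] cn0 /sf rc].
  rewrite c0 big1 // => b _; case: (eqVneq (f b) 0) => [->|/sf rb]; first by rewrite mulr0.
  by rewrite tprod1 //; case: eqP => [->|]; rewrite ?c0 ?mulr0 ?mul0r.
have cD : c \in divs c by apply/divsP; split => //; exists (one2 d L); rewrite // tprodC // tprod1.
rewrite (bigD1_seq c) ?divs_uniq //= tprod1 // eqxx mul1r big1 ?addr0 // => b bc.
case: (eqVneq (f b) 0) => [->|/sf rb]; first by rewrite mulr0.
by rewrite tprod1 // (negbTE bc) mul0r.
Qed.

Lemma fmulZl k f h : supp2 f -> supp2 h ->
  fmul (fun c => k * f c) h = (fun c => k * fmul f h c).
Proof.
move=> sf sh; apply/funext => c.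
have skf : supp2 (fun c => k * f c).
  by move=> a; case: (eqVneq (f a) 0) => [->|/sf //]; rewrite mulr0 eqxx.
rewrite /= !(@fmulE (divs c)) ?divs_uniq // mulr_sumr; apply: eq_bigr => a _ /=.
by rewrite mulr_sumr; apply: eq_bigr => b _ /=; ring.
Qed.

(** The second component of the bidegree being bounded on the support, bounding
    the first one leaves finitely many bidegrees. *)
Lemma is_seriesP (S : set iclass) f : is_series S f <->
  [/\ forall c, f c != 0 -> S c,
      forall N, finite_set [set c | f c != 0 /\ ((bideg c).1 <= N)%N]
    & exists k, forall c, f c != 0 -> ((bideg c).2 <= k)%N].
Proof.
split=> -[f1 f2 [k f3]]; split => //; try by exists k.
  move=> N; apply: (sub_finite_set (B := \bigcup_(n in [set n : nat * nat |
      (n.1 <= N)%N /\ (n.2 <= k)%N]) [set c | f c != 0 /\ bideg c = n])).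
    by move=> c [fc cN]; exists (bideg c) => //; split => //; exact: f3.
  apply: bigcup_finite => [|n _]; last exact: f2.
  apply: (sub_finite_set (B := [set` iota 0 N.+1] `*` [set` iota 0 k.+1])).
    move=> [a b] [aN bk]; split; [change (is_true (a \in iota 0 N.+1))|
      change (is_true (b \in iota 0 k.+1))]; by rewrite mem_iota.
  by apply: finite_setX; exact: finite_seq.
move=> n; apply: sub_finite_set (f2 n.1) => c [fc <-]; by split.
Qed.

Lemma B_plus_supp2 f : is_series Bp f -> supp2 f.
Proof. by case=> f1 _ _ c /f1; exact: B_plus_rooted2. Qed.

Lemma is_series_fmul f h : is_series Bp f -> is_series Bp h -> is_series Bp (fmul f h).
Proof.
move=> /is_seriesP[f1 f2 [k f3]] /is_seriesP[h1 h2 [l h3]].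
have mulS c : fmul f h c != 0 -> exists a b, [/\ f a != 0, h b != 0, tprod a b = c
    & bideg c = ((bideg a).1 + (bideg b).1, (bideg a).2 + (bideg b).2)%N].
  move=> /fmul_supp[a [b [fa hb <-]]]; exists a, b; split => //.
  by apply: (bideg_tprod (B_plus_rooted2 (f1 _ fa)) (B_plus_rooted2 (h1 _ hb))).
apply/is_seriesP; split.
- by move=> c /mulS[a [b [/f1 Ba /h1 Bb <- _]]]; exact: B_plus_tprod.
- move=> N; apply: (sub_finite_set (B := (fun p => tprod p.1 p.2) @`
    ([set c | f c != 0 /\ ((bideg c).1 <= N)%N] `*`
     [set c | h c != 0 /\ ((bideg c).1 <= N)%N]))).
    move=> c [/mulS[a [b [fa hb abc bc]]]]; rewrite bc /= => le.
    exists (a, b) => //=; split; split => //=; apply: leq_trans le.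
      exact: leq_addr.
    exact: leq_addl.
  by apply: finite_image; exact: finite_setX.
- exists (k + l)%N => c /mulS[a [b [fa hb abc ->]]] /=.
  by rewrite leq_add // ?f3 ?h3.
Qed.

Lemma That_series (v : That) : is_series Bp (fval v).
Proof. by have /asboolP := valP v. Qed.

Lemma That_supp2 (v : That) : supp2 (fval v).
Proof. exact/B_plus_supp2/That_series. Qed.

Lemma fval_to_That f : is_series Bp f -> fval (to_That s deg rl f) = f.
Proof. by move=> sf; rewrite /fval /to_That insubdK //; apply/asboolP. Qed.

Lemma fval_inj (u v : That) : fval u = fval v -> u = v.
Proof. exact: val_inj. Qed.

Lemma fval_mul (u v : That) : fval (mulT u v) = fmul (fval u) (fval v).
Proof. by rewrite fval_to_That //; apply: is_series_fmul; exact: That_series. Qed.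

Lemma is_series_ind c : Bp c -> is_series Bp (ind R c).
Proof.
move=> Bc; have ic x : ind R c x != 0 -> x = c.
  by rewrite /ind; case: (eqVneq x c) => [-> //|_]; rewrite eqxx.
split=> [x /ic -> //|n|].
  by apply: (sub_finite_set (B := [set c])) => // x [/ic ->].
by exists (bideg c).2 => x /ic ->.
Qed.

Lemma fval_basis c : Bp c -> fval (basis s deg rl c) = ind R c.
Proof. by move=> Bc; rewrite fval_to_That //; exact: is_series_ind. Qed.

Lemma basis_out c : ~ Bp c -> basis s deg rl c = 0.
Proof.
move=> nB; rewrite /basis /to_That /insubd insubN //; apply/negP => /asboolP[f1 _ _].
by apply: nB; apply: f1; rewrite /ind eqxx oner_eq0.
Qed.

Lemma basis_mul a b : Bp a -> Bp b ->
  mulT (basis s deg rl a) (basis s deg rl b) = basis s deg rl (tprod a b).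
Proof.
move=> Ba Bb; apply: fval_inj; rewrite fval_mul !fval_basis //; last exact: B_plus_tprod.
exact: fmul_ind2 (B_plus_rooted2 Ba) (B_plus_rooted2 Bb).
Qed.

Lemma mulTA : associative (@mulT R d L s deg rl).
Proof.
move=> u v w; apply: fval_inj; rewrite !fval_mul.
by apply: fmulA; exact: That_supp2.
Qed.

Lemma mulTC : commutative (@mulT R d L s deg rl).
Proof.
move=> u v; apply: fval_inj; rewrite !fval_mul.
by apply: fmulC; exact: That_supp2.
Qed.

Lemma mul1T : left_id (oneT s deg rl) (@mulT R d L s deg rl).
Proof.
move=> u; apply: fval_inj; rewrite fval_mul fval_basis; last exact: B_plus_one.
by apply: fmul_one; exact: That_supp2.
Qed.

HB.instance Definition _ := Monoid.isComLaw.Build That (oneT s deg rl)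
  (@mulT R d L s deg rl) mulTA mulTC mul1T.

Lemma fvalD (u v : That) c : fval (u + v) c = fval u c + fval v c.
Proof. by []. Qed.

Lemma fvalZ (k : R) (u : That) c : fval (k *: u) c = k * fval u c.
Proof. by []. Qed.

Lemma mulTZl (k : R) (u v : That) : mulT (k *: u) v = k *: mulT u v.
Proof.
apply: fval_inj; rewrite fval_mul; apply/funext => c; rewrite fvalZ !fval_mul.
have -> : fval (k *: u) = (fun c => k * fval u c) by apply/funext.
by rewrite fmulZl //; exact: That_supp2.
Qed.

End SeriesAlgebra.

(** * The recursion *)

Section Recursion.
Variables (R : realType) (d : nat) (L : finType).
Variables (s : 'I_d -> R) (deg : L -> R) (rl : rule d L).
Hypothesis hs : forall j, 1 <= s j.
Local Notation iclass := (iclass d L).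
Local Notation mindex := (mindex d).
Local Notation Bp := (B_plus s deg rl).
Local Notation Bo := (B_circ s deg rl).
Local Notation That := (@That R d L s deg rl).
Local Notation basis := (basis s deg rl).
Local Notation dg c := (deg_plus s deg (rep c)).
Implicit Types al be : iclass -> That.

(** [MJA], for a map that is known through its values on the basis. *)
Definition MJ al (t : L) (k : mindex) (tau : iclass) : iclass -> R := fun c =>
  \sum_(p \in [set: iclass * iclass])
    Delta2 R (rep tau) p * fmul (ind R (hatJ t k p.1)) (fval (al p.2)) c.

Definition antip_rhs al (t : L) (k : mindex) (tau : iclass) : iclass -> R := fun c =>
  - \sum_(l \in [set: mindex]) fmul (negXpow R l) (Pplus s deg rl (MJ al t (k + l) tau)) c.

(** The invariant of the recursion.  The bounds on the bidegree make all the
    sums finite; the two statements on the degree imply that an element of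
    nonpositive degree, other than the unit, has image zero. *)
Definition good_image (c : iclass) (f : iclass -> R) : Prop := forall x, f x != 0 ->
  [/\ ((bideg c).1 <= (bideg x).1)%N, ((bideg x).2 <= (bideg c).2)%N,
      dg x = dg c & c <> one2 d L -> 0 < dg x].

Definition good_map al : Prop := forall c, good_image c (fval (al c)).

Lemma mnorm_ge0 (l : mindex) : 0 <= mnorm s l.
Proof. by apply: sumr_ge0 => j _; rewrite mulr_ge0 // (le_trans ler01). Qed.

Lemma antip_rhs_supp al t k tau x : antip_rhs al t k tau x != 0 -> exists l p b,
  [/\ Delta2 R (rep tau) p != 0, fval (al p.2) b != 0,
      x = tprod (Xmon L l) (tprod (hatJ t (k + l) p.1) b),
      Bp (tprod (hatJ t (k + l) p.1) b) & 0 < dg (tprod (hatJ t (k + l) p.1) b)].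
Proof.
rewrite /antip_rhs oppr_eq0 => H.
have [l _ ] := @fsbigN1 _ _ _ unit _ _
  (fun _ l => fmul (negXpow R l) (Pplus s deg rl (MJ al t (k + l) tau)) x) tt H.
move=> /fmul_supp[x1 [c [nx1]]]; rewrite /Pplus.
case: asboolP => [[Bc dc]|_]; last by rewrite eqxx.
move=> H1 xc; have [p _] := @fsbigN1 _ _ _ unit _ _
  (fun _ p => Delta2 R (rep tau) p * fmul (ind R (hatJ t (k + l) p.1)) (fval (al p.2)) c) tt H1.
rewrite mulf_eq0 negb_or => /andP[Dp /fmul_supp[y [b [iy ab yb]]]].
have iE (u v : iclass) : ind R u v != 0 -> v = u.
  by rewrite /ind; case: (eqVneq v u) => [-> //|_]; rewrite eqxx.
have ye := iE _ _ iy.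
have x1e : x1 = Xmon L l.
  by apply: iE; move: nx1; rewrite /negXpow mulf_eq0 negb_or => /andP[].
exists l, p, b; split => //; rewrite -?ye ?yb //.
by rewrite -x1e.
Qed.

Section OneStep.
Variables (al : iclass -> That) (t : L) (k : mindex) (tau : iclass).
Hypothesis al_good : good_map al.
Hypothesis Bt : Bo tau.

Lemma antip_rhs_grades x l p b : Delta2 R (rep tau) p != 0 -> fval (al p.2) b != 0 ->
  x = tprod (Xmon L l) (tprod (hatJ t (k + l) p.1) b) ->
  [/\ rooted2 (hatJ t (k + l) p.1), rooted2 b,
      ((bideg (hatJ t k tau)).1 + \sum_(j < d) l j <= (bideg x).1)%N,
      ((bideg x).2 <= (bideg (hatJ t k tau)).2)%N
    & dg x = dg (hatJ t k tau) /\ dg x = mnorm s l + dg (tprod (hatJ t (k + l) p.1) b)]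
  /\ ((bideg (hatJ t 0%R p.1)).1 + (bideg p.2).1 <= (bideg x).1)%N
  /\ ((bideg b).1 <= (bideg x).1)%N.
Proof.
move=> Dp ab ->.
have [A [eps [nA [_ _ [h1 h2 h3 h4 [c [n [o [P [aP pP]]]]]]]]]] := Delta2_support t k Bt Dp.
have [g1 g2 g3 _] := al_good ab.
have rJ : rooted2 (hatJ t (k + l) p.1) by rewrite pP; exact: rooted2_hatJ.
have rb : rooted2 b by have [f1 _ _] := That_series (al p.2); exact: B_plus_rooted2 (f1 _ ab).
have rJb := rooted2_tprod rJ rb; have rX := rooted2_Xmon L l.
have [bX dX] := Xmon_grades s deg l.
have skl : (\sum_(j < d) (k + l)%R j = \sum_(j < d) k j + \sum_(j < d) l j)%N.
  by rewrite -big_split; apply: eq_bigr => j _; rewrite ffunE.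
have E1 := h1 (k + l); have E0 := h1 0; have F1 := h3 (k + l); have F0 := h3 k.
rewrite skl in F1.
rewrite (bideg_tprod rX rJb) (bideg_tprod rJ rb) bX /= in g1 g2 *.
have E2 := h2 (k + l).
split; [split => //|split]; try by rewrite /= in E1 E0 F1 F0 g1 g2 E2 *; lia.
have E4 := h4 (k + l).
rewrite (deg_tprod s deg rX rJb) (deg_tprod s deg rJ rb) dX g3; split => //.
by move: E4; rewrite mnormD => E4; lra.
Qed.

Lemma antip_rhs_Bp x : antip_rhs al t k tau x != 0 -> Bp x.
Proof. by move=> /antip_rhs_supp[l [p [b [_ _ -> Bc _]]]]; apply: B_plus_tprod => //; exact: B_plus_Xmon. Qed.

Lemma antip_rhs_good x : antip_rhs al t k tau x != 0 ->
  [/\ ((bideg (hatJ t k tau)).1 <= (bideg x).1)%N,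
      ((bideg x).2 <= (bideg (hatJ t k tau)).2)%N,
      dg x = dg (hatJ t k tau) & 0 < dg x].
Proof.
move=> /antip_rhs_supp[l [p [b [Dp ab xE Bc dc]]]].
have [[_ _ n1 n2 [dx dx']] _] := antip_rhs_grades Dp ab xE; split => //.
  exact: leq_trans (leq_addr _ _) n1.
by rewrite dx' ltr_wpDl // mnorm_ge0.
Qed.

(** Both [eps] and the exponent [l] of the monomial raise the first component of
    the bidegree, so that finitely many of them contribute below a bound. *)
Lemma antip_rhs_series : is_series Bp (antip_rhs al t k tau).
Proof.
apply/is_seriesP; split; first exact: antip_rhs_Bp; last first.
  by exists (bideg (hatJ t k tau)).2 => x /antip_rhs_good[].
move=> N.
pose S1 := [set l : mindex | forall j, (l j <= N)%N].
pose S2 := [set p | Delta2 R (rep tau) p != 0 /\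
    ((bideg (hatJ t 0%R p.1)).1 + (bideg p.2).1 <= N)%N].
pose S3 (p : iclass * iclass) := [set b | fval (al p.2) b != 0 /\ ((bideg b).1 <= N)%N].
pose S23 := \bigcup_(p in S2) ([set p] `*` S3 p).
pose F (z : mindex * ((iclass * iclass) * iclass)) :=
  tprod (Xmon L z.1) (tprod (hatJ t (k + z.1) z.2.1.1) z.2.2).
apply: (sub_finite_set (B := F @` (S1 `*` S23))).
  move=> x [/antip_rhs_supp[l [p [b [Dp ab xE Bc dc]]]] xN].
  have [[_ _ n1 n2 _] [n3 n4]] := antip_rhs_grades Dp ab xE.
  exists (l, (p, b)) => //; split => /=.
    move=> j; apply: leq_trans xN; apply: leq_trans n1; apply: leq_trans (leq_addl _ _).
    by rewrite (bigD1 j) //= leq_addr.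
  exists p; first by split => //; exact: leq_trans n3 xN.
  by split => //; split => //; exact: leq_trans n4 xN.
apply: finite_image; apply: finite_setX; first exact: finite_ffun.
apply: bigcup_finite; first exact: (Delta2_finite N t Bt).
move=> p _; apply: finite_setX => //.
by have /is_seriesP[_ f _] := That_series (al p.2); exact: f.
Qed.

End OneStep.

(** The right factors of the coproduct have a smaller second bidegree than the
    planted tree. *)
Lemma antip_rhs_ext al be t k tau : Bo tau ->
  (forall c, ((bideg c).2 < (bideg (hatJ t k tau)).2)%N -> al c = be c) ->
  antip_rhs al t k tau = antip_rhs be t k tau.
Proof.
move=> Bt ab; apply/funext => x; congr (- _); apply: eq_fsbigr => l _.
congr (fmul _ (Pplus _ _ _ _) x); apply/funext => c; apply: eq_fsbigr => p _.
case: (eqVneq (Delta2 R (rep tau) p) 0) => [->|Dp]; first by rewrite !mul0r.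
rewrite ab //.
have [A [eps [nA [_ _ [_ h2 _ _ [c' [n [o [P [aP pP]]]]]]]]]] := Delta2_support t k Bt Dp.
apply: leq_trans (h2 k).
rewrite pP hatJ_gr (bi2_iso (dgraph_iso_sym (rep_cls _))) bi2_gr pbi2_plantP.
by rewrite addSn ltnS leq_addl.
Qed.

Section Theta.
Variable phi : L -> mindex -> iclass -> That.

(** The multiplicative map with given values on the planted trees and with
    [X_i] sent to [- X_i]. *)
Definition theta (c : iclass) : That :=
  (-1) ^+ (\sum_(j < d) (root_data c).1 j)%N *:
    mulT (basis (Xmon L (root_data c).1)) (brprod (@mulT R d L s deg rl) phi (root_data c).2).

Lemma theta_gr n (P : ptree d L) : theta (cls (gr 2 n 0 P)) =
  (-1) ^+ (\sum_(j < d) n j)%N *: mulT (basis (Xmon L n)) (brprod (@mulT R d L s deg rl) phi P).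
Proof.
have [e1 e2] := root_dataP n P; rewrite /theta e1; congr (_ *: mulT _ _).
by apply/esym/brprod_iso.
Qed.

Lemma theta_Xmon k : theta (Xmon L k) = (-1) ^+ (\sum_(j < d) k j)%N *: basis (Xmon L k).
Proof.
by rewrite {1}Xmon_gr theta_gr brprod_empty mulTC mul1T.
Qed.

Lemma theta_one : theta (one2 d L) = oneT s deg rl.
Proof.
rewrite -Xmon0 theta_Xmon big1 ?expr0 ?scale1r ?Xmon0 // => j _.
by rewrite ffunE.
Qed.

Lemma mulTZr (k : R) (u v : That) : mulT u (k *: v) = k *: mulT u v.
Proof. by rewrite mulTC mulTZl mulTC. Qed.

Lemma mulTACA : interchange (@mulT R d L s deg rl) (@mulT R d L s deg rl).
Proof.
by move=> a b c e; rewrite -!mulTA [mulT b (mulT c e)]mulTA [mulT b c]mulTC -mulTA.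
Qed.

Lemma theta_mul a b : rooted2 a -> rooted2 b -> theta (tprod a b) = mulT (theta a) (theta b).
Proof.
move=> [n [P ->]] [m [Q ->]]; rewrite tprod_gr !theta_gr brprod_psum.
rewrite mulTZl mulTZr scalerA -exprD; congr (_ ^+ _ *: _).
  by rewrite -big_split; apply: eq_bigr => j _; rewrite ffunE.
rewrite -(XmonD L n m) -(basis_mul (B_plus_Xmon s deg rl n) (B_plus_Xmon s deg rl m)).
exact: mulTACA.
Qed.

Lemma theta_hatJ t k tau : Bo tau -> theta (hatJ t k tau) = phi t k tau.
Proof.
move=> /B_circ_inv[c [n [o [P [[aP _ ->] _]]]]].
rewrite hatJ_gr theta_gr brprod_plantP // big1; last by move=> j _; rewrite ffunE.
by rewrite expr0 scale1r Xmon0 mul1T.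
Qed.
End Theta.

Lemma good_mul a b (u v : That) : Bp a -> Bp b ->
  (forall x, fval u x != 0 -> [/\ ((bideg a).1 <= (bideg x).1)%N,
      ((bideg x).2 <= (bideg a).2)%N, dg x = dg a & 0 < dg x]) ->
  good_image b (fval v) -> good_image (tprod a b) (fval (mulT u v)).
Proof.
move=> Ba Bb gu gv x; rewrite fval_mul => /fmul_supp[y [z [uy vz <-]]].
have ry : rooted2 y by have [f1 _ _] := That_series u; exact: B_plus_rooted2 (f1 _ uy).
have rz : rooted2 z by have [f1 _ _] := That_series v; exact: B_plus_rooted2 (f1 _ vz).
have [ra rb] := (B_plus_rooted2 Ba, B_plus_rooted2 Bb).
have [u1 u2 u3 u4] := gu _ uy; have [v1 v2 v3 v4] := gv _ vz.
rewrite (bideg_tprod ry rz) (bideg_tprod ra rb) /=.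
rewrite (deg_tprod s deg ry rz) (deg_tprod s deg ra rb).
split; [exact: leq_add|exact: leq_add|by rewrite u3 v3|move=> _].
case: (pselect (b = one2 d L)) => [b1|/v4 v0]; last exact: addr_gt0.
by rewrite v3 b1; have [_ ->] := one_grades s deg; rewrite addr0.
Qed.

Definition step_J al (t : L) (k : mindex) (tau : iclass) : That :=
  to_That s deg rl (antip_rhs al t k tau).

Definition step al (c : iclass) : That :=
  if pselect (Bp c) then theta (step_J al) c else 0.

Lemma fval_step_J al t k tau : good_map al -> Bo tau ->
  fval (step_J al t k tau) = antip_rhs al t k tau.
Proof. by move=> ga Bt; rewrite fval_to_That //; exact: antip_rhs_series. Qed.

Lemma fval0 c : fval (0 : That) c = 0. Proof. by []. Qed.

Lemma munit_sum i : (\sum_(j < d) munit i j = 1)%N.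
Proof.
by rewrite (bigD1 i) //= ffunE eqxx big1 // => j /negbTE ji; rewrite ffunE ji.
Qed.

Lemma mnorm_munit i : mnorm s (munit i) = s i.
Proof.
rewrite /mnorm (bigD1 i) //= ffunE eqxx mul1r big1 ?addr0 // => j /negbTE ji.
by rewrite ffunE ji mul0r.
Qed.

Lemma theta_X phi i : theta phi (Xmon L (munit i)) = - XT s deg rl i.
Proof. by rewrite theta_Xmon munit_sum expr1 scaleN1r. Qed.

Lemma ind_neq0 (u v : iclass) : ind R u v != 0 -> v = u.
Proof. by rewrite /ind; case: (eqVneq v u) => [-> //|_]; rewrite eqxx. Qed.

Lemma theta_good al : good_map al ->
  forall c, Bp c -> good_image c (fval (theta (step_J al) c)).
Proof.
move=> ga; apply: B_plus_ind.
- move=> x; rewrite theta_one fval_basis; last exact: B_plus_one.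
  by move=> /ind_neq0 ->; split.
- move=> i c Bc gc; rewrite theta_mul ?theta_X; last 2 first.
  + exact: rooted2_Xmon.
  + exact: B_plus_rooted2 Bc.
  apply: good_mul => //; first exact: B_plus_Xmon.
  move=> x; rewrite -[fval _ x]/(- fval (XT s deg rl i) x) oppr_eq0.
  rewrite fval_basis; last exact: B_plus_Xmon.
  move=> /ind_neq0 ->; split => //; have [_ ->] := Xmon_grades s deg (munit i : mindex).
  by rewrite mnorm_munit (lt_le_trans ltr01).
- move=> t k tau c Bt BJ Bc gc; rewrite theta_mul ?theta_hatJ //; last 2 first.
  + exact: B_plus_rooted2 BJ.
  + exact: B_plus_rooted2 Bc.
  apply: good_mul => // x; rewrite fval_step_J //; exact: antip_rhs_good.
Qed.

Lemma step_good al : good_map al -> good_map (step al).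
Proof.
move=> ga c; rewrite /step; case: pselect => [Bc|nB] /=; last by move=> x /eqP[].
exact: theta_good.
Qed.

Lemma step_ext al be N : (forall c, ((bideg c).2 < N)%N -> al c = be c) ->
  forall c, ((bideg c).2 <= N)%N -> step al c = step be c.
Proof.
move=> ab c; rewrite /step; case: pselect => [Bc|nB] /=; last by [].
move: c Bc; apply: (@B_plus_ind R d L s deg rl (fun c => ((bideg c).2 <= N)%N ->
  theta (step_J al) c = theta (step_J be) c)) => [_|i c Bc IH|t k tau c Bt BJ Bc IH].
- by rewrite !theta_one.
- have [rX rc] := (rooted2_Xmon L (munit i : mindex), B_plus_rooted2 Bc).
  rewrite (bideg_tprod rX rc) => le.
  rewrite (theta_mul _ rX rc) (theta_mul _ rX rc) !theta_X IH; first by [].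
  exact: leq_trans (leq_addl _ _) le.
- have [rJ rc] := (B_plus_rooted2 BJ, B_plus_rooted2 Bc).
  rewrite (bideg_tprod rJ rc) => le.
  rewrite (theta_mul _ rJ rc) (theta_mul _ rJ rc) (theta_hatJ _ t k Bt) (theta_hatJ _ t k Bt).
  have -> : theta (step_J al) c = theta (step_J be) c.
    by apply: IH; exact: leq_trans (leq_addl _ _) le.
  rewrite /step_J (@antip_rhs_ext al be _ _ _ Bt); first by [].
  move=> c' lt; apply: ab; exact: leq_trans lt (leq_trans (leq_addr _ _) le).
Qed.

(** The value at [c] no longer changes once [m] exceeds the second component of
    the bidegree of [c]; see [approx_stable]. *)
Definition approx (m : nat) : iclass -> That := iter m step (fun=> 0).

Lemma approxS m c : approx m.+1 c = step (approx m) c. Proof. by []. Qed.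

Lemma approx_good m : good_map (approx m).
Proof.
elim: m => [c x|m IH] /=; first by move=> /eqP[].
exact: step_good.
Qed.

Lemma approx_stable m m' c : ((bideg c).2 < m <= m')%N -> approx m c = approx m' c.
Proof.
elim: m m' c => [//|m IH] [|m'] c; first by rewrite andbF.
rewrite !ltnS => /andP[cm mm'].
by rewrite !approxS; apply: step_ext cm => c' c'm; apply: IH; rewrite c'm.
Qed.

Definition antip (c : iclass) : That := approx (bideg c).2.+1 c.

Lemma antip_good : good_map antip.
Proof. by move=> c; exact: approx_good. Qed.

Lemma antip_fix c : antip c = step antip c.
Proof.
rewrite {1}/antip; rewrite approxS; apply: step_ext (leqnn (bideg c).2) => c' lt.
by apply/esym/approx_stable; rewrite ltnSn.
Qed.

Lemma antip_out c : ~ Bp c -> antip c = 0.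
Proof. by move=> nB; rewrite antip_fix /step; case: pselect. Qed.

Lemma antip_theta c : Bp c -> antip c = theta (step_J antip) c.
Proof. by move=> Bc; rewrite {1}antip_fix /step; case: pselect. Qed.

Lemma antip_one : antip (one2 d L) = oneT s deg rl.
Proof. by rewrite (antip_theta (B_plus_one s deg rl)) theta_one. Qed.

Lemma antip_mul a b : Bp a -> Bp b -> antip (tprod a b) = mulT (antip a) (antip b).
Proof.
move=> Ba Bb; rewrite (antip_theta Ba) (antip_theta Bb) (antip_theta (B_plus_tprod Ba Bb)).
exact: theta_mul (B_plus_rooted2 Ba) (B_plus_rooted2 Bb).
Qed.

Lemma antip_X i : antip (Xmon L (munit i)) = - XT s deg rl i.
Proof. by rewrite (antip_theta (B_plus_Xmon s deg rl _)) theta_X. Qed.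

Lemma antip_hatJ t k tau : Bo tau -> Bp (hatJ t k tau) ->
  fval (antip (hatJ t k tau)) = antip_rhs antip t k tau.
Proof.
move=> Bt BJ; rewrite (antip_theta BJ) (theta_hatJ _ t k Bt); apply: fval_step_J Bt; exact: antip_good.
Qed.

(** The recursion preserves the degree, while all its values have positive
    degree. *)
Lemma antip_neg a : a <> one2 d L -> dg a <= 0 -> antip a = 0.
Proof.
move=> a1 da; apply: fval_inj; apply/funext => x; apply/eqP.
apply: contraT => /antip_good[_ _ dx /(_ a1)].
by rewrite dx ltNge da.
Qed.

Lemma gr2_roots n (P : ptree d L) (g : dgraph d L) : dgraph_iso (gr 2 n 0 P) g ->
  [/\ forall e : edge g, ecol e = 0%N,
      forall x : node g, isroot x -> ncol x = 2%N /\ odec x = 0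
    & exists x : node g, isroot x].
Proof.
case=> fN [fE [bN bE st nn ee]]; have [fN' fK f'K] := bN; have [fE' fEK fE'K] := bE.
split.
- by move=> e; rewrite -[e]fE'K; have [_ -> _] := ee (fE' e).
- move=> x; rewrite -[x]f'K (iso_isroot bN bE st) isroot_gr => /eqP ->.
  by have [-> _ ->] := nn None.
- by exists (fN None); rewrite (iso_isroot bN bE st) isroot_gr.
Qed.

Lemma JKhat2_union (a b : iclass) : rooted2 a -> rooted2 b ->
  cls (JKhat2 (dunion (rep a) (rep b))) = tprod a b.
Proof.
move=> [n [P aP]] [m [Q bQ]]; apply/cls_eqP.
have /gr2_roots[ea ra [x rx]] : dgraph_iso (gr 2 n 0 P) (rep a).
  by rewrite aP; exact/dgraph_iso_sym/rep_cls.
have /gr2_roots[eb rb _] : dgraph_iso (gr 2 m 0 Q) (rep b).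
  by rewrite bQ; exact/dgraph_iso_sym/rep_cls.
apply: (@JKhat2_trivial d L (dunion (rep a) (rep b)) (inl x)).
- by case.
- case=> y /isrootP ry; [apply: ra|apply: rb]; apply/isrootP => e ey.
    exact: (ry (inl e)) (congr1 inl ey).
  exact: (ry (inr e)) (congr1 inr ey).
- by move/isrootP: rx => rx; apply/isrootP; case=> e //= [] /rx.
Qed.

Lemma antip_ideal c : B_ideal s deg rl c -> antip c = 0.
Proof.
move=> [Bc [a [b [Ba Bb a1 da ->]]]].
rewrite (JKhat2_union (B_plus_rooted2 Ba) (B_plus_rooted2 Bb)) (antip_mul Ba Bb).
rewrite (antip_neg a1 da); apply: fval_inj; apply/funext => x; rewrite fval_mul.
by apply: fsbig1 => p _; rewrite fval0 mul0r.
Qed.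

End Recursion.

(** * Existence and uniqueness *)

Section Extension.
Variables (R : realType) (d : nat) (L : finType).
Variables (s : 'I_d -> R) (deg : L -> R) (rl : rule d L).
Hypothesis hs : forall j, 1 <= s j.
Local Notation iclass := (iclass d L).
Local Notation Bp := (B_plus s deg rl).
Local Notation That := (@That R d L s deg rl).
Local Notation basis := (basis s deg rl).
Local Notation antip := (@antip R d L s deg rl).

Definition antipF (v : That) : iclass -> R := fun c =>
  \sum_(tau \in [set: iclass]) fval v tau * fval (antip tau) c.

Lemma antipF_finite (v : That) c :
  finite_set [set tau | fval v tau * fval (antip tau) c != 0].
Proof.
have /is_seriesP[_ f _] := That_series v.
apply: sub_finite_set (f (bideg c).1) => tau /=.
rewrite mulf_eq0 negb_or => /andP[vt /(antip_good hs)[le _ _ _]].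
by split.
Qed.

Lemma antipF_seq (v : That) c (r : seq iclass) : uniq r ->
  (forall tau, fval v tau != 0 -> ((bideg tau).1 <= (bideg c).1)%N -> tau \in r) ->
  antipF v c = \sum_(tau <- r) fval v tau * fval (antip tau) c.
Proof.
move=> ur vr; rewrite /antipF (fsum_seq ur).
  by apply: eq_bigl => tau; apply/mem_set.
move=> tau _; rewrite mulf_eq0 negb_or => /andP[vt /(antip_good hs)[le _ _ _]].
exact: vr.
Qed.

Lemma antipF_series v : is_series Bp (antipF v).
Proof.
have nz c : antipF v c != 0 -> exists2 tau, fval v tau != 0 & fval (antip tau) c != 0.
  move=> H; have [tau _] := @fsbigN1 _ _ _ unit _ _
    (fun _ tau => fval v tau * fval (antip tau) c) tt H.
  by rewrite mulf_eq0 negb_or => /andP[vt ac]; exists tau.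
have [v1 v2 [k v3]] := (is_seriesP _ _).1 (That_series v).
apply/is_seriesP; split.
- by move=> c /nz[tau _ ac]; have [f _ _] := That_series (antip tau); exact: f.
- move=> N; apply: (sub_finite_set (B := \bigcup_(tau in
      [set tau | fval v tau != 0 /\ ((bideg tau).1 <= N)%N])
      [set c | fval (antip tau) c != 0 /\ ((bideg c).1 <= N)%N])).
    move=> c [/nz[tau vt ac] cN]; exists tau => //; split => //.
    by have [le _ _ _] := antip_good hs ac; exact: leq_trans le cN.
  apply: bigcup_finite => // tau _.
  by have [_ f _] := (is_seriesP _ _).1 (That_series (antip tau)); exact: f.
- exists k => c /nz[tau vt ac]; have [_ le _ _] := antip_good hs ac.
  exact: leq_trans le (v3 _ vt).
Qed.

Definition antipV (v : That) : That := to_That s deg rl (antipF v).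

Lemma fval_antipV v : fval (antipV v) = antipF v.
Proof. by rewrite fval_to_That //; exact: antipF_series. Qed.

(** As the first component of the bidegree does not decrease, the terms of [v]
    in this set suffice to compute the coefficients of its image up to [N]. *)
Definition carrier (v : That) (N : nat) : seq iclass :=
  fset_set [set c | fval v c != 0 /\ ((bideg c).1 <= N)%N].

Lemma carrierP v N c : fval v c != 0 -> ((bideg c).1 <= N)%N -> c \in carrier v N.
Proof.
move=> vc cN; rewrite /carrier in_fset_set ?mem_set //.
by have [_ f _] := (is_seriesP _ _).1 (That_series v); exact: f.
Qed.

Lemma antipV_linear (a : R) (u v : That) : antipV (a *: u + v) = a *: antipV u + antipV v.
Proof.
apply: fval_inj; apply/funext => c; rewrite fvalD fvalZ !fval_antipV.
pose r := undup (carrier u (bideg c).1 ++ carrier v (bideg c).1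
  ++ carrier (a *: u + v) (bideg c).1).
have ur : uniq r by exact: undup_uniq.
rewrite !(antipF_seq ur); last 3 first.
- by move=> tau t1 t2; rewrite mem_undup !mem_cat (carrierP t1 t2) ?orbT.
- by move=> tau t1 t2; rewrite mem_undup !mem_cat (carrierP t1 t2) ?orbT.
- by move=> tau t1 t2; rewrite mem_undup !mem_cat (carrierP t1 t2) ?orbT.
rewrite mulr_sumr -big_split; apply: eq_bigr => tau _ /=.
by rewrite fvalD fvalZ mulrDl mulrA.
Qed.

Lemma antipV0 : antipV 0 = 0.
Proof.
apply: fval_inj; apply/funext => c; rewrite fval_antipV; apply: fsbig1 => tau _.
by rewrite fval0 mul0r.
Qed.

Lemma antipV_basis c : antipV (basis c) = antip c.
Proof.
have [Bc|nB] := pselect (Bp c); last by rewrite basis_out // antipV0 antip_out.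
apply: fval_inj; apply/funext => x; rewrite fval_antipV.
rewrite /antipF (fsum_seq (r := [:: c])) //; last first.
  move=> tau _; rewrite fval_basis // mulf_eq0 negb_or => /andP[/ind_neq0 -> _].
  by rewrite inE.
rewrite big_mkcond big_seq1 mem_set // fval_basis //.
by rewrite /ind eqxx mul1r.
Qed.

(** For a given coefficient both sides are finite sums over pairs of terms of [u]
    and [v], which reduces the claim to the basis. *)
Lemma antipV_mul u v : antipV (mulT u v) = mulT (antipV u) (antipV v).
Proof.
apply: fval_inj; apply/funext => c; rewrite fval_antipV fval_mul.
set N := (bideg c).1.
have [u1 _ _] := That_series u; have [v1 _ _] := That_series v.
pose U := carrier u N; pose V := carrier v N.
have uU : uniq U by exact: fset_uniq.
have uV : uniq V by exact: fset_uniq.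
pose W := undup [seq tprod a b | a <- U, b <- V].
have uW : uniq W by exact: undup_uniq.
have inUV a b : fval u a != 0 -> fval v b != 0 -> ((bideg (tprod a b)).1 <= N)%N ->
    a \in U /\ b \in V.
  move=> ua vb; have [ra rb] := (B_plus_rooted2 (u1 _ ua), B_plus_rooted2 (v1 _ vb)).
  rewrite (bideg_tprod ra rb) => le; split; apply: carrierP => //.
    exact: leq_trans (leq_addr _ _) le.
  exact: leq_trans (leq_addl _ _) le.
transitivity (\sum_(a <- U) \sum_(b <- V) fval u a * fval v b * fval (antip (tprod a b)) c).
  rewrite (antipF_seq uW); last first.
    move=> tau; rewrite fval_mul => /fmul_supp[a [b [ua vb <-]]] le.
    have [aU bV] := inUV _ _ ua vb le.
    by rewrite mem_undup; apply: allpairs_f.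
  transitivity (\sum_(tau <- W) \sum_(a <- U) \sum_(b <- V)
      (tprod a b == tau)%:R * (fval u a * fval v b) * fval (antip tau) c).
    apply: eq_bigr => tau _; case: (eqVneq (fval (antip tau) c) 0) => [->|ac].
      rewrite mulr0 big1 // => a _; rewrite big1 // => b _; by rewrite mulr0.
    have [le _ _ _] := antip_good hs ac.
    rewrite fval_mul (fmul_seq uU uV) => [|a b ua vb ab]; last first.
      by apply: inUV => //; rewrite ab.
    rewrite mulr_suml; apply: eq_bigr => a _; rewrite mulr_suml; apply: eq_bigr => b _.
    by [].
  rewrite exchange_big big_seq [RHS]big_seq; apply: eq_bigr => a aU.
  rewrite exchange_big big_seq [RHS]big_seq; apply: eq_bigr => b bV.
  rewrite (bigD1_seq (tprod a b)) //= ?eqxx ?mul1r; last first.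
    by rewrite mem_undup; apply: allpairs_f.
  rewrite big1 ?addr0 // => tau; rewrite eq_sym => /negbTE ->.
  by rewrite !mul0r.
have uD := divs_uniq c.
rewrite (fmulE uD) //; try exact: That_supp2.
have nD x : x \in divs c -> ((bideg x).1 <= N)%N.
  move=> /divsP[rx [y ry xy]]; by rewrite /N -xy (bideg_tprod rx ry) leq_addr.
transitivity (\sum_(x <- divs c) \sum_(y <- divs c) \sum_(a <- U) \sum_(b <- V)
   (tprod x y == c)%:R * ((fval u a * fval v b) * (fval (antip a) x * fval (antip b) y))).
  transitivity (\sum_(a <- U) \sum_(b <- V) \sum_(x <- divs c) \sum_(y <- divs c)
   (tprod x y == c)%:R * ((fval u a * fval v b) * (fval (antip a) x * fval (antip b) y))).
    apply: eq_bigr => a _; apply: eq_bigr => b _.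
    case: (eqVneq (fval u a) 0) => [->|ua].
      by rewrite !mul0r big1 // => x _; rewrite big1 // => y _; rewrite !(mul0r, mulr0).
    case: (eqVneq (fval v b) 0) => [->|vb].
      by rewrite mulr0 mul0r big1 // => x _; rewrite big1 // => y _; rewrite !(mul0r, mulr0).
    rewrite (antip_mul (u1 _ ua) (v1 _ vb)) fval_mul (fmulE uD) //; try exact: That_supp2.
    rewrite mulr_sumr; apply: eq_bigr => x _; rewrite mulr_sumr; apply: eq_bigr => y _.
    ring.
  transitivity (\sum_(a <- U) \sum_(x <- divs c) \sum_(y <- divs c) \sum_(b <- V)
   (tprod x y == c)%:R * ((fval u a * fval v b) * (fval (antip a) x * fval (antip b) y))).
    apply: eq_bigr => a _; rewrite exchange_big; apply: eq_bigr => x _.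
    by rewrite exchange_big.
  rewrite [LHS]exchange_big; apply: eq_bigr => x _.
  by rewrite [LHS]exchange_big.
rewrite [LHS]big_seq [RHS]big_seq; apply: eq_bigr => x xD.
rewrite [LHS]big_seq [RHS]big_seq; apply: eq_bigr => y yD.
rewrite !fval_antipV (antipF_seq uU) => [|tau ut le]; last first.
  by apply: carrierP => //; exact: leq_trans le (nD _ xD).
rewrite (antipF_seq uV) => [|tau ut le]; last first.
  by apply: carrierP => //; exact: leq_trans le (nD _ yD).
rewrite mulr_suml mulr_sumr; apply: eq_bigr => a _.
rewrite mulr_sumr mulr_sumr; apply: eq_bigr => b _.
ring.
Qed.

Lemma antipV_ideal (v : That) : v \in @Jminus R d L s deg rl -> antipV v = 0.
Proof.
rewrite unfold_in => /asboolP[v1 _ _]; apply: fval_inj; apply/funext => c.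
rewrite fval_antipV; apply: fsbig1 => tau _.
case: (eqVneq (fval v tau) 0) => [->|/v1 Bi]; first by rewrite mul0r.
by rewrite (antip_ideal hs Bi) fval0 mulr0.
Qed.

Definition antipode (x : Tplus s deg rl) : That := antipV (repr x).

Lemma antipode_pT v : antipode (pT v) = antipV v.
Proof.
have : repr (pT v) - v \in @Jminus R d L s deg rl.
  by rewrite Quotient.idealrBE reprK.
move=> /antipV_ideal; rewrite -[repr _ - v]addrC -scaleN1r antipV_linear scaleN1r.
by rewrite addrC => /eqP; rewrite subr_eq0 => /eqP.
Qed.

Lemma antipode_basis c : antipode (pT (basis c)) = antip c.
Proof. by rewrite antipode_pT antipV_basis. Qed.

Lemma antipode_algebra_morphism : algebra_morphism antipode.
Proof.
split.
- by move=> a u v /=; rewrite !antipode_pT antipV_linear.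
- by rewrite /oneT antipode_basis antip_one.
- by move=> u v /=; rewrite !antipode_pT antipV_mul.
- move=> v c; split.
    apply: sub_finite_set (antipF_finite v c) => tau /=.
    by rewrite antipode_basis.
  rewrite antipode_pT fval_antipV; apply: eq_fsbigr => tau _.
  by rewrite antipode_basis.
Qed.

Lemma antipode_triangular : triangular antipode.
Proof.
by move=> tau c Bt; rewrite antipode_basis => /(antip_good hs)[].
Qed.

End Extension.

Section Uniqueness.
Variables (R : realType) (d : nat) (L : finType).
Variables (s : 'I_d -> R) (deg : L -> R) (rl : rule d L).
Local Notation iclass := (iclass d L).
Local Notation Bp := (B_plus s deg rl).
Local Notation That := (@That R d L s deg rl).
Local Notation basis := (basis s deg rl).

Definition antipode_eqs (A : Tplus s deg rl -> That) : Prop :=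
  [/\ algebra_morphism A,
      forall i : 'I_d, A (pT (XT s deg rl i)) = - XT s deg rl i
    & forall (t : L) (k : mindex d) (tau : iclass),
        B_circ s deg rl tau -> Bp (hatJ t k tau) ->
        fval (A (calJ s deg rl t k tau)) = antip_rhs (fun c => A (pT (basis c))) t k tau].

Lemma morphism0 (A : Tplus s deg rl -> That) : algebra_morphism A -> A (pT 0) = 0.
Proof.
move=> [lin _ _ _]; have := lin (- 1) 0 0; rewrite /= scaler0 add0r scaleN1r.
by rewrite addNr.
Qed.

(** The equation for a planted tree involves smaller values only, and products
    of planted trees and of the [X_i] exhaust the basis. *)
Lemma antipode_unique (A A' : Tplus s deg rl -> That) :
  antipode_eqs A -> antipode_eqs A' -> A = A'.
Proof.
move=> [mA XA JA] [mA' XA' JA'].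
have [_ oneA mulA serA] := mA; have [_ oneA' mulA' serA'] := mA'.
have onB c : A (pT (basis c)) = A' (pT (basis c)).
  suff H N : forall c, ((bideg c).2 < N)%N -> A (pT (basis c)) = A' (pT (basis c)).
    exact: (H (bideg c).2.+1).
  elim: N => // N IH {}c cN; have [Bc|nB] := pselect (Bp c); last first.
    by rewrite basis_out // !morphism0.
  move: c Bc cN; apply: (@B_plus_ind R d L s deg rl (fun c => ((bideg c).2 < N.+1)%N ->
     A (pT (basis c)) = A' (pT (basis c)))) => [_|i c Bc Hc|t k tau c Bt BJ Bc Hc].
  - by rewrite -/(oneT s deg rl) oneA oneA'.
  - have [rX rc] := (rooted2_Xmon L (munit i : mindex d), B_plus_rooted2 Bc).
    rewrite (bideg_tprod rX rc) => le.
    rewrite -(basis_mul (B_plus_Xmon s deg rl (munit i)) Bc).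
    have -> : A (pT (mulT (basis (Xmon L (munit i))) (basis c))) =
      mulT (A (pT (XT s deg rl i))) (A (pT (basis c))) by exact: mulA.
    have -> : A' (pT (mulT (basis (Xmon L (munit i))) (basis c))) =
      mulT (A' (pT (XT s deg rl i))) (A' (pT (basis c))) by exact: mulA'.
    rewrite XA XA' Hc; first by [].
    exact: leq_ltn_trans (leq_addl _ _) le.
  - have [rJ rc] := (B_plus_rooted2 BJ, B_plus_rooted2 Bc).
    rewrite (bideg_tprod rJ rc) => le.
    rewrite -(basis_mul BJ Bc).
    have -> : A (pT (mulT (basis (hatJ t k tau)) (basis c))) =
      mulT (A (calJ s deg rl t k tau)) (A (pT (basis c))) by exact: mulA.
    have -> : A' (pT (mulT (basis (hatJ t k tau)) (basis c))) =
      mulT (A' (calJ s deg rl t k tau)) (A' (pT (basis c))) by exact: mulA'.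
    have -> : A (pT (basis c)) = A' (pT (basis c)).
      by apply: Hc; exact: leq_ltn_trans (leq_addl _ _) le.
    have -> : A (calJ s deg rl t k tau) = A' (calJ s deg rl t k tau); last by [].
    apply: fval_inj; rewrite (JA _ _ _ Bt BJ) (JA' _ _ _ Bt BJ).
    apply: (antip_rhs_ext Bt) => c' lt; apply: IH; apply: leq_trans lt _.
    exact: leq_trans (leq_addr _ _) le.
apply/funext => x; rewrite -[x]reprK; apply: fval_inj; apply/funext => c.
have [_ e] := serA (repr x) c; have [_ e'] := serA' (repr x) c.
rewrite -[\pi_ _ _]/(pT (repr x)) e e'; apply: eq_fsbigr => tau _.
by rewrite onB.
Qed.

End Uniqueness.

Theorem proposition6p3 (R : realType) (d : nat) (L : finType)
    (s : 'I_d -> R) (deg : L -> R) (rl : rule d L)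
    (hd : (0 < d)%N) (hs : forall j, 1 <= s j) (hdeg : forall t, deg t != 0)
    (hrl : forall t, rl t !=set0)
    (hsub : subcritical s deg rl) (hcomplete : complete_rule s deg rl)
    (hneg : forall t, deg t < 0 -> rl t = [set mset0]) :
  exists A : Tplus s deg rl -> That s deg rl,
    triangular A /\
    unique (fun A : Tplus s deg rl -> That s deg rl =>
      [/\ algebra_morphism A,
          forall i : 'I_d, A (pT (XT s deg rl i)) = - XT s deg rl i
        & forall (t : L) (k : mindex d) (tau : iclass d L),
            B_circ s deg rl tau -> B_plus s deg rl (hatJ t k tau) ->
            fval (A (calJ s deg rl t k tau)) = fun c : iclass d L =>
              - \sum_(l \in [set: mindex d])
                  fmul (negXpow R l)
                    (Pplus s deg rl (MJA A t (k + l) tau)) c]) A.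
Proof.
exists (@antipode R d L s deg rl); split; first exact: antipode_triangular.
have eqs : antipode_eqs (@antipode R d L s deg rl).
  split; first exact: antipode_algebra_morphism.
    by move=> i; rewrite /XT antipode_basis // antip_X.
  move=> t k tau Bt BJ; rewrite /calJ antipode_basis // antip_hatJ //.
  by congr (antip_rhs _ t k tau); apply/funext => c; rewrite antipode_basis.
by split => // A' eqs'; exact: antipode_unique eqs eqs'.
Qed.
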